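(* Let $(p_n)$ be a sequence of positive integers with $p_n\to\infty$ and $p_n/n\to0$. Let $\widehat\tau_n=\widehat\tau_n(Y^n)$ be any estimator for which there exists a constant $C>0$ such that $$\inf_{\theta_0\in\ell_0[p_n]}P_{\theta_0}\big(\widehat\tau_n\in[1/n,\,C\tau_n(p_n)]\big)\to1 .$$ Then for every sequence $M_n\to\infty$, $$\sup_{\theta_0\in\ell_0[p_n]}\mathrm E_{\theta_0}\,\Pi_{\widehat\tau_n}\Big(\theta:\ \|\theta_0-\theta\|_2\ge M_n\sqrt{p_n\log n}\ \Big|\ Y^n\Big)\to0 .$$ In particular, this holds for $\widehat\tau_n$ equal to the maximum marginal likelihood estimator $$\widehat\tau_M=\operatorname*{argmax}_{\tau\in[1/n,1]}\ \prod_{i=1}^n\int_{-\infty}^\infty\varphi(Y_i-\theta)g_\tau(\theta)\,d\theta .$$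
   Context: Model: under $P_{\theta_0}$ (expectation $\mathrm E_{\theta_0}$), with $\theta_0\in\mathbb R^n$, one observes $Y^n=(Y_1,\dots,Y_n)$ with independent $Y_i\sim N(\theta_{0,i},1)$. $\ell_0[p]=\{\theta\in\mathbb R^n:\ \#\{i:\theta_i\neq0\}\le p\}$, $\tau_n(p)=(p/n)\sqrt{\log(n/p)}$, and $\varphi$ is the standard normal density. Horseshoe prior with parameter $\tau>0$: $\theta_1,\dots,\theta_n$ are i.i.d. with density $g_\tau(\theta)=\int_0^\infty\varphi\big(\frac{\theta}{\lambda\tau}\big)\frac1{\lambda\tau}\frac{2}{\pi(1+\lambda^2)}\,d\lambda$. For fixed $\tau$, $\Pi_\tau(\cdot\mid Y^n)$ is the posterior distribution of $\theta$ under this prior and the likelihood $Y_i\mid\theta\sim N(\theta_i,1)$ independent, i.e. the probability measure on $\mathbb R^n$ with density proportional to $\prod_{i=1}^n\varphi(Y_i-\theta_i)g_\tau(\theta_i)$. The empirical Bayes posterior $\Pi_{\widehat\tau_n}(\cdot\mid Y^n)$ is obtained by substituting $\tau=\widehat\tau_n(Y^n)$ in $\Pi_\tau(\cdot\mid Y^n)$. *)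

(* Defs.v *)
From HB Require Import structures.
From mathcomp Require Import all_boot all_order all_algebra.
From mathcomp Require Import all_classical all_reals all_analysis.

Set Implicit Arguments.
Unset Strict Implicit.
Unset Printing Implicit Defensive.

Import Order.TTheory GRing.Theory Num.Theory.
Import numFieldNormedType.Exports.

Local Open Scope classical_set_scope.
Local Open Scope ring_scope.

Section tuple_cons.
Context d (T : measurableType d) (n : nat).

Definition tuple_cons (x : T * n.-tuple T) : n.+1.-tuple T :=
  [the n.+1.-tuple T of x.1 :: x.2].

Lemma measurable_tuple_cons : measurable_fun [set: T * n.-tuple T] tuple_cons.
Proof. exact: measurable_cons. Qed.

HB.instance Definition _ :=
  isMeasurableFun.Build _ _ _ _ tuple_cons measurable_tuple_cons.

Definition tuple_uncons (t : n.+1.-tuple T) : T * n.-tuple T :=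
  (tnth t ord0, [tuple of behead t]).

Lemma measurable_tuple_uncons :
  measurable_fun [set: n.+1.-tuple T] tuple_uncons.
Proof.
by apply: measurable_fun_pair; [exact: measurable_tnth|exact: measurable_behead].
Qed.

Lemma tuple_consK : cancel tuple_cons tuple_uncons.
Proof. by move=> [x t]; congr pair; apply: val_inj. Qed.

Lemma tuple_unconsK : cancel tuple_uncons tuple_cons.
Proof. by move=> t; rewrite [RHS]tuple_eta; apply: val_inj. Qed.

End tuple_cons.

Section cons_measure.
Local Open Scope ereal_scope.
Context d (T : measurableType d) (R : realType) (n : nat).
Context (mu : {sigma_finite_measure set T -> \bar R}).
Context (nu : {sigma_finite_measure set (n.-tuple T) -> \bar R}).

Definition cons_measure : set (n.+1.-tuple T) -> \bar R :=
  pushforward (mu \x nu) (@tuple_cons _ T n).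

Let cons_measure0 : cons_measure set0 = 0.
Proof. by rewrite /cons_measure /pushforward preimage_set0 measure0. Qed.

Let cons_measure_ge0 A : 0 <= cons_measure A.
Proof. exact: measure_ge0. Qed.

Let cons_measure_sigma_additive : semi_sigma_additive cons_measure.
Proof.
exact: measure_semi_sigma_additive.
Qed.

HB.instance Definition _ := isMeasure.Build _ _ _ cons_measure
  cons_measure0 cons_measure_ge0 cons_measure_sigma_additive.

Let cons_measure_sigma_finite : sigma_finite setT cons_measure.
Proof.
have /sigma_finiteP[F [TF ndF Foo]] := sigma_finiteT mu.
have /sigma_finiteP[G [TG ndG Goo]] := sigma_finiteT nu.
exists (fun k => @tuple_uncons _ T n @^-1` (F k `*` G k)).
  rewrite -preimage_bigcup -(preimage_setT (@tuple_uncons _ T n)).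
  congr preimage; apply/seteqP; split => // -[x t] _.
  have [k _ Fkx] : (\bigcup_i F i) x by rewrite -TF.
  have [l _ Glt] : (\bigcup_i G i) t by rewrite -TG.
  exists (maxn k l) => //; split.
    by move: x Fkx; exact/subsetPset/ndF/leq_maxl.
  by move: t Glt; exact/subsetPset/ndG/leq_maxr.
move=> k; have [mF Fk] := Foo k; have [mG Gk] := Goo k; split.
  rewrite -[X in measurable X]setTI; apply: measurable_tuple_uncons => //.
  exact: measurableX.
rewrite /cons_measure /pushforward -comp_preimage.
rewrite (_ : _ \o _ = id); last by apply/funext => x /=; rewrite tuple_consK.
by rewrite preimage_id product_measure1E// lte_mul_pinfty// ge0_fin_numE.
Qed.

HB.instance Definition _ := Measure_isSigmaFinite.Build _ _ _ cons_measure
  cons_measure_sigma_finite.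

End cons_measure.

(* Product measure mu_0 x ... x mu_(n-1), characterized by tuple_measure_box. *)
Fixpoint tuple_measure d (T : measurableType d) (R : realType) (n : nat) :
    ('I_n -> {sigma_finite_measure set T -> \bar R}) ->
    {sigma_finite_measure set (n.-tuple T) -> \bar R} :=
  match n with
  | 0%N => fun _ => \d_([tuple] : 0.-tuple T)
  | n'.+1 => fun mu =>
      cons_measure (mu ord0) (tuple_measure (fun i => mu (lift ord0 i)))
  end.

Section tuple_measure_box.
Local Open Scope ereal_scope.
Context d (T : measurableType d) (R : realType).

Lemma measurable_box n (A : 'I_n -> set T) : (forall i, measurable (A i)) ->
  measurable [set t : n.-tuple T | forall i, A i (tnth t i)].
Proof.
move=> mA.
rewrite (_ : mkset _ = \bigcap_(i in [set: 'I_n]) ((fun t => tnth t i) @^-1` A i)).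
  apply: fin_bigcap_measurable => // i _.
  by rewrite -[X in measurable X]setTI; exact: measurable_tnth.
by apply/seteqP; split => t /= At i => [_|]; exact: At.
Qed.

Lemma tuple_measure_box n (mu : 'I_n -> {sigma_finite_measure set T -> \bar R})
    (A : 'I_n -> set T) : (forall i, measurable (A i)) ->
  tuple_measure mu [set t | forall i, A i (tnth t i)] = \prod_(i < n) mu i (A i).
Proof.
elim: n mu A => [|n ih] mu A mA.
  rewrite big_ord0 /= diracE mem_set//= => -[].
  by case.
rewrite big_ord_recl /= -ih//.
have mB := measurable_box (fun i => mA (lift ord0 i)).
rewrite /cons_measure /pushforward -product_measure1E//.
congr (_ _); apply/seteqP; split => -[x t] /=.
  move=> At; split => [|i]; first exact: (At ord0).
  by have := At (lift ord0 i); rewrite tnthS.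
move=> [Ax At] i; by case: (unliftP ord0 i) => [j|] ->; rewrite ?tnthS.
Qed.

End tuple_measure_box.

(* R^n with its Borel sigma-algebra: measurableTypeR R is R with the sigma-algebra
   on which Lebesgue measure and normal_prob are defined. *)
Notation borel_tuple R n := (n.-tuple (measurableTypeR R)).

Section horseshoe.
Context {R : realType}.
Implicit Types (n p : nat) (t : R).

Section sequence_model.
Context (n : nat) (theta0 : n.-tuple R).

Let law : {sigma_finite_measure set (borel_tuple R n) -> \bar R} :=
  tuple_measure (fun i => normal_prob (tnth theta0 i) 1).

Definition data_law : set (borel_tuple R n) -> \bar R := law.

Let data_law0 : data_law set0 = 0%E. Proof. exact: (measure0 law). Qed.

Let data_law_ge0 A : (0 <= data_law A)%E. Proof. exact: (measure_ge0 law). Qed.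

Let data_law_sigma_additive : semi_sigma_additive data_law.
Proof. exact: (@measure_semi_sigma_additive _ _ _ law). Qed.

HB.instance Definition _ := isMeasure.Build _ _ _ data_law
  data_law0 data_law_ge0 data_law_sigma_additive.

Let data_law_setT : data_law setT = 1%E.
Proof.
have := tuple_measure_box (fun i => normal_prob (tnth theta0 i) 1)
  (fun=> measurableT).
rewrite (_ : mkset _ = setT); last by apply/seteqP; split.
by rewrite big1 => // i _; exact: probability_setT.
Qed.

HB.instance Definition _ := Measure_isProbability.Build _ _ _ data_law
  data_law_setT.

End sequence_model.

Definition lebesgue_tuple n : {sigma_finite_measure set (borel_tuple R n) -> \bar R} :=
  tuple_measure (fun=> @lebesgue_measure R).

Definition nearly_black n p : set (n.-tuple R) :=
  [set theta : n.-tuple R | (#|[pred i | tnth theta i != 0%R]| <= p)%N].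

Definition tau_rate n p : R := p%:R / n%:R * Num.sqrt (ln (n%:R / p%:R)).

Definition l2dist n (x y : n.-tuple R) : R :=
  Num.sqrt (\sum_(i < n) (tnth x i - tnth y i) ^+ 2).

Local Notation phi := (normal_pdf 0 1).

(* Extended-real valued: the horseshoe density is infinite at 0. *)
Definition horseshoe_pdf t (theta : R) : \bar R :=
  (\int[lebesgue_measure]_(l in `]0%R, +oo[)
     (phi (theta / (l * t)) * (l * t)^-1 * (2 / (pi * (1 + l ^+ 2))))%:E)%E.

Definition posterior_kernel n t (y theta : n.-tuple R) : \bar R :=
  (\prod_(i < n) ((phi (tnth y i - tnth theta i))%:E
                  * horseshoe_pdf t (tnth theta i)))%E.

(* For t > 0 the normalizing constant is positive and finite, so that the division
   in \bar R is the usual one and the posterior is a probability measure. *)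
Definition posterior n t (y : n.-tuple R) (A : set (n.-tuple R)) : \bar R :=
  ((\int[lebesgue_tuple n]_(theta in A) posterior_kernel t y theta)
   / (\int[lebesgue_tuple n]_theta posterior_kernel t y theta))%E.

Definition marginal_likelihood n t (y : n.-tuple R) : \bar R :=
  (\prod_(i < n) \int[lebesgue_measure]_theta
     ((phi (tnth y i - theta))%:E * horseshoe_pdf t theta))%E.

Definition is_mmle n (tau : n.-tuple R -> R) :=
  forall y, n%:R^-1 <= tau y <= 1 /\
    forall t, n%:R^-1 <= t <= 1 ->
      (marginal_likelihood t y <= marginal_likelihood (tau y) y)%E.

Definition eb_mass_outside n (tau : n.-tuple R -> R) (theta0 : n.-tuple R)
    (r : R) : \bar R :=
  (\int[data_law theta0]_y
     posterior (tau y) y [set theta | (r <= l2dist theta0 theta)%R])%E.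

End horseshoe.

Arguments nearly_black {R} n p.

(* Main.v *)
Require Import Defs.
From mathcomp Require Import all_boot all_order all_algebra.
From mathcomp Require Import all_classical all_reals all_analysis.
From mathcomp Require Import measurable_realfun ring lra.

Set Implicit Arguments.
Unset Strict Implicit.
Unset Printing Implicit Defensive.

Import Order.TTheory GRing.Theory Num.Theory.
Import numFieldNormedType.Exports.

Local Open Scope classical_set_scope.
Local Open Scope ring_scope.

(** Given its local scale [v], half-Cauchy with scale tau, a coordinate has prior N(0, v^2), hence
    posterior N(k y, k) with k = v^2 / (1 + v^2). The posterior second moment of theta_i about
    theta_{0,i} is therefore a quotient of two one-dimensional integrals over [v]. Where theta_{0,i}
    = 0 it is O(tau exp(y^2/2)) and also O(1 + y^2) ([second_moment_zero_small],
    [second_moment_zero_le]). Elsewhere it is O(1 + log(1/tau) + (y - theta_{0,i})^2), because the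
    Cauchy tail of the prior stops the shrinkage once y^2 exceeds a multiple of log(1/tau)
    ([second_moment_signal_le]).

    These bounds are monotone in tau, so on the event that the estimate lies in [1/n, T], with T = C
    tau_n(p), they can be frozen at T or at 1/n, however the estimate depends on the same data.
    Markov's inequality under the posterior ([posterior_markov]) and integration over the data, with
    noise coordinates split at |y| = a, give [eb_mass_outside_le]. With a = sqrt(8 log n) the
    expected sum of second moments is O(n T a + 1 + p log n) = O(p log n). At radius M sqrt(p log n)
    this leaves O(1/M^2) plus the probability that the estimate is out of range
    ([eb_mass_outside_rate_le], [contraction_of_rate]).

    For the maximum marginal likelihood estimator the lower end 1/n is built in, and only an
    estimate above A tau_n(p) has to be excluded ([mmle_le_rate]). Let [lr t y] be the ratio of the
    marginal density of one observation to the noise density, and let zeta(t) be close to sqrt(2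
    log(1/t)). Under the noise law, ln lr has mean at most -c t / zeta(t) and second moment O(t /
    zeta(t)^2), while 1/lr has mean at most 1 + C t / zeta(t). With s = tau_n(p), an estimate t
    above A s has likelihood at least that of s. The at most p signals contribute at most p ln(t/s)
    to the log ratio, whereas the noise contributes a drift of order -n t / zeta(t), which for large
    A dominates this and any fixed multiple of p. So either the centred noise sum at t is large, or
    the noise log likelihood at s is below -(C+1) p. Chebyshev's inequality on a geometric grid of t
    controls the first event ([log_lr_env_moments]), Markov's inequality for the product of the 1/lr
    the second ([integral_inv_lr]); both have probability O(1/p). *)

(** * Integration against finite product measures *)

Section tuple_integral.
Local Open Scope ereal_scope.
Context d (T : measurableType d) (R : realType).
Implicit Types (n : nat).

Lemma integral_tuple_cons n (mu : 'I_n.+1 -> {sigma_finite_measure set T -> \bar R})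
    (f : n.+1.-tuple T -> \bar R) :
  measurable_fun [set: n.+1.-tuple T] f -> (forall t, 0 <= f t) ->
  \int[tuple_measure mu]_t f t =
  \int[mu ord0]_x \int[tuple_measure (fun i => mu (lift ord0 i))]_t
     f (tuple_cons (x, t)).
Proof.
move=> mf f0.
rewrite [LHS]ge0_integral_pushforward//.
rewrite preimage_setT.
rewrite fubini_tonelli1//.
  exact: measurableT_comp.
by move=> x; exact: f0.
Qed.

Lemma integral_tuple0 (mu : 'I_0 -> {sigma_finite_measure set T -> \bar R})
    (f : 0.-tuple T -> \bar R) :
  measurable_fun [set: 0.-tuple T] f -> \int[tuple_measure mu]_t f t = f [tuple].
Proof. by move=> mf /=; rewrite integral_dirac// diracT mul1e. Qed.

Lemma emeasurable_tuple_prod n (f : 'I_n -> T -> \bar R) :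
  (forall i, measurable_fun setT (f i)) ->
  measurable_fun [set: n.-tuple T] (fun t => \prod_(i < n) f i (tnth t i)).
Proof.
move=> mf; elim: (index_enum _) => [|i s ih].
  rewrite [X in measurable_fun _ X](_ : _ = cst 1); first exact: measurable_cst.
  by apply/funext => t; rewrite big_nil.
rewrite [X in measurable_fun _ X](_ : _ = fun t => f i (tnth t i) *
    \prod_(j <- s) f j (tnth t j)); last by apply/funext => t; rewrite big_cons.
apply: emeasurable_funM => //; apply: measurableT_comp => //.
exact: measurable_tnth.
Qed.

Lemma integral_tuple_prod n (mu : 'I_n -> {sigma_finite_measure set T -> \bar R})
    (f : 'I_n -> T -> \bar R) :
  (forall i, measurable_fun setT (f i)) -> (forall i x, 0 <= f i x) ->
  \int[tuple_measure mu]_t (\prod_(i < n) f i (tnth t i)) =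
  \prod_(i < n) \int[mu i]_x f i x.
Proof.
elim: n mu f => [|n ih] mu f mf f0.
  by rewrite integral_tuple0 ?big_ord0//; exact: emeasurable_tuple_prod.
rewrite integral_tuple_cons; first last.
- by move=> t; apply: prode_ge0 => i _; exact: f0.
- exact: emeasurable_tuple_prod.
rewrite big_ord_recl -ih//.
have mF : measurable_fun [set: n.-tuple T]
    (fun t => \prod_(i < n) f (lift ord0 i) (tnth t i)).
  exact: (emeasurable_tuple_prod (f := fun i => f (lift ord0 i))).
have F0 (t : n.-tuple T) : 0 <= \prod_(i < n) f (lift ord0 i) (tnth t i).
  by apply: prode_ge0 => i _; exact: f0.
rewrite -ge0_integralZr//; last by apply: integral_ge0.
apply: eq_integral => x _; rewrite -ge0_integralZl//.
apply: eq_integral => t _; rewrite big_ord_recl; congr (_ * _).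
by apply: eq_bigr => i _; rewrite tnthS.
Qed.

Section probability.
Context n (P : 'I_n -> probability T R).

Lemma tuple_measure_setT : tuple_measure (fun i => P i) setT = 1.
Proof.
have := tuple_measure_box (fun i => P i) (fun=> measurableT).
rewrite (_ : mkset _ = setT); last by apply/seteqP; split.
by rewrite big1 // => i _; exact: probability_setT.
Qed.

(** A function of one coordinate is a product whose other factors are 1, and those integrate to 1
    under probabilities. *)
Lemma ge0_integral_tuple_coord j (f : T -> \bar R) :
  measurable_fun setT f -> (forall x, 0 <= f x) ->
  \int[tuple_measure (fun i => P i)]_t f (tnth t j) = \int[P j]_x f x.
Proof.
move=> mf f0; pose F i := if i == j then f else cst 1.
have mF i : measurable_fun setT (F i) by rewrite /F; case: ifP.
have F0 i x : 0 <= F i x by rewrite /F; case: ifP => //= _; exact: lee01.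
transitivity (\int[tuple_measure (fun i => P i)]_t (\prod_(i < n) F i (tnth t i))).
  apply: eq_integral => t _; rewrite (bigD1 j)//= big1 ?mule1 /F ?eqxx// => i ij.
  by rewrite (negbTE ij).
rewrite integral_tuple_prod// (bigD1 j)//= /F eqxx big1 ?mule1// => i ij.
by rewrite (negbTE ij) integral_cst// mul1e; exact: probability_setT.
Qed.

Lemma integral_tuple_coord j (f : T -> \bar R) : measurable_fun setT f ->
  \int[tuple_measure (fun i => P i)]_t f (tnth t j) = \int[P j]_x f x.
Proof.
move=> mf; rewrite integralE [RHS]integralE; congr (_ - _).
  rewrite -ge0_integral_tuple_coord//; last exact: measurable_funepos.
  by apply: eq_integral => t _; rewrite unlock.
rewrite -ge0_integral_tuple_coord//; last exact: measurable_funeneg.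
by apply: eq_integral => t _; rewrite unlock.
Qed.

Lemma integrable_tuple_coord j (f : T -> \bar R) :
  (P j).-integrable setT f ->
  (tuple_measure (fun i => P i)).-integrable setT (fun t => f (tnth t j)).
Proof.
move=> /integrableP[mf foo]; apply/integrableP; split.
  by apply: measurableT_comp => //; exact: measurable_tnth.
rewrite (ge0_integral_tuple_coord j (f := fun x => `|f x|))//.
exact: measurableT_comp.
Qed.

End probability.

(* Chebyshev's variance computation for sums of independent centred variables. *)
Lemma integral_tuple_sum_sqr n (P : 'I_n -> probability T R)
    (h : 'I_n -> T -> R) (v : 'I_n -> R) :
  (forall i, measurable_fun setT (h i)) ->
  (forall i, \int[P i]_x (h i x)%:E = 0) ->
  (forall i, \int[P i]_x ((h i x) ^+ 2)%:E <= (v i)%:E) ->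
  \int[tuple_measure (fun i => P i)]_t ((\sum_(i < n) h i (tnth t i)) ^+ 2)%:E
    <= (\sum_(i < n) v i)%:E.
Proof.
elim: n P h v => [|n ih] P h v mh h0 hv.
  rewrite integral_tuple0 ?big_ord0 ?expr0n//=.
  rewrite [X in measurable_fun _ X](_ : _ = cst 0); first exact: measurable_cst.
  by apply/funext => t; rewrite big_ord0 expr0n.
have mS m (k : 'I_m -> T -> R) : (forall i, measurable_fun setT (k i)) ->
    measurable_fun [set: m.-tuple T] (fun t => \sum_(i < m) k i (tnth t i))%R.
  move=> mk; apply: measurable_sum => i.
  by apply: measurableT_comp => //; exact: measurable_tnth.
have hint i : (P i).-integrable setT (fun x => (h i x)%:E).
  apply/integrableP; split; first exact/measurable_EFinP.
  apply: (@le_lt_trans _ _ (\int[P i]_x (1 + ((h i x) ^+ 2)%:E))).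
    apply: ge0_le_integral => //.
    - by apply: measurableT_comp => //; exact/measurable_EFinP.
    - apply: emeasurable_funD => //; apply/measurable_EFinP.
      exact: measurable_funX.
    - move=> x _; rewrite -EFinD lee_fin.
      by rewrite -[X in (_ <= 1 + X)%R]real_normK ?num_real//; nra.
  rewrite ge0_integralD//; last 2 first.
  - by move=> x _; rewrite lee_fin sqr_ge0.
  - by apply/measurable_EFinP; exact: measurable_funX.
  rewrite integral_cst// mul1e; apply: lte_add_pinfty.
    exact: (le_lt_trans (probability_le1 (P i) measurableT) (ltry 1)).
  by apply: le_lt_trans (hv i) _; rewrite ltry.
pose h' i := h (lift ord0 i); pose P' i := P (lift ord0 i).
set S := fun t : n.-tuple T => (\sum_(i < n) h' i (tnth t i))%R.
have mS' : measurable_fun [set: n.-tuple T] S by apply: mS => i; exact: mh.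
have intS : (tuple_measure (fun i => P' i)).-integrable setT (EFin \o S).
  rewrite [X in _.-integrable _ X](_ : _ =
      (fun t => \sum_(i < n) (h' i (tnth t i))%:E)); last first.
    by apply/funext => t; rewrite /= sumEFin.
  apply: integrable_sum => // i _.
  exact: (integrable_tuple_coord (P := P') (hint (lift ord0 i))).
(* The sum over the remaining coordinates has mean zero, which removes the cross term when the
   square is expanded. *)
have S0 : \int[tuple_measure (fun i => P' i)]_t (S t)%:E = 0.
  under eq_integral do rewrite -sumEFin.
  rewrite integral_sum//; last first.
    by move=> i; exact: (integrable_tuple_coord (P := P') (hint (lift ord0 i))).
  rewrite big1// => i _.
  rewrite (integral_tuple_coord P' i (f := fun x => (h' i x)%:E)).
    exact: h0.
  by apply/measurable_EFinP; exact: mh.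
have := ih P' h' (fun i => v (lift ord0 i)) _ _ _.
move=> /(_ (fun i => mh _) (fun i => h0 _) (fun i => hv _)) S2.
set V' := (\sum_(i < n) v (lift ord0 i))%R in S2.
rewrite integral_tuple_cons; first last.
- by move=> t; rewrite lee_fin sqr_ge0.
- by apply/measurable_EFinP; apply: measurable_funX; apply: mS => i; exact: mh.
apply: (@le_trans _ _ (\int[P ord0]_x (((h ord0 x) ^+ 2)%:E + V'%:E))).
  apply: ge0_le_integral => //.
  - by move=> x _; apply: integral_ge0 => t _; rewrite lee_fin sqr_ge0.
  - apply: (measurable_fun_fubini_tonelli_F
      (m2 := tuple_measure (fun i => P (lift ord0 i)))
      (fun z => ((\sum_(i < n.+1) h i (tnth (tuple_cons z) i)) ^+ 2)%:E)).
      apply/measurable_EFinP; apply: measurable_funX.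
      apply: (measurableT_comp (f := fun t : n.+1.-tuple T => (\sum_(i < n.+1) h i (tnth t i))%R)) => //.
      exact: mS.
    by move=> z; rewrite lee_fin sqr_ge0.
  - apply: emeasurable_funD => //; apply/measurable_EFinP.
    by apply: measurable_funX; exact: mh.
  - move=> x _.
    have -> : \int[tuple_measure (fun i => P' i)]_t
       ((\sum_(i < n.+1) h i (tnth (tuple_cons (x, t)) i)) ^+ 2)%:E =
       \int[tuple_measure (fun i => P' i)]_t
         (((h ord0 x) ^+ 2)%:E + ((2 * h ord0 x)%:E * (S t)%:E + ((S t) ^+ 2)%:E)).
      apply: eq_integral => t _; rewrite -EFinM -!EFinD; congr EFin.
      rewrite big_ord_recl/=; under eq_bigr do rewrite tnthS.
      by rewrite sqrrD /S /h'; ring.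
    have iS2 : (tuple_measure (fun i => P' i)).-integrable setT
        (fun t => ((S t) ^+ 2)%:E).
      apply/integrableP; split.
        by apply/measurable_EFinP; exact: measurable_funX.
      under eq_integral do rewrite gee0_abs ?lee_fin ?sqr_ge0//.
      exact: (le_lt_trans S2 (ltry _)).
    have iS : (tuple_measure (fun i => P' i)).-integrable setT
        (fun t => (2 * h ord0 x)%:E * (S t)%:E) by exact: integrableZl.
    rewrite integralD//; last 2 first.
    - apply/integrableP; split; first exact: measurable_cst.
      by rewrite integral_cst//= tuple_measure_setT mule1 ltry.
    - exact: integrableD.
    rewrite integral_cst//= tuple_measure_setT mule1 integralD//.
    by rewrite integralZl// S0 mule0 add0e leeD2l.
rewrite ge0_integralD//; last 3 first.
- by move=> x _; rewrite lee_fin sqr_ge0.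
- by apply/measurable_EFinP; exact: measurable_funX.
- by move=> x _; apply: le_trans S2; apply: integral_ge0 => t _; rewrite lee_fin sqr_ge0.
rewrite big_ord_recl EFinD leeD ?hv// integral_cst//.
rewrite (_ : V'%:E * _ = V'%:E)// -[RHS]mule1; congr (_ * _).
exact: probability_setT.
Qed.

End tuple_integral.

(** * The normal law as a density against Lebesgue measure *)

Section integral_normal_prob.
Local Open Scope ereal_scope.
Context {R : realType}.
Implicit Types (m s : R).
Local Notation mu := (@lebesgue_measure R).

(** The Radon-Nikodym derivative and [normal_pdf m s] have the same integral over every measurable
    set, hence agree almost everywhere. *)
Lemma ge0_integral_normal_prob m s (f : R -> \bar R) :
  measurable_fun setT f -> (forall x, 0 <= f x) ->
  \int[normal_prob m s]_x f x = \int[mu]_x (f x * (normal_pdf m s x)%:E).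
Proof.
move=> mf f0; have dom := normal_prob_dominates m s.
rewrite -(Radon_Nikodym_SigmaFinite.change_of_variables dom)//=.
apply: ae_eq_integral => //=.
- apply: emeasurable_funM => //.
  exact: measurable_int (Radon_Nikodym_SigmaFinite.f_integrable dom).
- apply: emeasurable_funM => //; apply/measurable_EFinP.
  exact: measurable_normal_pdf.
apply: ae_eqe_mul2l; apply: integral_ae_eq => //.
- exact: Radon_Nikodym_SigmaFinite.f_integrable.
- by apply/measurable_EFinP; exact: measurable_normal_pdf.
- move=> A _ mA; rewrite -Radon_Nikodym_SigmaFinite.f_integral//.
Qed.

End integral_normal_prob.

(** * Measurability of real expressions *)

Section measurability.
Context d (T : measurableType d) {R : realType}.
Implicit Types (D : set T) (f : T -> R).

(* [`^] sends 0 to 0 for the exponent -1, as does [^-1]. *)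
Lemma measurable_funV D f :
  measurable_fun D f -> measurable_fun D (fun x => (f x)^-1).
Proof.
move=> mf; rewrite (_ : (fun x => _) = fun x => f x * (f x ^+ 2) `^ (-1)).
  apply: measurable_funM => //.
  apply: (measurableT_comp (f := @powR R ^~ (-1))); first exact: measurable_powR.
  exact: measurable_funX.
apply/funext => x; rewrite powR_inv1 ?sqr_ge0//.
have [->|fx0] := eqVneq (f x) 0; first by rewrite invr0 mul0r.
by field.
Qed.

Lemma measurable_fun_cst D (c : R) : measurable_fun D (fun _ : T => c).
Proof. exact: measurable_cst. Qed.

Lemma measurable_fun_expR D f :
  measurable_fun D f -> measurable_fun D (fun x => expR (f x)).
Proof. by move=> mf; apply: measurableT_comp. Qed.

Lemma measurable_fun_ln D f :
  measurable_fun D f -> measurable_fun D (fun x => ln (f x)).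
Proof. by move=> mf; apply: measurableT_comp. Qed.

Lemma measurable_fun_sqrt D f :
  measurable_fun D f -> measurable_fun D (fun x => Num.sqrt (f x)).
Proof.
move=> mf; apply: (measurableT_comp (f := @Num.sqrt R)) => //.
by apply: continuous_measurable_fun; exact: sqrt_continuous.
Qed.

Lemma measurable_fun_normr D f :
  measurable_fun D f -> measurable_fun D (fun x => `|f x|).
Proof. by move=> mf; apply: measurableT_comp. Qed.

Lemma measurable_fun_normal_pdf D m s f :
  measurable_fun D f -> measurable_fun D (fun x => normal_pdf m s (f x)).
Proof.
by move=> mf; apply: measurableT_comp => //; exact: measurable_normal_pdf.
Qed.

End measurability.

(** Reads measurability off the syntax of the integrand; subterms of unknown shape must be covered
    by a hypothesis, be constant, or are left as goals. *)
Ltac measR := lazymatch goal with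
  | |- measurable_fun _ (fun x => x) => exact: measurable_id
  | |- measurable_fun _ (fun x => (@?f x + @?g x)%R) =>
      apply: (@measurable_funD _ _ _ _ f g); measR
  | |- measurable_fun _ (fun x => (@?f x * @?g x)%R) =>
      apply: (@measurable_funM _ _ _ _ f g); measR
  | |- measurable_fun _ (fun x => (- @?f x)%R) =>
      apply: (@measurable_funN _ _ _ _ f); measR
  | |- measurable_fun _ (fun x => (@?f x ^+ ?n)%R) =>
      apply: (@measurable_funX _ _ _ _ f n); measR
  | |- measurable_fun _ (fun x => ((@?f x)^-1)%R) =>
      apply: (@measurable_funV _ _ _ _ f); measR
  | |- measurable_fun _ (fun x => expR (@?f x)) =>
      apply: (@measurable_fun_expR _ _ _ _ f); measR
  | |- measurable_fun _ (fun x => ln (@?f x)) =>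
      apply: (@measurable_fun_ln _ _ _ _ f); measR
  | |- measurable_fun _ (fun x => Num.sqrt (@?f x)) =>
      apply: (@measurable_fun_sqrt _ _ _ _ f); measR
  | |- measurable_fun _ (fun x => `|@?f x|%R) =>
      apply: (@measurable_fun_normr _ _ _ _ f); measR
  | |- measurable_fun _ (fun x => normal_pdf ?m ?s (@?f x)) =>
      apply: (@measurable_fun_normal_pdf _ _ _ _ m s f); measR
  | |- measurable_fun _ (fun x => fst x) => exact: measurable_fst
  | |- measurable_fun _ (fun x => snd x) => exact: measurable_snd
  | |- _ => first [assumption | apply: measurable_fun_cst | idtac]
  end.

(** * Monotonicity and linearity of nonnegative integrals *)

Section nonneg_integral.
Context d (T : measurableType d) {R : realType} (mu : {measure set T -> \bar R}).
Implicit Types (D : set T) (f g : T -> R).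
Local Open Scope ereal_scope.

Lemma le_integralR D f g : measurable D ->
  measurable_fun setT f -> measurable_fun setT g ->
  (forall x, D x -> (0 <= f x <= g x)%R) ->
  \int[mu]_(x in D) (f x)%:E <= \int[mu]_(x in D) (g x)%:E.
Proof.
move=> mD mf mg fg; apply: ge0_le_integral => //.
- by move=> x /fg /andP[f0 _]; rewrite lee_fin.
- by apply: measurable_funTS; exact/measurable_EFinP.
- by apply: measurable_funTS; exact/measurable_EFinP.
- by move=> x /fg /andP[_]; rewrite lee_fin.
Qed.

(* Monotonicity holds without any measurability assumption, the integral of a
   nonnegative function being a supremum over the simple functions below it. *)
Lemma le_integral_lower D (f g : T -> \bar R) :
  (forall x, D x -> 0 <= f x) -> (forall x, D x -> f x <= g x) ->
  \int[mu]_(x in D) f x <= \int[mu]_(x in D) g x.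
Proof.
move=> f0 fg.
have p0 x : 0 <= (f \_ D) x by exact: erestrict_ge0.
have pq x : (f \_ D) x <= (g \_ D) x by exact: lee_restrict.
have q0 x : D x -> 0 <= g x by move=> Dx; exact: le_trans (f0 _ Dx) (fg _ Dx).
rewrite ge0_integralE// [leRHS]ge0_integralE//; apply: ge_ereal_sup => _ [h hp <-].
apply: ereal_sup_ubound; exists h; last by [].
by move=> x; exact: le_trans (hp x) (pq x).
Qed.

Lemma integralRZl D (k : R) f : measurable D ->
  measurable_fun setT f -> (0 <= k)%R -> (forall x, D x -> (0 <= f x)%R) ->
  \int[mu]_(x in D) (k * f x)%:E = k%:E * \int[mu]_(x in D) (f x)%:E.
Proof.
move=> mD mf k0 f0; under eq_integral do rewrite EFinM.
rewrite ge0_integralZl//.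
by apply: measurable_funTS; exact/measurable_EFinP.
Qed.

Lemma integralRD D f g : measurable D ->
  measurable_fun setT f -> measurable_fun setT g ->
  (forall x, D x -> (0 <= f x)%R) -> (forall x, D x -> (0 <= g x)%R) ->
  \int[mu]_(x in D) (f x + g x)%:E =
  \int[mu]_(x in D) (f x)%:E + \int[mu]_(x in D) (g x)%:E.
Proof.
move=> mD mf mg f0 g0; under eq_integral do rewrite EFinD.
rewrite ge0_integralD//; apply: measurable_funTS; exact/measurable_EFinP.
Qed.

End nonneg_integral.

(** * Explicit integrals of rational functions *)

Section halfline.
Context {R : realType}.
Local Notation mu := (@lebesgue_measure R).
Implicit Types (t v y a c : R).

Let cvg_sqr_pinfty : (fun v : R => v ^+ 2) @ +oo --> +oo.
Proof.
apply/cvgryPge => A; near=> v; apply: (@le_trans _ _ v).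
  by near: v; apply: nbhs_pinfty_ge; rewrite num_real.
have : 1 <= v by near: v; apply: nbhs_pinfty_ge; rewrite num_real.
by move=> v1; nra.
Unshelve. all: by end_near. Qed.

(** The primitive is [- (2 * (c + v ^+ 2))^-1]. This evaluates the second term of [domker]. *)
Lemma integral_rational_tail a c : 0 <= a -> 0 < c + a ^+ 2 ->
  (\int[mu]_(v in `[a, +oo[) (v / (c + v ^+ 2) ^+ 2)%:E =
   (2 * (c + a ^+ 2))^-1%:E)%E.
Proof.
move=> a0 ca.
have cv v : a <= v -> 0 < c + v ^+ 2.
  by move=> av; apply: lt_le_trans ca _; rewrite lerD2l ler_sqr ?nnegrE// (le_trans a0).
have cF v : {for v, continuous (fun v : R => c + v ^+ 2)}.
  by apply: cvgD; [exact: cvg_cst|exact: exprn_continuous].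
have dF v : a <= v ->
    is_derive v 1 (fun v : R => - (2 * (c + v ^+ 2))^-1) (v / (c + v ^+ 2) ^+ 2).
  move=> av; have := cv _ av => cv0.
  have D1 : is_derive v 1 (fun v : R => 2 * (c + v ^+ 2)) (4 * v).
    by apply: is_derive_eq; rewrite /GRing.scale/= !mulr1; ring.
  have D2 := is_deriveV (f := fun v : R => 2 * (c + v ^+ 2)) _ D1.
  have nz : 2 * (c + v ^+ 2) != 0 by rewrite mulf_neq0// lt0r_neq0.
  have D3 := D2 nz.
  have D4 := is_deriveN D3; apply: (is_derive_eq D4).
  by rewrite /GRing.scale/=; field; rewrite lt0r_neq0.
have cG v : a <= v -> {for v, continuous (fun v : R => v / (c + v ^+ 2) ^+ 2)}.
  move=> av; apply: cvgM; first exact: cvg_id.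
  apply: cvgV; first by rewrite expf_neq0// lt0r_neq0// cv.
  by apply: (cvg_comp _ (fun z : R => z ^+ 2)); [exact: cF|exact: exprn_continuous].
rewrite (@ge0_continuous_FTC2y _ _ (fun v => - (2 * (c + v ^+ 2))^-1) a 0).
- by rewrite EFinN oppeK add0e.
- by move=> v av; rewrite divr_ge0 ?sqr_ge0// (le_trans a0).
- by apply: continuous_in_subspaceT => v; rewrite inE/= in_itv/= andbT => /cG.
- rewrite -oppr0; apply: cvgN; apply/gtr0_cvgV0.
    exists a; split; first exact: num_real.
    by move=> v av /=; rewrite mulr_gt0// cv// ltW.
  apply: gt0_cvgMry => //; apply/cvgryPge => A.
  by near do rewrite -lerBlDl; move/cvgryPge : cvg_sqr_pinfty; apply.
- by move=> v av; have [] := dF _ (ltW av).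
- apply: cvg_at_right_filter; apply: cvgN; apply: cvgV.
    by rewrite mulf_neq0// lt0r_neq0.
  by apply: cvgM; [exact: cvg_cst|exact: cF].
- move=> v; rewrite in_itv/= andbT => av; rewrite derive1E.
  by have [_] := dF _ (ltW av).
Unshelve. all: by end_near. Qed.

Lemma integral_hcauchy t : 0 < t ->
  (\int[mu]_(v in `[0%R, +oo[) (2 / pi * (t / (t ^+ 2 + v ^+ 2)))%:E = 1)%E.
Proof.
move=> t0; have t2 v : 0 < t ^+ 2 + v ^+ 2 by rewrite ltr_wpDr ?sqr_ge0 ?exprn_gt0.
have cG v : {for v, continuous (fun v : R => 2 / pi * (t / (t ^+ 2 + v ^+ 2)))}.
  apply: cvgM; first exact: cvg_cst.
  apply: cvgM; first exact: cvg_cst.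
  apply: cvgV; first by rewrite lt0r_neq0.
  by apply: cvgD; [exact: cvg_cst|exact: exprn_continuous].
have dF v : is_derive v 1 (fun v : R => 2 / pi * atan (v / t))
    (2 / pi * (t / (t ^+ 2 + v ^+ 2))).
  have D1 : is_derive v 1 (fun v : R => v / t) t^-1.
    by apply: is_derive_eq; rewrite /GRing.scale/= mulr0 add0r mulr1.
  have D2 := @is_derive1_comp _ atan (fun v : R => v / t) v _ _ _ D1.
  have D3 := D2 _ (is_derive1_atan (v / t)).
  have D4 := is_deriveZ (2 / pi) D3; apply: (is_derive_eq D4).
  rewrite /GRing.scale/=; congr (_ * _); field.
  by rewrite !lt0r_neq0.
have cF v : {for v, continuous (fun v : R => 2 / pi * atan (v / t))}.
  apply: cvgM; first exact: cvg_cst.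
  apply: (cvg_comp (fun v => v / t) atan); last exact: continuous_atan.
  by apply: cvgM; [exact: cvg_id|exact: cvg_cst].
have pi0 : pi != 0 :> R by rewrite lt0r_neq0 // pi_gt0.
rewrite (@ge0_continuous_FTC2y _ _ (fun v => 2 / pi * atan (v / t)) 0 1).
- by rewrite mul0r atan0 mulr0 sube0.
- by move=> v v0; apply: mulr_ge0; apply: divr_ge0; rewrite ?pi_ge0 ?ltW.
- by apply: continuous_in_subspaceT => v _; exact: cG.
- rewrite [X in _ --> X](_ : 1 = 2 / pi * (pi / 2)); last by rewrite mulrA divfK// divff.
  apply: cvgM; first exact: cvg_cst.
  apply: (cvg_comp (fun v => v / t) atan); last exact: cvgy_atan.
  by apply: gt0_cvgMly; [rewrite invr_gt0|exact: cvg_id].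
- by move=> v _; have [] := dF v.
- by apply: cvg_at_right_filter; exact: cF.
- by move=> v _; rewrite derive1E; have [_] := dF v.
Qed.

Lemma integralT_cauchy t m : 0 < t ->
  (\int[mu]_y (t / (t ^+ 2 + (y - m) ^+ 2))%:E = pi%:E)%E.
Proof.
move=> t0; have t2 v : 0 < t ^+ 2 + v ^+ 2 by rewrite ltr_wpDr ?sqr_ge0 ?exprn_gt0.
pose F (x : R^o) := (x - m) / t.
have F'E : F^`()%classic = cst t^-1.
  apply/funext => x; rewrite /F derive1E deriveM// deriveD// derive_cst scaler0.
  by rewrite add0r derive_id derive_cst addr0 scaler1.
have := @increasing_ge0_integration_by_substitutionT R F (fun x => (oneDsqr x)^-1).
rewrite F'E => sub.
have <- : (\int[mu]_x ((((fun x => (oneDsqr x)^-1) \o F) * cst t^-1)%R x)%:E =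
   \int[mu]_y (t / (t ^+ 2 + (y - m) ^+ 2))%:E)%E.
  apply: eq_integral => y _; congr EFin.
  change ((1 + ((y - m) / t) ^+ 2)^-1 * t^-1 = t / (t ^+ 2 + (y - m) ^+ 2)).
  have := t2 (y - m); set z := y - m => tz.
  have -> : 1 + (z / t) ^+ 2 = (t ^+ 2 + z ^+ 2) / t ^+ 2.
    by field; rewrite lt0r_neq0.
  by field; rewrite !lt0r_neq0.
rewrite -sub.
- have := @ge0_symfun_integralT R (fun x => (oneDsqr x)^-1).
  move=> ->; first last.
  + by move=> x /=; rewrite /oneDsqr sqrrN.
  + exact: continuous_oneDsqrV.
  + by move=> x; rewrite invr_ge0 ltW.
  by rewrite -set_itvcy integral0y_oneDsqr -EFinM; congr EFin; field.
- by move=> x y xy; rewrite /F ltr_pM2r ?ltrD2r// invr_gt0.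
- by move=> ?; exact: cvg_cst.
- exact: is_cvg_cst.
- exact: is_cvg_cst.
- by move=> x; apply: derivableM => //; exact: derivableB.
- by apply/gt0_cvgMlNy; [rewrite invr_gt0|exact: cvg_addrr_Ny].
- by apply/gt0_cvgMly; [rewrite invr_gt0|exact: cvg_addrr].
- exact: continuous_oneDsqrV.
- by move=> x; rewrite invr_ge0 ltW.
Qed.

End halfline.

(** * Rational bounds on the exponential *)

Section exponential_bounds.
Context {R : realType}.
Implicit Types (x : R) (n : nat).

Lemma expR_ge_pow n x : 0 <= x -> (1 + x / n.+1%:R) ^+ n.+1 <= expR x.
Proof.
move=> x0; have -> : expR x = expR (x / n.+1%:R) ^+ n.+1.
  by rewrite -expRM_natl mulrC divfK.
rewrite lerXn2r ?nnegrE ?expR_ge0 ?expR_ge1Dx//.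
by rewrite addr_ge0 ?divr_ge0.
Qed.

(** Trades a Gaussian factor for a rational function of any chosen degree, so that the later
    integrals over the scale become elementary. *)
Lemma expRN_le_pow n x : 0 <= x -> expR (- x) <= ((1 + x / n.+1%:R) ^+ n.+1)^-1.
Proof.
move=> x0; rewrite expRN lef_pV2 ?posrE ?expR_gt0 ?expR_ge_pow//.
by rewrite exprn_gt0// ltr_wpDr ?divr_ge0.
Qed.

End exponential_bounds.

(** * Pointwise bounds on the Gaussian scale-mixture kernel *)

Section scale_mixture.
Context {R : realType}.
Local Notation mu := (@lebesgue_measure R).
Implicit Types (t v y : R).

(** Density on the positive half-line of the full scale [v] (local scale times [t]) of one
    coordinate. *)
Definition hcauchy t v : R := 2 / pi * (t / (t ^+ 2 + v ^+ 2)).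

(* [sqrt (2 pi)] times the density at [y] of [N(0, 1 + v^2)]. *)
Definition mixker v y : R :=
  (Num.sqrt (1 + v ^+ 2))^-1 * expR (- (y ^+ 2 / (2 * (1 + v ^+ 2)))).

(** Common dominating function: up to a constant times [t] it bounds all the integrands below. Its
    first term serves [v <= 1], its second [v >= 1], and it integrates in [v] to O(1 / (1 +
    y^2)). *)
Definition domker v y : R :=
  hcauchy 1 v / (1 + y ^+ 2) + v / (1 + y ^+ 2 / 4 + v ^+ 2) ^+ 2.

Let twopi : (1 / 2 : R) <= 2 / (pi : R) <= 1.
Proof.
have p2 := pi_ge2 R; have p4 := pihalf_lt2 R.
have p0 : 0 < pi :> R by lra.
by rewrite ler_pdivlMr// ler_pdivrMr//; apply/andP; split; lra.
Qed.

Let s_gt0 v : 0 < 1 + v ^+ 2. Proof. by rewrite ltr_wpDr ?sqr_ge0. Qed.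

Let r_ge1 v : 1 <= Num.sqrt (1 + v ^+ 2).
Proof. by rewrite -{1}sqrtr1 ler_sqrt ?lerDl ?sqr_ge0//; exact/ltW. Qed.

Lemma hcauchy_ge0 t v : 0 <= t -> 0 <= hcauchy t v.
Proof.
move=> t0; have /andP[h _] := twopi.
apply: mulr_ge0; first by lra.
by rewrite divr_ge0 ?addr_ge0 ?sqr_ge0.
Qed.

(** Any kernel that is O(v^2) near [v = 0] gains a factor [t] from here. *)
Lemma hcauchy_le t v : 0 < t -> hcauchy t v * v ^+ 2 <= t.
Proof.
move=> t0; have /andP[_ h] := twopi.
have d0 : 0 < t ^+ 2 + v ^+ 2 by rewrite ltr_wpDr ?sqr_ge0 ?exprn_gt0.
have u0 : 0 <= t / (t ^+ 2 + v ^+ 2) * v ^+ 2.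
  by rewrite mulr_ge0 ?sqr_ge0// divr_ge0 ?ltW.
have ut : t / (t ^+ 2 + v ^+ 2) * v ^+ 2 <= t.
  by rewrite mulrAC ler_pdivrMr// ler_wpM2l ?ltW// ltr_pwDl ?exprn_gt0.
by rewrite /hcauchy; set c := 2 / pi in h *; nra.
Qed.

Lemma hcauchy_ge t v : 0 < t -> (t / (t ^+ 2 + v ^+ 2)) / 2 <= hcauchy t v.
Proof.
move=> t0; have /andP[h _] := twopi.
have u0 : 0 <= t / (t ^+ 2 + v ^+ 2).
  by rewrite divr_ge0 ?addr_ge0 ?sqr_ge0 ?ltW.
by rewrite /hcauchy; set c := 2 / pi in h *; nra.
Qed.

Lemma mixker_ge0 v y : 0 <= mixker v y.
Proof. by rewrite mulr_ge0 ?expR_ge0// invr_ge0 sqrtr_ge0. Qed.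

Lemma mixker_le1 v y : mixker v y <= 1.
Proof.
rewrite /mixker -[leRHS]mulr1 ler_pM ?invr_ge0 ?sqrtr_ge0 ?expR_ge0//.
  by rewrite invf_le1 ?r_ge1// (lt_le_trans ltr01 (r_ge1 _)).
by rewrite -[leRHS]expR0 ler_expR oppr_le0 divr_ge0 ?sqr_ge0 ?mulr_ge0// ?ltW ?s_gt0.
Qed.

Lemma domker_ge0 v y : 0 <= v -> 0 <= domker v y.
Proof.
move=> v0; rewrite /domker; apply: addr_ge0; apply: divr_ge0 => //.
- exact: hcauchy_ge0.
- by rewrite addr_ge0 ?sqr_ge0.
- exact: sqr_ge0.
Qed.


(* Bounds [E := exp (- y^2 / (2 s))], [s = 1 + v^2], by a rational function
   whose product with [v / s^2] has an elementary primitive. *)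
Let expN_le (s y : R) : 0 < s ->
  expR (- (y ^+ 2 / (2 * s))) <= s ^+ 2 / (s + y ^+ 2 / 4) ^+ 2.
Proof.
move=> s0; have x0 : 0 <= y ^+ 2 / (2 * s) by rewrite divr_ge0 ?sqr_ge0 ?mulr_ge0 ?ltW.
apply: (le_trans (expRN_le_pow 1 x0)).
rewrite -[leRHS]invf_div -expr_div_n lef_pV2 ?posrE; last 2 first.
- by apply: exprn_gt0; apply: ltr_wpDr => //; rewrite divr_ge0.
- apply: exprn_gt0; apply: divr_gt0 => //; apply: ltr_wpDr => //; rewrite divr_ge0 ?sqr_ge0//.
have -> : (s + y ^+ 2 / 4) / s = 1 + y ^+ 2 / (2 * s) / 2.
  by field; rewrite lt0r_neq0.
by [].
Qed.

Let exp_le_inv (x : R) : 0 <= x -> expR (- (x / 4)) <= 4 / (1 + x).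
Proof.
move=> x0; apply: (le_trans (expRN_le_pow 0 (divr_ge0 x0 (ler0n _ 4)))).
rewrite expr1 -[leRHS]invf_div lef_pV2 ?posrE//; last 2 first.
- by apply: ltr_wpDr => //; rewrite !divr_ge0.
- by apply: divr_gt0 => //; apply: ltr_wpDr.
by rewrite divr1; lra.
Qed.

Let mulr_exp_le (x : R) : 0 <= x -> x * expR (- (x / 4)) <= 64 / (1 + x).
Proof.
move=> x0; have := expRN_le_pow 1 (divr_ge0 x0 (ler0n _ 4)); set E := expR _ => EE.
have q0 : 0 < (1 + x / 4 / 2) ^+ 2.
  by apply: exprn_gt0; apply: ltr_wpDr => //; rewrite !divr_ge0.
apply: (@le_trans _ _ (x * ((1 + x / 4 / 2) ^+ 2)^-1)); first by rewrite ler_wpM2l.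
rewrite ler_pdivrMr// mulrAC ler_pdivlMr ?ltr_wpDr//; nra.
Qed.

Let mulr_exp_sqr_le (x : R) : 0 <= x -> 2 * x * expR (- x) <= 14 / (1 + x / 2) ^+ 2.
Proof.
move=> x0; have := expRN_le_pow 2 x0; set E := expR _ => EE.
have q0 : 0 < (1 + x / 3) ^+ 3.
  by apply: exprn_gt0; apply: ltr_wpDr => //; rewrite !divr_ge0.
have q1 : 0 < (1 + x / 2) ^+ 2.
  by apply: exprn_gt0; apply: ltr_wpDr => //; rewrite !divr_ge0.
apply: (@le_trans _ _ (2 * x * ((1 + x / 3) ^+ 3)^-1)).
  by rewrite ler_wpM2l// mulr_ge0.
rewrite ler_pdivrMr// mulrAC ler_pdivlMr//.
have x2 : 0 <= x ^+ 2 by rewrite exprn_ge0.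
have x3 : 0 <= x ^+ 3 by rewrite exprn_ge0.
by lra.
Qed.

Let hcauchy1_ge v : 0 <= v <= 1 -> 1 / 4 <= hcauchy 1 v.
Proof.
move=> /andP[v0 v1]; apply: le_trans (hcauchy_ge v ltr01).
rewrite expr1n; have : (1 + v ^+ 2)^-1 >= 2^-1.
  by rewrite lef_pV2 ?posrE ?s_gt0//; nra.
by rewrite !div1r; lra.
Qed.

(** For [v <= 1] the kernel is at most exp(-y^2/4), which is O(1 / (1 + y^2)), and
    [hcauchy 1 v >= 1 / 4]. For [v >= 1] the rational bound [expN_le] on the exponential cancels the
    powers of 1 + v^2. *)
Lemma kappa_mixker_le v y : 0 <= v ->
  (1 + v ^+ 2)^-1 * mixker v y <= 16 * domker v y.
Proof.
move=> v0; have sv := s_gt0 v; have rv := r_ge1 v.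
have y1 : 0 < 1 + y ^+ 2 by rewrite ltr_wpDr ?sqr_ge0.
rewrite /mixker; set r := Num.sqrt _ in rv *.
have r2 : r ^+ 2 = 1 + v ^+ 2 by rewrite sqr_sqrtr// ltW.
have ri0 : 0 <= r^-1 by rewrite invr_ge0 (le_trans ler01).
have ri1 : r^-1 <= 1 by rewrite invf_le1// (lt_le_trans ltr01).
have E0 := expR_ge0 (- (y ^+ 2 / (2 * (1 + v ^+ 2)))).
have d0 : 0 < 1 + y ^+ 2 / 4 + v ^+ 2.
  by rewrite addrAC ltr_wpDr// divr_ge0 ?sqr_ge0.
have [v1|/ltW v1] := leP v 1.
  have Ele : expR (- (y ^+ 2 / (2 * (1 + v ^+ 2)))) <= 4 / (1 + y ^+ 2).
    apply: le_trans (exp_le_inv (sqr_ge0 y)); rewrite ler_expR lerN2.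
    rewrite ler_wpM2l ?sqr_ge0// lef_pV2 ?posrE ?mulr_gt0//; nra.
  have si : (1 + v ^+ 2)^-1 <= 1 by rewrite invf_le1// lerDl sqr_ge0.
  have si0 : 0 <= (1 + v ^+ 2)^-1 by rewrite invr_ge0 ltW.
  apply: (@le_trans _ _ (1 * (1 * (4 / (1 + y ^+ 2))))).
    by apply: ler_pM => //; [rewrite mulr_ge0|apply: ler_pM].
  rewrite !mul1r; apply: (@le_trans _ _ (16 * (hcauchy 1 v / (1 + y ^+ 2)))).
    rewrite mulrA ler_pM2r ?invr_gt0//.
    by have := @hcauchy1_ge v; rewrite v0 v1 => /(_ isT); lra.
  rewrite ler_pM2l// /domker lerDl divr_ge0 ?sqr_ge0//.
have Ele := expN_le y sv.
apply: (@le_trans _ _ (2 * (v / (1 + y ^+ 2 / 4 + v ^+ 2) ^+ 2))); last first.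
  rewrite /domker mulrDr ler_wpDl//.
    by rewrite mulr_ge0// divr_ge0 ?hcauchy_ge0// ltW.
  rewrite ler_wpM2r// ?divr_ge0 ?sqr_ge0//; lra.
have dE : 1 + v ^+ 2 + y ^+ 2 / 4 = 1 + y ^+ 2 / 4 + v ^+ 2 by rewrite addrAC.
rewrite dE in Ele.
apply: (@le_trans _ _ ((1 + v ^+ 2)^-1 * (r^-1 * ((1 + v ^+ 2) ^+ 2 / (1 + y ^+ 2 / 4 + v ^+ 2) ^+ 2)))).
  by rewrite !ler_wpM2l// invr_ge0 ltW.
have r0 : 0 < r by apply: lt_le_trans rv.
set D := _ + _ + _ ^+ 2 in d0 *.
have -> : (1 + v ^+ 2)^-1 * (r^-1 * ((1 + v ^+ 2) ^+ 2 / D ^+ 2)) = r / D ^+ 2.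
  by rewrite -r2; field; rewrite !lt0r_neq0.
rewrite mulrA ler_pM2r ?invr_gt0 ?exprn_gt0//.
(* What remains is sqrt(1 + v^2) <= 2 v, which holds for [v >= 1]. *)
rewrite -(@ler_pXn2r _ 2) ?nnegrE ?(ltW r0) ?mulr_ge0//.
by rewrite r2; nra.
Qed.


Lemma hcauchy_mixker_le t v y : 0 < t -> 0 <= v ->
  hcauchy t v * (v ^+ 2 / (1 + v ^+ 2) * mixker v y) <= t * (16 * domker v y).
Proof.
move=> t0 v0; rewrite -mulrA mulrA ler_pM ?hcauchy_le ?kappa_mixker_le//.
  by rewrite mulr_ge0 ?hcauchy_ge0 ?sqr_ge0// ltW.
by rewrite mulr_ge0 ?mixker_ge0// invr_ge0 ltW.
Qed.

(** For [v <= 1] the kernel differs from its value at [v = 0] by O(v^2 / (1 + y^2)), and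
    [hcauchy_le] absorbs v^2. For [v >= 1] the two terms are bounded separately. *)
Lemma hcauchy_mixkerB_le t v y : 0 < t -> 0 <= v ->
  hcauchy t v * `|mixker v y - expR (- (y ^+ 2 / 2))| <= t * (128 * domker v y).
Proof.
move=> t0 v0; have sv := s_gt0 v; have rv := r_ge1 v.
have y1 : 0 < 1 + y ^+ 2 by rewrite ltr_wpDr ?sqr_ge0.
have h0 := hcauchy_ge0 v (ltW t0).
have y20 := sqr_ge0 y.
have e2 : expR (- (y ^+ 2 / 2)) <= 2 / (1 + y ^+ 2).
  apply: (le_trans (expRN_le_pow 0 (divr_ge0 (sqr_ge0 y) (ler0n _ 2)))).
  rewrite expr1 -[leRHS]invf_div lef_pV2 ?posrE//; last 2 first.
  - by apply: ltr_wpDr => //; rewrite !divr_ge0.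
  - by apply: divr_gt0.
  by rewrite divr1; lra.
have dom0 : 0 <= v / (1 + y ^+ 2 / 4 + v ^+ 2) ^+ 2 by rewrite divr_ge0 ?sqr_ge0.
have [v1|/ltW v1] := leP v 1.
  suff B : `|mixker v y - expR (- (y ^+ 2 / 2))| <= v ^+ 2 * (32 / (1 + y ^+ 2)).
    apply: (@le_trans _ _ (t * (32 / (1 + y ^+ 2)))).
      apply: (@le_trans _ _ (hcauchy t v * (v ^+ 2 * (32 / (1 + y ^+ 2))))).
        by rewrite ler_wpM2l.
      by rewrite mulrA ler_wpM2r ?hcauchy_le// divr_ge0// ltW.
    rewrite ler_pM2l// /domker mulrDr; apply: ler_wpDr; first by rewrite mulr_ge0.
    rewrite mulrA ler_pM2r ?invr_gt0//.
    by have := @hcauchy1_ge v; rewrite v0 v1 => /(_ isT); lra.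
  have si : (1 + v ^+ 2)^-1 <= 1 by rewrite invf_le1// lerDl sqr_ge0.
  have si0 : 0 <= (1 + v ^+ 2)^-1 by rewrite invr_ge0 ltW.
  have v20 := sqr_ge0 v.
  have sE : (1 + v ^+ 2)^-1 * v ^+ 2 = 1 - (1 + v ^+ 2)^-1.
    by field; rewrite lt0r_neq0.
  rewrite /mixker; set r := Num.sqrt _ in rv *.
  have r2 : r ^+ 2 = 1 + v ^+ 2 by rewrite sqr_sqrtr// ltW.
  have r0 : 0 < r by rewrite (lt_le_trans ltr01).
  have ri0 : 0 <= r^-1 by rewrite invr_ge0 ltW.
  have ri1 : r^-1 <= 1 by rewrite invf_le1.
  have ris : (1 + v ^+ 2)^-1 <= r^-1.
    by rewrite lef_pV2 ?posrE// -r2 expr2 ler_peMr// ltW.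
  set x := y ^+ 2 in y1 y20 e2 *.
  have aE : x / (2 * (1 + v ^+ 2)) = x / 2 * (1 + v ^+ 2)^-1.
    by field; rewrite lt0r_neq0.
  have /andP[ab ba] : x / 4 <= x / (2 * (1 + v ^+ 2)) <= x / 2.
    rewrite aE; apply/andP; split; last by rewrite ler_piMr// divr_ge0.
    have -> : x / 4 = x / 2 * 2^-1 by field.
    rewrite ler_wpM2l ?divr_ge0// lef_pV2 ?posrE//; nra.
  set a := x / (2 * _) in aE ab ba *.
  have Ea4 : expR (- a) <= expR (- (x / 4)) by rewrite ler_expR lerN2.
  have E0 := expR_ge0 (- a); have E20 := expR_ge0 (- (x / 2)).
  have Eab : expR (- (x / 2)) <= expR (- a) by rewrite ler_expR lerN2.
  (* By exp(-w) >= 1 - w the difference is at most [expR (- a) * (x / 2 - a)], and [x / 2 - a] is at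
     most [v ^+ 2 * (x / 2)]. *)
  have up : expR (- a) - expR (- (x / 2)) <= v ^+ 2 * (32 / (1 + x)).
    have -> : expR (- (x / 2)) = expR (- a) * expR (- (x / 2 - a)).
      by rewrite -expRD; congr expR; lra.
    have := expR_ge1Dx (- (x / 2 - a)); set w := expR (- (_ - _)) => w1.
    have xe := mulr_exp_le y20.
    have dab : x / 2 - a <= v ^+ 2 * (x / 2).
      rewrite aE -[X in X - _]mulr1 -mulrBr -sE mulrC ler_wpM2r ?divr_ge0//.
      by rewrite mulrC ler_piMr.
    have dab0 : 0 <= x / 2 - a by lra.
    apply: (@le_trans _ _ (expR (- a) * (x / 2 - a))); first by nra.
    apply: (@le_trans _ _ (expR (- (x / 4)) * (v ^+ 2 * (x / 2)))).
      exact: ler_pM.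
    have -> : expR (- (x / 4)) * (v ^+ 2 * (x / 2)) =
              v ^+ 2 * (x * expR (- (x / 4)) / 2) by ring.
    by rewrite ler_wpM2l//; lra.
  have lo : expR (- (x / 2)) - r^-1 * expR (- a) <= v ^+ 2 * (32 / (1 + x)).
    apply: (@le_trans _ _ (expR (- (x / 2)) * (1 - (1 + v ^+ 2)^-1))); first by nra.
    rewrite -sE mulrC; apply: (@le_trans _ _ (v ^+ 2 * expR (- (x / 2)))).
      by rewrite ler_wpM2r// ler_piMl.
    rewrite ler_wpM2l//; apply: (le_trans e2); rewrite ler_wpM2r ?invr_ge0 ?ltW//; lra.
  by rewrite ler_norml; apply/andP; split; nra.
have hv : hcauchy t v <= t * (2 / (1 + v ^+ 2)).
  have v20 : 0 < v ^+ 2 by rewrite exprn_gt0// (lt_le_trans ltr01).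
  apply: (@le_trans _ _ (t / v ^+ 2)); first by rewrite ler_pdivlMr// hcauchy_le.
  by rewrite ler_pM2l// -[leRHS]invf_div lef_pV2 ?posrE ?divr_gt0//; nra.
have D0 := domker_ge0 y v0.
have B1 := kappa_mixker_le y v0.
have B2 : (1 + v ^+ 2)^-1 * expR (- (y ^+ 2 / 2)) <= 4 * domker v y.
  apply: (@le_trans _ _ ((1 + v ^+ 2)^-1 * (2 / (1 + y ^+ 2)))).
    by rewrite ler_wpM2l// invr_ge0 ltW.
  rewrite /domker mulrDr; apply: ler_wpDr; first by rewrite mulr_ge0.
  rewrite [leLHS]mulrA [leRHS]mulrA ler_pM2r ?invr_gt0//.
  by have := hcauchy_ge v ltr01; rewrite expr1n div1r; lra.
apply: (@le_trans _ _ (t * (2 / (1 + v ^+ 2)) * (mixker v y + expR (- (y ^+ 2 / 2))))).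
  apply: ler_pM => //; apply: le_trans (ler_normB _ _) _.
  by rewrite !ger0_norm ?mixker_ge0 ?expR_ge0.
rewrite -mulrA ler_pM2l//; set e := expR _ in B2 *.
have -> : 2 / (1 + v ^+ 2) * (mixker v y + e) =
   2 * ((1 + v ^+ 2)^-1 * mixker v y) + 2 * ((1 + v ^+ 2)^-1 * e) by ring.
by lra.
Qed.

(** The weight y^2 / (1 + v^2)^2 is the squared shrinkage bias (y - k y)^2 with k = v^2 / (1 + v^2).
    It is small only for large [v], so the part [v <= 1] leaves a term without factor [t] but with
    Gaussian decay in [y]. *)
Lemma mixker_shrink_le t v y : 0 < t -> 0 <= v ->
  hcauchy t v * (y ^+ 2 / (1 + v ^+ 2) ^+ 2 * mixker v y) <=
  hcauchy t v * (y ^+ 2 * expR (- (y ^+ 2 / 4))) + t * (28 * domker v y).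
Proof.
move=> t0 v0; have sv := s_gt0 v; have rv := r_ge1 v.
have h0 := hcauchy_ge0 v (ltW t0); have y20 := sqr_ge0 y.
have D0 := domker_ge0 y v0.
rewrite /mixker; set r := Num.sqrt _ in rv *.
have r0 : 0 < r by rewrite (lt_le_trans ltr01).
have ri0 : 0 <= r^-1 by rewrite invr_ge0 ltW.
have ri1 : r^-1 <= 1 by rewrite invf_le1.
have E0 := expR_ge0 (- (y ^+ 2 / (2 * (1 + v ^+ 2)))).
have [v1|/ltW v1] := leP v 1.
  apply: ler_wpDr; first by rewrite !mulr_ge0// ltW.
  rewrite ler_wpM2l//; apply: ler_pM.
  - by rewrite divr_ge0 ?sqr_ge0.
  - by rewrite mulr_ge0.
  - rewrite ler_piMr// invf_le1 ?exprn_gt0// exprn_ege1// lerDl sqr_ge0//.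
  - rewrite -[leRHS]mul1r; apply: ler_pM => //.
    rewrite ler_expR lerN2 ler_wpM2l// lef_pV2 ?posrE ?mulr_gt0//; nra.
apply: ler_wpDl; first by apply: mulr_ge0 => //; rewrite mulr_ge0 ?expR_ge0.
have hv : hcauchy t v <= t * (2 / (1 + v ^+ 2)).
  have v20 : 0 < v ^+ 2 by rewrite exprn_gt0// (lt_le_trans ltr01).
  apply: (@le_trans _ _ (t / v ^+ 2)); first by rewrite ler_pdivlMr// hcauchy_le.
  by rewrite ler_pM2l// -[leRHS]invf_div lef_pV2 ?posrE ?divr_gt0//; nra.
have x0 : 0 <= y ^+ 2 / (2 * (1 + v ^+ 2)).
  by rewrite divr_ge0// mulr_ge0// ltW.
have := mulr_exp_sqr_le x0; set E := expR _ in E0 *.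
set D := 1 + y ^+ 2 / 4 + v ^+ 2.
have Dp : 0 < D by rewrite /D addrAC ltr_wpDr// divr_ge0.
have -> : 1 + y ^+ 2 / (2 * (1 + v ^+ 2)) / 2 = D / (1 + v ^+ 2).
  by rewrite /D; field; rewrite lt0r_neq0.
move=> EE.
have E1 : y ^+ 2 / (1 + v ^+ 2) ^+ 2 * (r^-1 * E) <= 14 * (1 + v ^+ 2) * (v / D ^+ 2).
  have -> : y ^+ 2 / (1 + v ^+ 2) ^+ 2 * (r^-1 * E) =
     (1 + v ^+ 2)^-1 * r^-1 * (2 * (y ^+ 2 / (2 * (1 + v ^+ 2))) * E).
    by field; rewrite !lt0r_neq0.
  apply: (@le_trans _ _ ((1 + v ^+ 2)^-1 * v * (14 / (D / (1 + v ^+ 2)) ^+ 2))).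
    apply: ler_pM => //.
    - by apply: mulr_ge0 => //; rewrite invr_ge0 ltW.
    - by apply: mulr_ge0 => //; apply: mulr_ge0 => //; rewrite mulr_ge0.
    - by rewrite ler_wpM2l ?invr_ge0 ?(ltW sv)// (le_trans ri1).
  rewrite le_eqVlt; apply/orP; left; apply/eqP.
  by field; rewrite !lt0r_neq0.
apply: (@le_trans _ _ (t * (2 / (1 + v ^+ 2)) * (14 * (1 + v ^+ 2) * (v / D ^+ 2)))).
  apply: ler_pM => //; apply: mulr_ge0; last exact: mulr_ge0.
  by rewrite divr_ge0 ?sqr_ge0.
have -> : t * (2 / (1 + v ^+ 2)) * (14 * (1 + v ^+ 2) * (v / D ^+ 2)) =
   t * (28 * (v / D ^+ 2)) by field; rewrite !lt0r_neq0.
rewrite !ler_pM2l// /domker -/D lerDr divr_ge0 ?hcauchy_ge0//.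
by rewrite addr_ge0.
Qed.

End scale_mixture.

(** * Tonelli's theorem with one variable restricted to a set *)

Section tonelli_restrict.
Local Open Scope ereal_scope.
Context d1 d2 (T1 : measurableType d1) (T2 : measurableType d2) (R : realType).
Variables (m1 : {sigma_finite_measure set T1 -> \bar R}).
Variables (m2 : {sigma_finite_measure set T2 -> \bar R}).
Variables (D : set T2) (f : T1 * T2 -> R).
Hypotheses (mD : measurable D) (mf : measurable_fun setT f).
Hypothesis f0 : forall x y, D y -> (0 <= f (x, y))%R.

Let g : T1 * T2 -> \bar R := fun z => (f z * \1_D z.2)%:E.

Let mg : measurable_fun setT g.
Proof.
apply/measurable_EFinP; apply: measurable_funM => //.
by apply: (measurableT_comp (f := \1_D : T2 -> R)).
Qed.

Let g0 z : 0 <= g z.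
Proof.
case: z => x y; rewrite /g lee_fin indicE /=.
have [/set_mem Dy|_] := boolP (y \in D); last by rewrite mulr0.
by rewrite mulr1 f0.
Qed.

Let gE x : \int[m2]_y g (x, y) = \int[m2]_(y in D) (f (x, y))%:E.
Proof.
rewrite [RHS]integral_mkcond; apply: eq_integral => y _.
by rewrite /g patchE indicE /=; case: (y \in D); rewrite ?mulr1 ?mulr0.
Qed.

Lemma measurable_integral_restrict :
  measurable_fun setT (fun x => \int[m2]_(y in D) (f (x, y))%:E).
Proof.
under eq_fun do rewrite -gE.
exact: measurable_fun_fubini_tonelli_F.
Qed.

Lemma tonelli_restrict :
  \int[m1]_x \int[m2]_(y in D) (f (x, y))%:E =
  \int[m2]_(y in D) \int[m1]_x (f (x, y))%:E.
Proof.
under eq_integral do rewrite -gE.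
rewrite fubini_tonelli// [RHS]integral_mkcond; apply: eq_integral => y _.
rewrite patchE; case: ifPn => yD.
  by apply: eq_integral => x _; rewrite /g indicE yD mulr1.
by rewrite integral0_eq// => x _; rewrite /g indicE (negbTE yD) mulr0.
Qed.

End tonelli_restrict.

(** * The marginal density as a half-Cauchy mixture *)

Section half_cauchy_mixture.
Context {R : realType}.
Local Notation mu := (@lebesgue_measure R).
Implicit Types (t v y : R).
Local Notation I f := (\int[mu]_(v in `[0%R, +oo[) (f v)%:E)%E.

Lemma measurable_hcauchy t : measurable_fun setT (hcauchy t : R -> R).
Proof. rewrite /hcauchy; measR. Qed.

Lemma measurable_mixker2 :
  measurable_fun setT (fun z : R * R => mixker z.1 z.2).
Proof. rewrite /mixker; measR. Qed.

Lemma measurable_mixker y : measurable_fun setT (mixker^~ y).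
Proof. rewrite /mixker; measR. Qed.

Lemma measurable_domker y : measurable_fun setT (domker^~ y).
Proof. rewrite /domker /hcauchy; measR. Qed.

(** This is sqrt(2 pi) times the marginal density of one observation. The integral is finite by
    [mixE], so [fine] loses nothing. *)
Definition mix t y : R := fine (I (fun v => hcauchy t v * mixker v y)).

Lemma integral_hcauchy_scaled t (c : R) : 0 < t -> 0 <= c ->
  I (fun v => hcauchy t v * c) = c%:E.
Proof.
move=> t0 c0; under eq_integral do rewrite mulrC.
rewrite integralRZl//; last 2 first.
- exact: measurable_hcauchy.
- by move=> v _; rewrite hcauchy_ge0// ltW.
by rewrite integral_hcauchy// mule1.
Qed.

Lemma mixE t y : 0 < t ->
  I (fun v => hcauchy t v * mixker v y) = (mix t y)%:E.
Proof.
move=> t0; rewrite /mix fineK// ge0_fin_numE; last first.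
  apply: integral_ge0 => v _.
  by rewrite lee_fin mulr_ge0 ?mixker_ge0 ?hcauchy_ge0 ?(ltW t0).
apply: (@le_lt_trans _ _ (I (fun v => hcauchy t v * 1))); last first.
  by rewrite integral_hcauchy_scaled// ltry.
apply: le_integralR => //.
- by apply: measurable_funM; [exact: measurable_hcauchy|exact: measurable_mixker].
- by apply: measurable_funM => //; exact: measurable_hcauchy.
- move=> v _; have h0 := hcauchy_ge0 v (ltW t0).
  by rewrite mulr_ge0 ?mixker_ge0// ler_wpM2l// mixker_le1.
Qed.

Lemma measurable_mix t : 0 < t -> measurable_fun setT (mix t).
Proof.
move=> t0; apply: measurableT_comp; first exact: fine_measurable.
apply: (measurable_integral_restrict mu
  (f := fun z => hcauchy t z.2 * mixker z.2 z.1)) => //.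
- rewrite /hcauchy /mixker; measR.
- by move=> y v _ /=; rewrite mulr_ge0 ?mixker_ge0 ?hcauchy_ge0 ?(ltW t0).
Qed.

Let Dge0 (v : R) : `[0%R, +oo[%classic v -> 0 <= v.
Proof. by rewrite /= in_itv/= andbT. Qed.

Lemma integral_domker y : (I (domker^~ y) <= (3 / (1 + y ^+ 2))%:E)%E.
Proof.
have y20 := sqr_ge0 y; have y1 : 0 < 1 + y ^+ 2 by rewrite ltr_wpDr.
have -> : I (domker^~ y) = ((1 + y ^+ 2)^-1 + (2 * (1 + y ^+ 2 / 4))^-1)%:E.
  have c0 : 0 < 1 + y ^+ 2 / 4 + 0 ^+ 2 by rewrite expr0n/= addr0 ltr_wpDr ?divr_ge0.
  rewrite /domker integralRD//; last 4 first.
  - by apply: measurable_funM => //; exact: measurable_hcauchy.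
  - measR.
  - by move=> v _; rewrite mulr_ge0 ?hcauchy_ge0// invr_ge0 ltW.
  - by move=> v /Dge0 v0; rewrite divr_ge0 ?sqr_ge0.
  rewrite integral_hcauchy_scaled ?invr_ge0 ?(ltW y1)//.
  by rewrite (integral_rational_tail _ c0)// expr0n/= addr0.
rewrite lee_fin.
have -> : (2 * (1 + y ^+ 2 / 4))^-1 = 2 / (4 + y ^+ 2).
  by field; apply: lt0r_neq0; lra.
have : 2 / (4 + y ^+ 2) <= 2 / (1 + y ^+ 2).
  by rewrite ler_pM2l// lef_pV2 ?posrE; lra.
rewrite -[(1 + _)^-1]mul1r.
by move: (_ / (4 + _)) => a aa; lra.
Qed.

Let le_domker (f : R -> R) t y (K : R) : 0 < t -> 0 <= K ->
  measurable_fun setT f ->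
  (forall v, 0 <= v -> 0 <= f v <= t * (K * domker v y)) ->
  (I f <= (t * (3 * K) / (1 + y ^+ 2))%:E)%E.
Proof.
move=> t0 K0 mf fK.
apply: (@le_trans _ _ (I (fun v => t * K * domker v y))).
  apply: le_integralR => //.
  - by apply: measurable_funM => //; exact: measurable_domker.
  - by move=> v /Dge0 v0; rewrite -mulrA; exact: fK.
rewrite integralRZl//; last 3 first.
- exact: measurable_domker.
- by rewrite mulr_ge0// ltW.
- by move=> v /Dge0 v0; exact: domker_ge0.
have -> : t * (3 * K) / (1 + y ^+ 2) = t * K * (3 / (1 + y ^+ 2)) by ring.
rewrite [leRHS]EFinM; apply: lee_wpmul2l; last exact: integral_domker.
by rewrite lee_fin mulr_ge0// ltW.
Qed.

Lemma integral_kappa_le t y : 0 < t ->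
  (I (fun v => hcauchy t v * (v ^+ 2 / (1 + v ^+ 2) * mixker v y))
   <= (t * 48 / (1 + y ^+ 2))%:E)%E.
Proof.
move=> t0; have -> : 48 = 3 * 16 :> R by ring.
apply: le_domker => //.
  by rewrite /hcauchy /mixker; measR.
move=> v v0; rewrite hcauchy_mixker_le// andbT.
rewrite mulr_ge0 ?hcauchy_ge0 ?(ltW t0)// mulr_ge0 ?mixker_ge0// divr_ge0 ?sqr_ge0//.
by rewrite addr_ge0 ?sqr_ge0.
Qed.

Lemma integral_mixkerB_le t y : 0 < t ->
  (I (fun v => hcauchy t v * `|mixker v y - expR (- (y ^+ 2 / 2))|)
   <= (t * 384 / (1 + y ^+ 2))%:E)%E.
Proof.
move=> t0; have -> : 384 = 3 * 128 :> R by ring.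
apply: le_domker => //.
  by rewrite /hcauchy /mixker; measR.
move=> v v0; rewrite hcauchy_mixkerB_le// andbT.
by rewrite mulr_ge0 ?hcauchy_ge0 ?(ltW t0).
Qed.

Lemma integral_shrink_le t y : 0 < t ->
  (I (fun v => hcauchy t v * (y ^+ 2 / (1 + v ^+ 2) ^+ 2 * mixker v y))
   <= (y ^+ 2 * expR (- (y ^+ 2 / 4)) + t * 84 / (1 + y ^+ 2))%:E)%E.
Proof.
move=> t0; have e0 : 0 <= y ^+ 2 * expR (- (y ^+ 2 / 4)).
  by rewrite mulr_ge0 ?sqr_ge0 ?expR_ge0.
have m1 := measurable_hcauchy t; have m2 := measurable_domker y.
apply: (@le_trans _ _ (I (fun v => hcauchy t v * (y ^+ 2 * expR (- (y ^+ 2 / 4)))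
    + t * (28 * domker v y)))).
  apply: le_integralR => //.
  - by rewrite /hcauchy /mixker; measR.
  - by measR.
  - move=> v /Dge0 v0; rewrite mixker_shrink_le// andbT.
    rewrite mulr_ge0 ?hcauchy_ge0 ?(ltW t0)// mulr_ge0 ?mixker_ge0// divr_ge0 ?sqr_ge0//.
rewrite integralRD//; last 4 first.
- by measR.
- by measR.
- by move=> v _; rewrite mulr_ge0// hcauchy_ge0// ltW.
- by move=> v /Dge0 v0; rewrite !mulr_ge0 ?domker_ge0// ltW.
rewrite integral_hcauchy_scaled// EFinD leeD2l//.
have -> : 84 = 3 * 28 :> R by ring.
apply: le_domker => //; first by measR.
by move=> v v0; rewrite lexx andbT !mulr_ge0 ?domker_ge0// ltW.
Qed.

Lemma mix_ge0 t y : 0 < t -> 0 <= mix t y.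
Proof.
move=> t0; rewrite -lee_fin -mixE//; apply: integral_ge0 => v _.
by rewrite lee_fin mulr_ge0 ?mixker_ge0 ?hcauchy_ge0 ?(ltW t0).
Qed.

(* As [t] tends to [0] the mixing variable concentrates at [0], where the kernel
   is [exp (- y^2 / 2)]. *)
Lemma mix_dist t y : 0 < t ->
  `|mix t y - expR (- (y ^+ 2 / 2))| <= t * 384 / (1 + y ^+ 2).
Proof.
move=> t0; have B := integral_mixkerB_le y t0.
have m1 := measurable_hcauchy t; have m2 := measurable_mixker y.
set e := expR _ in B *; have e0 : 0 <= e by exact: expR_ge0.
have h0 v : 0 <= hcauchy t v by rewrite hcauchy_ge0// ltW.
have mI : measurable_fun setT (fun v => hcauchy t v * `|mixker v y - e|) by measR.
have n0 (v : R) : 0 <= hcauchy t v * `|mixker v y - e| by rewrite mulr_ge0.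
rewrite ler_norml; apply/andP; split.
  rewrite lerBrDl lerBlDr -lee_fin EFinD.
  apply: (@le_trans _ _ (I (fun v => hcauchy t v * mixker v y +
     hcauchy t v * `|mixker v y - e|))); last first.
    rewrite integralRD//; last 2 first.
    - by measR.
    - by move=> v _; rewrite mulr_ge0 ?mixker_ge0.
    by rewrite mixE// leeD2l.
  rewrite -(@integral_hcauchy_scaled t e)//; apply: le_integralR => //.
  - by measR.
  - by measR.
  - move=> v _; rewrite mulr_ge0//= -mulrDr ler_wpM2l//.
    by rewrite -lerBlDl -normrN opprB ler_norm.
rewrite lerBlDl -lee_fin EFinD.
apply: (@le_trans _ _ (I (fun v => hcauchy t v * e +
     hcauchy t v * `|mixker v y - e|))); last first.
  rewrite integralRD//; last 2 first.
  - by measR.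
  - by move=> v _; rewrite mulr_ge0.
  by rewrite integral_hcauchy_scaled// leeD2l.
rewrite -mixE//; apply: le_integralR => //.
- by measR.
- by measR.
- move=> v _; rewrite mulr_ge0 ?mixker_ge0//= -mulrDr ler_wpM2l//.
  by rewrite -lerBlDl ler_norm.
Qed.

Let hcauchy_scale (s t v : R) : 0 < s -> s <= t ->
  hcauchy t v <= t / s * hcauchy s v.
Proof.
move=> s0 st; have t0 : 0 < t by apply: lt_le_trans st.
have ds : 0 < s ^+ 2 + v ^+ 2 by rewrite ltr_wpDr ?sqr_ge0 ?exprn_gt0.
have dt : 0 < t ^+ 2 + v ^+ 2 by rewrite ltr_wpDr ?sqr_ge0 ?exprn_gt0.
rewrite /hcauchy.
have -> : t / s * (2 / pi * (s / (s ^+ 2 + v ^+ 2))) = 2 / pi * (t / (s ^+ 2 + v ^+ 2)).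
  by move: (2 / pi) => c; field; rewrite !lt0r_neq0.
rewrite ler_wpM2l ?divr_ge0 ?pi_ge0// ler_wpM2l ?(ltW t0)//.
by rewrite lef_pV2 ?posrE// lerD2r ler_sqr ?nnegrE ?(ltW s0) ?(ltW t0).
Qed.

Let hcauchy_diff (s t v : R) : 0 < s -> s <= t ->
  `|hcauchy t v - hcauchy s v| <= (t / s - 1) * hcauchy s v.
Proof.
move=> s0 st; have t0 : 0 < t by apply: lt_le_trans st.
have ds : 0 < s ^+ 2 + v ^+ 2 by rewrite ltr_wpDr ?sqr_ge0 ?exprn_gt0.
have dt : 0 < t ^+ 2 + v ^+ 2 by rewrite ltr_wpDr ?sqr_ge0 ?exprn_gt0.
have up := hcauchy_scale v s0 st; have h0 := hcauchy_ge0 v (ltW s0).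
rewrite ler_norml; apply/andP; split; last by lra.
have lo : s / t * hcauchy s v <= hcauchy t v.
  rewrite /hcauchy.
  have -> : s / t * (2 / pi * (s / (s ^+ 2 + v ^+ 2))) =
            2 / pi * (s ^+ 2 / (t * (s ^+ 2 + v ^+ 2))).
    by move: (2 / pi) => c; field; rewrite !lt0r_neq0.
  rewrite ler_wpM2l ?divr_ge0 ?pi_ge0//.
  rewrite ler_pdivlMr// mulrAC ler_pdivrMr ?mulr_gt0//.
  have v2 := sqr_ge0 v; have : s ^+ 2 <= t ^+ 2 by rewrite ler_sqr ?nnegrE ?(ltW s0) ?(ltW t0).
  by nra.
have am : 2 - t / s <= s / t.
  have [ts tt] : t / s = t / s /\ (s / t) * (t / s) = 1 by split=> //; field; rewrite !lt0r_neq0.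
  have : 0 < t / s by rewrite divr_gt0.
  have : 0 < s / t by rewrite divr_gt0.
  by move: tt; move: (s / t) (t / s) => a b; have := sqr_ge0 (b - 1); nra.
by nra.
Qed.

(** The ratio of the two half-Cauchy densities is at most t / s at every [v]. *)
Lemma mix_scale (s t y : R) : 0 < s -> s <= t -> mix t y <= t / s * mix s y.
Proof.
move=> s0 st; have t0 : 0 < t by apply: lt_le_trans st.
have ms := measurable_hcauchy s; have mt := measurable_hcauchy t.
have mk := measurable_mixker y.
have ts0 : 0 <= t / s by rewrite divr_ge0 ?ltW.
have hs0 v := hcauchy_ge0 v (ltW s0); have ht0 v := hcauchy_ge0 v (ltW t0).
rewrite -lee_fin EFinM -!mixE// -integralRZl//; last 2 first.
- by measR.
- by move=> v _; rewrite mulr_ge0 ?mixker_ge0.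
apply: le_integralR => //.
- by measR.
- by measR.
- move=> v _; rewrite mulr_ge0 ?mixker_ge0//= mulrA ler_wpM2r ?mixker_ge0//.
  exact: hcauchy_scale.
Qed.

(** Both half-Cauchy densities have mass one, so the kernel can be centred at exp(-y^2/2) before the
    densities are subtracted. The increment then inherits the factor s / (1 + y^2) of
    [integral_mixkerB_le]. *)
Lemma mix_increment (s t y : R) : 0 < s -> s <= t ->
  mix t y <= mix s y + (t / s - 1) * (s * 384 / (1 + y ^+ 2)).
Proof.
move=> s0 st; have t0 : 0 < t by apply: lt_le_trans st.
have ms := measurable_hcauchy s; have mt := measurable_hcauchy t.
have mk := measurable_mixker y.
have ts0 : 0 <= t / s - 1 by rewrite subr_ge0 ler_pdivlMr// mul1r.
have hs0 v := hcauchy_ge0 v (ltW s0); have ht0 v := hcauchy_ge0 v (ltW t0).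
have B := integral_mixkerB_le y s0.
set e := expR _ in B; have e0 : 0 <= e by exact: expR_ge0.
rewrite -(lerD2r e) addrAC -lee_fin.
(* With [k] the kernel, the integrands satisfy (h_t - h_s)(k - e) <= |h_t - h_s| |k - e|, rearranged
   so that only nonnegative functions are integrated. *)
apply: (@le_trans _ _ (I (fun v => (hcauchy s v * mixker v y + hcauchy t v * e) +
    (t / s - 1) * (hcauchy s v * `|mixker v y - e|)))).
  rewrite EFinD -mixE// -(@integral_hcauchy_scaled s e)// -integralRD//; last 4 first.
  - by measR.
  - by measR.
  - by move=> v _; rewrite mulr_ge0 ?mixker_ge0.
  - by move=> v _; rewrite mulr_ge0.
  apply: le_integralR => //.
  - by measR.
  - by measR.
  - move=> v _; rewrite addr_ge0 ?(mulr_ge0 (ht0 v) (mixker_ge0 v y))//=;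
      last exact: mulr_ge0.
    have := hcauchy_diff v s0 st.
    have : (hcauchy t v - hcauchy s v) * (mixker v y - e) <=
        `|hcauchy t v - hcauchy s v| * `|mixker v y - e|.
      by rewrite -normrM ler_norm.
    have := normr_ge0 (mixker v y - e).
    move: (`|mixker v y - e|) (`|hcauchy t v - hcauchy s v|) => a b; nra.
rewrite integralRD//; last 4 first.
- by measR.
- by measR.
- move=> v _; rewrite addr_ge0 ?(mulr_ge0 (hs0 v) (mixker_ge0 v y))//.
  exact: mulr_ge0.
- by move=> v _; apply: mulr_ge0 => //; exact: mulr_ge0.
rewrite integralRD//; last 4 first.
- by measR.
- by measR.
- by move=> v _; rewrite mulr_ge0 ?mixker_ge0.
- by move=> v _; rewrite mulr_ge0.
rewrite mixE// integral_hcauchy_scaled// integralRZl//; last 2 first.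
- by measR.
- by move=> v _; rewrite mulr_ge0.
rewrite [leRHS]EFinD [X in (_ <= X + _)%E]EFinD leeD2l// [leRHS]EFinM.
by rewrite lee_wpmul2l// lee_fin.
Qed.

Let mix_ge_itv t y (a b c : R) : 0 < t -> 0 <= a -> a <= b -> 0 <= c ->
  (forall v, a <= v <= b -> c <= hcauchy t v * mixker v y) ->
  c * (b - a) <= mix t y.
Proof.
move=> t0 a0 ab c0 cab.
have mt := measurable_hcauchy t; have mk := measurable_mixker y.
rewrite -lee_fin -mixE//.
apply: (@le_trans _ _ (\int[mu]_(v in `[a, b]) (hcauchy t v * mixker v y)%:E)%E).
  apply: (@le_trans _ _ (\int[mu]_(v in `[a, b]) c%:E)%E).
    rewrite integral_cst//= lebesgue_measure_itv/= lte_fin.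
    case: ltP => [_|ba]; first by rewrite -EFinB -EFinM.
    have -> : a = b by apply/eqP; rewrite eq_le ab ba.
    by rewrite subrr mulr0 mule0.
  apply: le_integralR => //.
  - by measR.
  - by move=> v; rewrite /= in_itv/= => vab; rewrite c0 cab.
apply: ge0_subset_integral => //.
- by apply: measurable_funTS; apply/measurable_EFinP; measR.
- by move=> v _; rewrite lee_fin mulr_ge0 ?mixker_ge0 ?hcauchy_ge0 ?(ltW t0).
- by move=> v /=; rewrite !in_itv/= => /andP[av _]; rewrite (le_trans a0).
Qed.

Lemma mix_gt0 t y : 0 < t -> 0 < mix t y.
Proof.
move=> t0; have e0 := expR_gt0 (- (y ^+ 2 / 2)).
have d0 : 0 < t ^+ 2 + 1 by rewrite ltr_wpDr// exprn_gt0.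
have c0 : 0 < t / (t ^+ 2 + 1) / 2 * (expR (- (y ^+ 2 / 2)) / 2).
  apply: mulr_gt0; last by rewrite divr_gt0.
  by rewrite divr_gt0// divr_gt0.
apply: (@lt_le_trans _ _ (t / (t ^+ 2 + 1) / 2 * (expR (- (y ^+ 2 / 2)) / 2) * (1 - 0))).
  by rewrite subr0 mulr1.
apply: mix_ge_itv => //; first exact: ltW.
move=> v /andP[v0 v1]; have v21 : v ^+ 2 <= 1 by rewrite exprn_ile1.
have v20 := sqr_ge0 v; have s0 : 0 < 1 + v ^+ 2 by rewrite ltr_wpDr.
apply: ler_pM.
- by rewrite divr_ge0// divr_ge0// ltW.
- by rewrite divr_ge0// ltW.
- apply: le_trans (hcauchy_ge v t0); rewrite ler_wpM2r// ler_wpM2l ?(ltW t0)//.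
  rewrite lef_pV2 ?posrE ?lerD2l//.
  by rewrite ltr_wpDr// exprn_gt0.
rewrite /mixker mulrC; apply: ler_pM => //.
  rewrite lef_pV2 ?posrE// ?sqrtr_gt0//.
  rewrite -(@ler_pXn2r _ 2) ?nnegrE ?sqrtr_ge0// sqr_sqrtr ?(ltW s0)//.
  by rewrite (_ : 2 ^+ 2 = 4 :> R); [lra|ring].
rewrite ler_expR lerN2 ler_wpM2l ?sqr_ge0// lef_pV2 ?posrE ?mulr_gt0//; lra.
Qed.

(** Only scales in [0, t] are kept: there the half-Cauchy density is at least 1 / (4 t) and the
    kernel at least half its value at [v = 0]. *)
Lemma mix_ge_exp t y : 0 < t <= 1 -> expR (- (y ^+ 2 / 2)) / 8 <= mix t y.
Proof.
move=> /andP[t0 t1].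
have E0 := expR_ge0 (- (y ^+ 2 / 2)).
have -> : expR (- (y ^+ 2 / 2)) / 8 = expR (- (y ^+ 2 / 2)) / 8 / t * (t - 0).
  by rewrite subr0 divfK// lt0r_neq0.
apply: mix_ge_itv => //; first exact: ltW.
  by rewrite !divr_ge0// ltW.
move=> v /andP[v0 vt].
have v2 : v ^+ 2 <= t ^+ 2 by rewrite ler_sqr ?nnegrE// ltW.
have v20 := sqr_ge0 v.
have h : (4 * t)^-1 <= hcauchy t v.
  apply: le_trans (hcauchy_ge v t0).
  have d0 : 0 < t ^+ 2 + v ^+ 2 by rewrite ltr_wpDr// exprn_gt0.
  have -> : (4 * t)^-1 = t / (2 * t ^+ 2) / 2 by field; rewrite lt0r_neq0.
  rewrite ler_wpM2r// ler_wpM2l ?(ltW t0)// lef_pV2 ?posrE ?mulr_gt0 ?exprn_gt0//.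
  lra.
have k : expR (- (y ^+ 2 / 2)) / 2 <= mixker v y.
  rewrite /mixker mulrC; apply: ler_pM => //.
    rewrite lef_pV2 ?posrE// ?sqrtr_gt0; last by rewrite ltr_wpDr.
    rewrite -(@ler_pXn2r _ 2) ?nnegrE ?sqrtr_ge0// sqr_sqrtr ?addr_ge0//.
    have t21 : t ^+ 2 <= 1 by rewrite exprn_ile1// ltW.
    by rewrite (_ : 2 ^+ 2 = 4 :> R); [lra|ring].
  rewrite ler_expR lerN2 ler_wpM2l ?sqr_ge0// lef_pV2 ?posrE// ?mulr_gt0 ?ltr_wpDr//; lra.
apply: (@le_trans _ _ ((4 * t)^-1 * (expR (- (y ^+ 2 / 2)) / 2))).
  rewrite le_eqVlt; apply/orP; left; apply/eqP; field.
  by rewrite lt0r_neq0.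
by apply: ler_pM => //; rewrite ?invr_ge0 ?mulr_ge0 ?divr_ge0 ?(ltW t0).
Qed.

(** Only scales in [u, 2 u] with u = sqrt(1 + y^2) are kept. They explain an observation of size y
    at no exponential cost, and the half-Cauchy tail gives them mass of order t / u. This is the
    heavy tail of the horseshoe. *)
Lemma mix_ge t y : 0 < t <= 1 -> t / (60 * (1 + y ^+ 2)) <= mix t y.
Proof.
move=> /andP[t0 t1]; set u := Num.sqrt (1 + y ^+ 2).
have y20 := sqr_ge0 y; have y1 : 0 < 1 + y ^+ 2 by rewrite ltr_wpDr.
have u2 : u ^+ 2 = 1 + y ^+ 2 by rewrite sqr_sqrtr// ltW.
have u1 : 1 <= u by rewrite -{1}sqrtr1 ler_sqrt// ?lerDl// ltW.
have u0 : 0 < u by apply: lt_le_trans u1.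
rewrite -u2; have -> : t / (60 * u ^+ 2) = t / (10 * u ^+ 2) * (6 * u)^-1 * (2 * u - u).
  by field; rewrite lt0r_neq0.
apply: mix_ge_itv => //; first exact: ltW.
- by rewrite ler_peMl ?ler1n// ltW.
- by rewrite !mulr_ge0 ?invr_ge0 ?mulr_ge0 ?exprn_ge0// ltW.
move=> v /andP[uv vu].
have v0 : 0 <= v by rewrite (le_trans (ltW u0)).
have v2u : u ^+ 2 <= v ^+ 2 by rewrite ler_sqr ?nnegrE// ltW.
have vu2 : v ^+ 2 <= 4 * u ^+ 2.
  have -> : 4 * u ^+ 2 = (2 * u) ^+ 2 by ring.
  by rewrite ler_sqr ?nnegrE// mulr_ge0// ltW.
have u21 : 1 <= u ^+ 2 by rewrite exprn_ege1.
have t2 : t ^+ 2 <= 1 by rewrite exprn_ile1// ltW.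
apply: ler_pM.
- by rewrite divr_ge0 ?mulr_ge0 ?exprn_ge0// ltW.
- by rewrite invr_ge0 mulr_ge0// ltW.
- apply: le_trans (hcauchy_ge v t0); rewrite -mulrA -invfM.
  rewrite ler_wpM2l ?(ltW t0)// lef_pV2 ?posrE ?mulr_gt0 ?exprn_gt0//; first by lra.
  by rewrite ltr_wpDr ?exprn_ge0// exprn_gt0.
rewrite /mixker; have -> : (6 * u)^-1 = (3 * u)^-1 * 2^-1.
  by field; rewrite lt0r_neq0.
apply: ler_pM => //.
- by rewrite invr_ge0 mulr_ge0// ltW.
- have u30 : 0 <= 3 * u by rewrite mulr_ge0// ltW.
  rewrite lef_pV2 ?posrE ?mulr_gt0// ?sqrtr_gt0; last by rewrite ltr_wpDr// sqr_ge0.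
  rewrite -(@ler_pXn2r _ 2) ?nnegrE ?sqrtr_ge0// sqr_sqrtr ?addr_ge0 ?sqr_ge0//.
  by nra.
have v1 : 0 < 1 + v ^+ 2 by rewrite ltr_wpDr ?sqr_ge0.
apply: le_trans (expR_ge1Dx _).
have : y ^+ 2 / (2 * (1 + v ^+ 2)) <= 2^-1.
  by rewrite ler_pdivrMr ?mulr_gt0//; lra.
by lra.
Qed.

End half_cauchy_mixture.

(** * Gaussian conjugacy and second moments *)

Section gaussian_algebra.
Context {R : realType}.
Implicit Types (m s t v y x theta : R).
Local Notation mu := (@lebesgue_measure R).
Local Notation phi := (normal_pdf (0 : R) 1).
Local Notation c0 := (normal_peak (1 : R)).
Local Notation kap v := (v ^+ 2 / (1 + v ^+ 2)).

Lemma normal_peak1_gt0 : 0 < c0.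
Proof. by rewrite normal_peak_gt0// oner_neq0. Qed.

Lemma normal_peak1_le : c0 <= 1 / 2.
Proof.
rewrite /normal_peak expr1n mul1r div1r lef_pV2 ?posrE// ?sqrtr_gt0; last first.
  by rewrite mulrn_wgt0// pi_gt0.
rewrite -(@ler_pXn2r _ 2) ?nnegrE ?sqrtr_ge0// sqr_sqrtr; last first.
  by rewrite mulrn_wge0// pi_ge0.
by have := pi_ge2 R; rewrite -mulr_natr; lra.
Qed.

Lemma normal_peakE s : 0 < s -> normal_peak s = c0 / s.
Proof.
move=> s0; rewrite /normal_peak -mulrnAr sqrtrM ?sqr_ge0// sqrtr_sqr gtr0_norm//.
by rewrite invfM mulrC expr1n mul1r.
Qed.

Lemma std_normal_pdfE x : phi x = c0 * expR (- (x ^+ 2 / 2)).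
Proof.
rewrite normal_pdfE ?oner_neq0//= /normal_fun subr0 expr1n mulNr.
by rewrite -[1 *+ 2]/(2%:R).
Qed.

Lemma std_normal_pdf_gt0 x : 0 < phi x.
Proof. by rewrite std_normal_pdfE mulr_gt0 ?normal_peak1_gt0 ?expR_gt0. Qed.

Lemma normal_pdf_posE m s x : 0 < s ->
  normal_pdf m s x = c0 / s * expR (- ((x - m) ^+ 2 / (2 * s ^+ 2))).
Proof.
move=> s0; rewrite normal_pdfE ?lt0r_neq0//= normal_peakE// /normal_fun.
by rewrite mulNr -mulr_natl.
Qed.

(* Completing the square: the conditional law of the mean given the scale [v]. *)
Lemma normal_posterior v y theta : 0 < v ->
  phi (y - theta) * (phi (theta / v) * v^-1) =
  c0 * mixker v y * normal_pdf (kap v * y) (Num.sqrt (kap v)) theta.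
Proof.
move=> v0; have s0 : 0 < 1 + v ^+ 2 by rewrite ltr_wpDr ?sqr_ge0.
have k0 : 0 < kap v by rewrite divr_gt0 ?exprn_gt0.
rewrite !std_normal_pdfE normal_pdf_posE ?sqrtr_gt0// /mixker.
rewrite sqr_sqrtr ?(ltW k0)// sqrtrM ?sqr_ge0// sqrtrV ?(ltW s0)// sqrtr_sqr gtr0_norm//.
set r := Num.sqrt _; have r0 : 0 < r by rewrite sqrtr_gt0.
transitivity (c0 ^+ 2 / v * expR (- (y ^+ 2 / (2 * (1 + v ^+ 2))) -
    ((theta - kap v * y) ^+ 2 / (2 * kap v)))).
  have -> : - (y ^+ 2 / (2 * (1 + v ^+ 2))) -
      ((theta - kap v * y) ^+ 2 / (2 * kap v)) =
      - ((y - theta) ^+ 2 / 2) - ((theta / v) ^+ 2 / 2).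
    by field; rewrite !lt0r_neq0.
  rewrite expRD; set A := expR _; set B := expR _; set c := c0.
  by field; rewrite lt0r_neq0.
rewrite expRD; set A := expR _; set B := expR _; set c := c0.
by field; rewrite !lt0r_neq0.
Qed.

(** Since w exp(-w) <= 1, the density times (x - m)^2 is at most 6 s^2 times the normal density with
    doubled variance, which integrates to one. *)
Lemma normal_second_moment_le m s (c : R) : 0 < s ->
  (\int[mu]_x ((x - c) ^+ 2 * normal_pdf m s x)%:E
    <= (12 * s ^+ 2 + 2 * (m - c) ^+ 2)%:E)%E.
Proof.
move=> s0; have q0 : 0 < Num.sqrt 2 * s by rewrite mulr_gt0// sqrtr_gt0.
have m1 := measurable_normal_pdf m s.
have m2 := measurable_normal_pdf m (Num.sqrt 2 * s).
apply: (@le_trans _ _ (\int[mu]_x (12 * s ^+ 2 * normal_pdf m (Num.sqrt 2 * s) x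
    + 2 * (m - c) ^+ 2 * normal_pdf m s x)%:E)%E); last first.
  rewrite integralRD//; last 4 first.
  - measR.
  - measR.
  - move=> x _; apply: mulr_ge0; last exact: normal_pdf_ge0.
    by rewrite mulr_ge0 ?sqr_ge0.
  - move=> x _; apply: mulr_ge0; last exact: normal_pdf_ge0.
    by rewrite mulr_ge0 ?sqr_ge0.
  have a0 : 0 <= 12 * s ^+ 2 by rewrite mulr_ge0 ?sqr_ge0.
  have b0 : 0 <= 2 * (m - c) ^+ 2 by rewrite mulr_ge0 ?sqr_ge0.
  rewrite !integralRZl//; last 2 first.
  - by move=> x _; exact: normal_pdf_ge0.
  - by move=> x _; exact: normal_pdf_ge0.
  by rewrite !integral_normal_pdf !mule1.
apply: le_integralR => //.
- measR.
- measR.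
- move=> x _; rewrite (mulr_ge0 (sqr_ge0 _) (normal_pdf_ge0 _ _ _))/=.
  have n0 := normal_pdf_ge0 m s x.
  have key : (x - m) ^+ 2 * normal_pdf m s x <=
      6 * s ^+ 2 * normal_pdf m (Num.sqrt 2 * s) x.
    rewrite !normal_pdf_posE// exprMn sqr_sqrtr//.
    set z := (x - m) ^+ 2; have z0 : 0 <= z by exact: sqr_ge0.
    set w := z / (2 * (2 * s ^+ 2)).
    have w0 : 0 <= w by rewrite divr_ge0// mulr_ge0// mulr_ge0// sqr_ge0.
    have -> : z / (2 * s ^+ 2) = w + w by rewrite /w; field; rewrite lt0r_neq0.
    have -> : z = 4 * s ^+ 2 * w by rewrite /w; field; rewrite lt0r_neq0.
    have ew : w * expR (- w) <= 1.
      rewrite expRN ler_pdivrMr ?expR_gt0// mul1r.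
      by have := expR_ge1Dx w; lra.
    rewrite opprD expRD; have e0 := expR_ge0 (- w); have cp := normal_peak1_gt0.
    have sq : Num.sqrt 2 <= 3 / 2 :> R.
      rewrite -(@ler_pXn2r _ 2) ?nnegrE ?sqrtr_ge0 ?divr_ge0// sqr_sqrtr//; lra.
    have sq0 : 0 < Num.sqrt 2 :> R by rewrite sqrtr_gt0.
    have -> : 4 * s ^+ 2 * w * (c0 / s * (expR (- w) * expR (- w))) =
       4 * s * c0 * expR (- w) * (w * expR (- w)).
      by move: (c0) => p; field; rewrite lt0r_neq0.
    have -> : 6 * s ^+ 2 * (c0 / (Num.sqrt 2 * s) * expR (- w)) =
       4 * s * c0 * expR (- w) * ((3 / 2) / Num.sqrt 2).
      by move: (c0) => p; field; rewrite !lt0r_neq0.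
    apply: ler_wpM2l; first by rewrite !mulr_ge0// ltW.
    by apply: (le_trans ew); rewrite ler_pdivlMr// mul1r.
  have : (x - c) ^+ 2 <= 2 * (x - m) ^+ 2 + 2 * (m - c) ^+ 2.
    by have := sqr_ge0 ((x - m) - (m - c)); nra.
  by nra.
Qed.

End gaussian_algebra.

(** * Horseshoe integrals rewritten over the scale *)

Section horseshoe_mixture.
Context {R : realType}.
Implicit Types (t v y l theta : R).
Local Notation mu := (@lebesgue_measure R).
Local Notation phi := (normal_pdf (0 : R) 1).
Local Notation c0 := (normal_peak (1 : R)).
Local Notation kap v := (v ^+ 2 / (1 + v ^+ 2)).
Local Notation I f := (\int[mu]_(v in `[0%R, +oo[) (f v)%:E)%E.

Let openE l : `]0%R, +oo[%classic l -> 0 < l.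
Proof. by rewrite /= in_itv/= andbT. Qed.

(** Tonelli exchanges mean and scale; then [normal_posterior] turns the inner integrand into a
    normal density in theta. *)
Lemma horseshoe_integral t y (F : R -> R) : 0 < t ->
  measurable_fun setT F -> (forall theta, 0 <= F theta) ->
  (\int[mu]_theta ((F theta * phi (y - theta))%:E * horseshoe_pdf t theta) =
   \int[mu]_(l in `]0%R, +oo[)
     ((2 / (pi * (1 + l ^+ 2)) * (c0 * mixker (l * t) y))%:E *
      \int[mu]_theta (F theta *
        normal_pdf (kap (l * t) * y) (Num.sqrt (kap (l * t))) theta)%:E))%E.
Proof.
move=> t0 mF F0.
pose f (z : R * R) := F z.1 * (c0 * expR (- ((y - z.1) ^+ 2 / 2))) *
  (c0 * expR (- ((z.1 / (z.2 * t)) ^+ 2 / 2)) * (z.2 * t)^-1 *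
   (2 / (pi * (1 + z.2 ^+ 2)))).
have fE x l : f (x, l) = F x * phi (y - x) *
    (phi (x / (l * t)) * (l * t)^-1 * (2 / (pi * (1 + l ^+ 2)))).
  by rewrite /f !std_normal_pdfE.
have mf : measurable_fun setT f.
  have mF1 : measurable_fun setT (fun z : R * R => F z.1).
    by apply: measurableT_comp.
  by rewrite /f; measR.
have w0 l : 0 <= 2 / (pi * (1 + l ^+ 2)).
  by rewrite divr_ge0// mulr_ge0 ?pi_ge0// addr_ge0 ?sqr_ge0.
have f0 x l : `]0%R, +oo[%classic l -> 0 <= f (x, l).
  move=> /openE l0; rewrite fE.
  have h1 := mulr_ge0 (F0 x) (normal_pdf_ge0 0 1 (y - x)); apply: mulr_ge0 => //.
  apply: mulr_ge0 => //; apply: mulr_ge0; first exact: normal_pdf_ge0.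
  by rewrite invr_ge0 mulr_ge0// ltW.
transitivity (\int[mu]_theta \int[mu]_(l in `]0%R, +oo[) (f (theta, l))%:E)%E.
  apply: eq_integral => x _; rewrite /horseshoe_pdf -ge0_integralZl//.
  - by apply: eq_integral => l _; rewrite -EFinM fE.
  - apply: measurable_funTS; apply/measurable_EFinP.
    by measR.
  - move=> l /openE l0; rewrite lee_fin; apply: mulr_ge0 => //.
    apply: mulr_ge0; first exact: normal_pdf_ge0.
    by rewrite invr_ge0 mulr_ge0// ltW.
  - by rewrite lee_fin; exact: mulr_ge0 (F0 x) (normal_pdf_ge0 0 1 (y - x)).
rewrite tonelli_restrict//; apply: eq_integral => l; rewrite inE => /openE l0.
have lt0 : 0 < l * t by rewrite mulr_gt0.
rewrite -integralRZl//; last 3 first.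
- apply: measurable_funM => //; exact: measurable_normal_pdf.
- apply: mulr_ge0 => //; apply: mulr_ge0; first exact: normal_peak_ge0.
  exact: mixker_ge0.
- by move=> x _; exact: mulr_ge0 (F0 x) (normal_pdf_ge0 _ _ _).
apply: eq_integral => x _; congr EFin; rewrite fE.
have := normal_posterior y x lt0.
set A := phi _; set B := phi _; set N := normal_pdf _ _ _ => AB.
transitivity (2 / (pi * (1 + l ^+ 2)) * F x * (A * (B / (l * t)))); first by ring.
by rewrite AB; ring.
Qed.

(** Substitution v = l t, from the standard half-Cauchy law to the one with scale [t]. The end point
    0 is added to fit the substitution theorem. *)
Lemma half_cauchy_substitution t (G : R -> R) : 0 < t ->
  continuous G -> (forall v, 0 <= v -> 0 <= G v) ->
  (\int[mu]_(l in `]0%R, +oo[) (2 / (pi * (1 + l ^+ 2)) * G (l * t))%:E)%E =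
  I (fun v => hcauchy t v * G v).
Proof.
move=> t0 cG G0; pose F (l : R^o) := l * t.
have t2 v : 0 < t ^+ 2 + v ^+ 2 by rewrite ltr_wpDr ?sqr_ge0 ?exprn_gt0.
have F'E : F^`()%classic = cst t.
  apply/funext => x; rewrite /F derive1E deriveM// derive_cst scaler0.
  by rewrite add0r derive_id /GRing.scale/= mulr1.
have cH : continuous (fun v => hcauchy t v * G v).
  move=> v; apply: cvgM; last exact: cG.
  apply: cvgM; first exact: cvg_cst.
  apply: cvgM; first exact: cvg_cst.
  apply: cvgV; first by rewrite lt0r_neq0.
  by apply: cvgD; [exact: cvg_cst|exact: exprn_continuous].
have cc : continuous (fun l => 2 / (pi * (1 + l ^+ 2)) * G (l * t)).
  move=> v; apply: cvgM.
    apply: cvgM; first exact: cvg_cst.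
    apply: cvgV; first by rewrite lt0r_neq0// mulr_gt0 ?pi_gt0// ltr_wpDr ?sqr_ge0.
    apply: cvgM; first exact: cvg_cst.
    by apply: cvgD; [exact: cvg_cst|exact: exprn_continuous].
  apply: (cvg_comp (fun l => l * t) G); last exact: cG.
  by apply: cvgM; [exact: cvg_id|exact: cvg_cst].
rewrite integral_itv_obnd_cbnd; last first.
  apply: measurable_funTS; apply/measurable_EFinP.
  exact: continuous_measurable_fun.
have := @increasing_ge0_integration_by_substitutiony R F
   (fun v => hcauchy t v * G v) 0.
have Fz : F 0 = 0 by rewrite /F mul0r.
rewrite F'E Fz => ->.
- apply: eq_integral => l _; congr EFin.
  change (2 / (pi * (1 + l ^+ 2)) * G (l * t) = hcauchy t (l * t) * G (l * t) * t).
  rewrite /hcauchy; have -> : t ^+ 2 + (l * t) ^+ 2 = t ^+ 2 * (1 + l ^+ 2) by ring.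
  have l1 : 0 < 1 + l ^+ 2 by rewrite ltr_wpDr ?sqr_ge0.
  have := @pi_gt0 R; move: (pi : R) => P P0.
  by move: (G _) => g; field; rewrite !lt0r_neq0.
- by move=> x y _ _ xy; rewrite /F ltr_pM2r.
- by move=> x _; exact: cvg_cst.
- exact: is_cvg_cst.
- exact: is_cvg_cst.
- split; first by move=> x _; exact: derivableM.
  by apply: cvg_at_right_filter; apply: cvgM; [exact: cvg_id|exact: cvg_cst].
- by apply/gt0_cvgMly => //; exact: cvg_id.
- exact: continuous_subspaceT.
- move=> x; rewrite in_itv/= andbT => x0.
  by apply: mulr_ge0; [rewrite hcauchy_ge0// ltW|rewrite G0// ltW].
Qed.

Let continuous_kappa : continuous (fun v : R => kap v).
Proof.
move=> v; apply: cvgM; first exact: exprn_continuous.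
apply: cvgV; first by rewrite lt0r_neq0// ltr_wpDr ?sqr_ge0.
by apply: cvgD; [exact: cvg_cst|exact: exprn_continuous].
Qed.

Let continuous_mixker y : continuous (mixker^~ y).
Proof.
have s0 v : 0 < 1 + v ^+ 2 :> R by rewrite ltr_wpDr ?sqr_ge0.
have cs : continuous (fun v : R => 1 + v ^+ 2).
  by move=> v; apply: cvgD; [exact: cvg_cst|exact: exprn_continuous].
move=> v; apply: cvgM.
  apply: cvgV; first by rewrite lt0r_neq0// sqrtr_gt0.
  by apply: (cvg_comp (fun v => 1 + v ^+ 2) Num.sqrt); [exact: cs|exact: sqrt_continuous].
apply: (cvg_comp _ expR); last exact: continuous_expR.
apply: cvgN; apply: cvgM; first exact: cvg_cst.
apply: cvgV; first by rewrite lt0r_neq0// mulr_gt0.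
by apply: cvgM; [exact: cvg_cst|exact: cs].
Qed.

Let kappa_ge0 v : 0 <= kap v.
Proof. by rewrite divr_ge0 ?sqr_ge0// addr_ge0 ?sqr_ge0. Qed.

Lemma horseshoe_marginal t y : 0 < t ->
  (\int[mu]_theta ((phi (y - theta))%:E * horseshoe_pdf t theta) =
   (c0 * mix t y)%:E)%E.
Proof.
move=> t0; have := horseshoe_integral y t0 (measurable_cst (1 : R)) (fun=> ler01).
under eq_integral do rewrite mul1r.
move=> ->; rewrite EFinM -mixE// -integralRZl//; last 3 first.
- by rewrite /hcauchy /mixker; measR.
- exact: normal_peak_ge0.
- by move=> v _; apply: mulr_ge0; [rewrite hcauchy_ge0// ltW|exact: mixker_ge0].
have -> : I (fun v => c0 * (hcauchy t v * mixker v y)) =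
    I (fun v => hcauchy t v * (c0 * mixker v y)).
  by apply: eq_integral => v _; congr EFin; ring.
rewrite -(@half_cauchy_substitution t (fun v => c0 * mixker v y))//.
- apply: eq_integral => l _; under eq_integral do rewrite mul1r.
  by rewrite integral_normal_pdf mule1.
- by move=> v; apply: cvgM; [exact: cvg_cst|exact: continuous_mixker].
- by move=> v _; apply: mulr_ge0; [exact: normal_peak_ge0|exact: mixker_ge0].
Qed.

(** Given [v] the mean is N(kap v * y, kap v), to which [normal_second_moment_le] applies. *)
Lemma horseshoe_second_moment t y (c : R) : 0 < t ->
  (\int[mu]_theta (((theta - c) ^+ 2 * phi (y - theta))%:E * horseshoe_pdf t theta)
   <= c0%:E *
     I (fun v => hcauchy t v * (mixker v y * (12 * kap v + 2 * (kap v * y - c) ^+ 2))))%E.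
Proof.
move=> t0.
have mF : measurable_fun setT (fun theta : R => (theta - c) ^+ 2) by measR.
rewrite (horseshoe_integral y t0 mF (fun=> sqr_ge0 _)).
have Q0 v : 0 <= 12 * kap v + 2 * (kap v * y - c) ^+ 2.
  by apply: addr_ge0; apply: mulr_ge0 => //; exact: sqr_ge0.
have mQ : measurable_fun setT (fun v => mixker v y * (12 * kap v + 2 * (kap v * y - c) ^+ 2)).
  by rewrite /mixker; measR.
have mh := measurable_hcauchy t.
have G0 v : 0 <= mixker v y * (12 * kap v + 2 * (kap v * y - c) ^+ 2).
  by apply: mulr_ge0 => //; exact: mixker_ge0.
rewrite -integralRZl//; last 3 first.
- by rewrite /mixker; measR.
- exact: normal_peak_ge0.
- by move=> v _; apply: mulr_ge0 => //; rewrite hcauchy_ge0// ltW.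
pose G v := c0 * (mixker v y * (12 * kap v + 2 * (kap v * y - c) ^+ 2)).
set J := (X in (_ <= X)%E); have {J}-> : J = I (fun v => hcauchy t v * G v).
  by apply: eq_integral => v _; congr EFin; rewrite /G; ring.
rewrite -half_cauchy_substitution//; last 2 first.
- move=> v; apply: cvgM; first exact: cvg_cst.
  apply: cvgM; first exact: continuous_mixker.
  apply: cvgD; first by apply: cvgM; [exact: cvg_cst|exact: continuous_kappa].
  apply: cvgM; first exact: cvg_cst.
  apply: (cvg_comp _ (fun z : R => z ^+ 2)); last exact: exprn_continuous.
  apply: cvgB; last exact: cvg_cst.
  by apply: cvgM; [exact: continuous_kappa|exact: cvg_cst].
- by move=> v _; apply: mulr_ge0 => //; exact: normal_peak_ge0.
apply: le_integral_lower => l /openE l0.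
  apply: mule_ge0; last first.
    apply: integral_ge0 => x _; rewrite lee_fin.
    exact: mulr_ge0 (sqr_ge0 _) (normal_pdf_ge0 _ _ _).
  rewrite lee_fin; apply: mulr_ge0.
    by rewrite divr_ge0// mulr_ge0 ?pi_ge0// addr_ge0 ?sqr_ge0.
  by apply: mulr_ge0; [exact: normal_peak_ge0|exact: mixker_ge0].
have lt0 : 0 < l * t by rewrite mulr_gt0.
have k0 : 0 < kap (l * t).
  by rewrite divr_gt0 ?exprn_gt0// ltr_wpDr ?sqr_ge0.
have := normal_second_moment_le (kap (l * t) * y) c (etrans (sqrtr_gt0 _) k0).
rewrite sqr_sqrtr ?(ltW k0)// => B.
set w := 2 / _; have w0 : 0 <= w.
  by rewrite divr_ge0// mulr_ge0 ?pi_ge0// addr_ge0 ?sqr_ge0.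
have -> : w * G (l * t) = w * (c0 * mixker (l * t) y) *
   (12 * kap (l * t) + 2 * (kap (l * t) * y - c) ^+ 2) by rewrite /G; ring.
rewrite [leRHS]EFinM; apply: lee_wpmul2l => //; rewrite lee_fin; apply: mulr_ge0 => //.
by apply: mulr_ge0; [exact: normal_peak_ge0|exact: mixker_ge0].
Qed.

End horseshoe_mixture.

(** * Posterior second moments of one coordinate *)

Section posterior_moments.
Context {R : realType}.
Implicit Types (t v y theta : R).
Local Notation mu := (@lebesgue_measure R).
Local Notation phi := (normal_pdf (0 : R) 1).
Local Notation c0 := (normal_peak (1 : R)).
Local Notation kap v := (v ^+ 2 / (1 + v ^+ 2)).
Local Notation I f := (\int[mu]_(v in `[0%R, +oo[) (f v)%:E)%E.

(** Unnormalised: division by [c0 * mix t y] gives the posterior second moment about [c]. The bounds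
    below therefore all carry that factor. *)
Definition second_moment t y (c : R) : \bar R :=
  (\int[mu]_theta (((theta - c) ^+ 2 * phi (y - theta))%:E * horseshoe_pdf t theta))%E.

Let kappa01 v : 0 <= kap v <= 1.
Proof.
have s0 : 0 < 1 + v ^+ 2 by rewrite ltr_wpDr ?sqr_ge0.
by rewrite divr_ge0 ?sqr_ge0 ?(ltW s0)//= ler_pdivrMr// mul1r lerDr.
Qed.

Let second_moment_zero t y : 0 < t ->
  (second_moment t y 0 <= (c0 * (12 + 2 * y ^+ 2))%:E *
    I (fun v => hcauchy t v * (kap v * mixker v y)))%E.
Proof.
move=> t0; apply: (le_trans (horseshoe_second_moment y 0 t0)).
have y20 := sqr_ge0 y; have mh := measurable_hcauchy t.
have h0 v : 0 <= hcauchy t v by rewrite hcauchy_ge0// ltW.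
have A0 : 0 <= 12 + 2 * y ^+ 2 by rewrite addr_ge0// mulr_ge0.
rewrite [X in (_ <= X * _)%E]EFinM -muleA; apply: lee_wpmul2l.
  by rewrite lee_fin normal_peak_ge0.
have km0 v : 0 <= kap v * mixker v y.
  by apply: mulr_ge0; [by case/andP: (kappa01 v)|exact: mixker_ge0].
rewrite -integralRZl//; last 2 first.
- by rewrite /mixker; measR.
- by move=> v _; exact: mulr_ge0.
apply: le_integralR => //.
- by rewrite /mixker; measR.
- by rewrite /mixker; measR.
- move=> v _; have m0 := mixker_ge0 v y; have := kappa01 v.
  move: (kap v) (mixker v y) (hcauchy t v) m0 (h0 v) => k m h m0 hh0 /andP[k0 k1].
  rewrite subr0 exprMn; apply/andP; split.
    apply: mulr_ge0 => //; apply: mulr_ge0 => //; apply: addr_ge0; apply: mulr_ge0 => //.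
    by rewrite mulr_ge0 ?sqr_ge0.
  have -> : (12 + 2 * y ^+ 2) * (h * (k * m)) = h * (m * (12 * k + 2 * (k * y ^+ 2))).
    by ring.
  rewrite ler_wpM2l// ler_wpM2l// lerD2l ler_wpM2l// ler_wpM2r// expr2.
  by rewrite ler_piMr.
Qed.

(** Crude bound from [kap v <= 1], used for noise observations of large size. *)
Lemma second_moment_zero_le t y : 0 < t ->
  (second_moment t y 0 <= ((12 + 2 * y ^+ 2) * (c0 * mix t y))%:E)%E.
Proof.
move=> t0; apply: (le_trans (second_moment_zero y t0)).
have h0 v : 0 <= hcauchy t v by rewrite hcauchy_ge0// ltW.
have -> : (12 + 2 * y ^+ 2) * (c0 * mix t y) = c0 * (12 + 2 * y ^+ 2) * mix t y by ring.
rewrite [leRHS]EFinM; apply: lee_wpmul2l.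
  by rewrite lee_fin mulr_ge0 ?normal_peak_ge0// addr_ge0// mulr_ge0 ?sqr_ge0.
rewrite -mixE//; apply: le_integralR => //.
- by rewrite /hcauchy /mixker; measR.
- by rewrite /hcauchy /mixker; measR.
- move=> v _; have m0 := mixker_ge0 v y; have /andP[k0 k1] := kappa01 v.
  apply/andP; split; first by apply: mulr_ge0 => //; exact: mulr_ge0.
  by rewrite ler_wpM2l// ler_piMl.
Qed.

(** The numerator gains a factor [t] from [integral_kappa_le], while [mix_ge_exp] bounds the
    normaliser from below; 576 is 12 * 48. *)
Lemma second_moment_zero_small t y : 0 < t <= 1 ->
  (second_moment t y 0 <= (576 * 8 * t * expR (y ^+ 2 / 2) * (c0 * mix t y))%:E)%E.
Proof.
move=> /[dup] tt /andP[t0 t1]; apply: (le_trans (second_moment_zero y t0)).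
have y20 := sqr_ge0 y; have y1 : 0 < 1 + y ^+ 2 by rewrite ltr_wpDr.
have c00 := normal_peak_ge0 (1 : R).
have A0 : 0 <= c0 * (12 + 2 * y ^+ 2) by rewrite mulr_ge0// addr_ge0// mulr_ge0.
apply: (@le_trans _ _ ((c0 * (12 + 2 * y ^+ 2))%:E * (t * 48 / (1 + y ^+ 2))%:E)%E).
  by apply: lee_wpmul2l; [rewrite lee_fin|exact: integral_kappa_le].
rewrite -EFinM lee_fin.
have := mix_ge_exp y tt; have e0 := expR_gt0 (y ^+ 2 / 2).
rewrite expRN; set e := expR _ in e0 *; set m := mix t y => em.
have em1 : 1 <= 8 * (e * m).
  have : e * (e^-1 / 8) <= e * m by rewrite ler_wpM2l// ltW.
  have -> : e * (e^-1 / 8) = 8^-1 by field; rewrite lt0r_neq0.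
  by lra.
have q : (12 + 2 * y ^+ 2) * (t * 48 / (1 + y ^+ 2)) <= 576 * t.
  rewrite mulrA ler_pdivrMr//; nra.
apply: (@le_trans _ _ (c0 * (576 * t))).
  by rewrite -[leLHS]mulrA ler_wpM2l.
have -> : 576 * 8 * t * e * (c0 * m) = c0 * (576 * t) * (8 * (e * m)).
  by move: (576 : R) => k; ring.
apply: ler_peMr; last exact: em1.
apply: mulr_ge0; first exact: c00.
by apply: mulr_ge0; [exact: ler0n|exact: ltW].
Qed.

(** If y^2 <= 8 ln(1/t), the bias weight is at most y^2. Otherwise exp(-y^2/8) <= t, so both terms
    of [integral_shrink_le] are O(t / (1 + y^2)), which [mix_ge] compares with [mix t y]. *)
Lemma integral_shrink_mix_le t y : 0 < t <= 1 ->
  (I (fun v => hcauchy t v * (y ^+ 2 / (1 + v ^+ 2) ^+ 2 * mixker v y)) <=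
   ((8 * ln t^-1 + 60 * 340) * mix t y)%:E)%E.
Proof.
move=> /[dup] tt /andP[t0 t1].
have y20 := sqr_ge0 y; have mh := measurable_hcauchy t.
have h0 v : 0 <= hcauchy t v by rewrite hcauchy_ge0// ltW.
have sm0 v : 0 <= y ^+ 2 / (1 + v ^+ 2) ^+ 2 * mixker v y.
  by apply: mulr_ge0; [rewrite divr_ge0 ?sqr_ge0|exact: mixker_ge0].
have m0 := mix_ge0 y t0.
have lt0 : 0 <= ln t^-1 by rewrite ln_ge0// invf_ge1.
have K0 : 0 <= 60 * 340 :> R by rewrite mulr_ge0 ?ler0n.
have KE : 60 * 84 + 60 * 256 = 60 * 340 :> R by rewrite -mulrDr -natrD.
have [ysmall|ybig] := leP (y ^+ 2) (8 * ln t^-1).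
  apply: (@le_trans _ _ (y ^+ 2 * mix t y)%:E); last first.
    by rewrite lee_fin ler_wpM2r// ler_wpDr.
  rewrite EFinM -mixE// -integralRZl//; last 2 first.
  - by rewrite /mixker; measR.
  - by move=> v _; apply: mulr_ge0 => //; exact: mixker_ge0.
  apply: le_integralR => //.
  - by rewrite /mixker; measR.
  - by rewrite /mixker; measR.
  - move=> v _; apply/andP; split; first exact: mulr_ge0.
    have hm0 : 0 <= hcauchy t v * mixker v y.
      by apply: mulr_ge0 => //; exact: mixker_ge0.
    have -> : hcauchy t v * (y ^+ 2 / (1 + v ^+ 2) ^+ 2 * mixker v y) =
      y ^+ 2 * (hcauchy t v * mixker v y * (1 + v ^+ 2) ^- 2) by ring.
    apply: ler_wpM2l => //; rewrite ler_piMr// invf_le1 ?exprn_gt0 ?exprn_ege1// ?lerDl ?ltr_wpDr ?sqr_ge0//.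
apply: (le_trans (integral_shrink_le y t0)); rewrite lee_fin.
have mg := mix_ge y tt.
have y1 : 0 < 1 + y ^+ 2 by rewrite ltr_wpDr.
have -> : t * 84 / (1 + y ^+ 2) = 60 * 84 * (t / (60 * (1 + y ^+ 2))).
  by field; rewrite lt0r_neq0.
have e8 : expR (- (y ^+ 2 / 8)) <= t.
  rewrite -[leRHS]lnK ?posrE// ler_expR lerNl -lnV ?posrE//.
  by rewrite ler_pdivlMr// mulrC ltW.
have g8 := expR_ge_pow 1 (divr_ge0 y20 (ler0n R 8)).
have small : y ^+ 2 * expR (- (y ^+ 2 / 4)) <= 60 * 256 * (t / (60 * (1 + y ^+ 2))).
  have -> : 60 * 256 * (t / (60 * (1 + y ^+ 2))) = 256 * t / (1 + y ^+ 2).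
    by field; rewrite lt0r_neq0.
  rewrite ler_pdivlMr//.
  have -> : - (y ^+ 2 / 4) = - (y ^+ 2 / 8) + - (y ^+ 2 / 8) by lra.
  rewrite expRD; set E := expR _ in e8 *.
  have E0 : 0 < E by exact: expR_gt0.
  have p1 : y ^+ 2 * (1 + y ^+ 2) * E <= 256.
    have EE : E * expR (y ^+ 2 / 8) = 1 by rewrite mulrC expRxMexpNx_1.
    set P := expR _ in g8 EE; have P0 : 0 < P by exact: expR_gt0.
    have PE : P^-1 = E by apply: (mulIf (lt0r_neq0 P0)); rewrite mulVf ?lt0r_neq0.
    rewrite -PE ler_pdivrMr//.
    apply: le_trans (ler_wpM2l (ler0n R 256) g8).
    by move: (y ^+ 2) y20 => x x0; lra.
  have -> : y ^+ 2 * (E * E) * (1 + y ^+ 2) = y ^+ 2 * (1 + y ^+ 2) * E * E by ring.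
  apply: ler_pM => //; last exact: ltW.
  by apply: mulr_ge0; [apply: mulr_ge0 => //|]; exact: ltW.
apply: (le_trans (lerD small (lexx _))).
rewrite -mulrDl addrC KE; apply: ler_pM => //; last by rewrite lerDr mulr_ge0.
by rewrite divr_ge0 ?mulr_ge0 ?(ltW t0) ?(ltW y1).
Qed.

(** The deviation [kap v * y - c] splits into the shrinkage bias, controlled by
    [integral_shrink_mix_le], and the observation error [y - c]. *)
Lemma second_moment_signal_le t y (c : R) : 0 < t <= 1 ->
  (second_moment t y c <=
    ((12 + 4 * (y - c) ^+ 2 + 4 * (8 * ln t^-1 + 60 * 340)) * (c0 * mix t y))%:E)%E.
Proof.
move=> /[dup] tt /andP[t0 t1]; have SM := integral_shrink_mix_le y tt.
move: (8 * ln _ + _) SM => L SM; apply: (le_trans (horseshoe_second_moment y c t0)).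
have y20 := sqr_ge0 y; have mh := measurable_hcauchy t.
have h0 v : 0 <= hcauchy t v by rewrite hcauchy_ge0// ltW.
have B0 : 0 <= 12 + 4 * (y - c) ^+ 2 by rewrite addr_ge0// mulr_ge0 ?sqr_ge0.
set B := 12 + 4 * _ in B0 *.
have -> : (B + 4 * L) * (c0 * mix t y) =
  c0 * (B * mix t y + 4 * (L * mix t y)) by ring.
rewrite [leRHS]EFinM; apply: lee_wpmul2l.
  by rewrite lee_fin normal_peak_ge0.
have sm0 v : 0 <= y ^+ 2 / (1 + v ^+ 2) ^+ 2 * mixker v y.
  by apply: mulr_ge0; [rewrite divr_ge0 ?sqr_ge0|exact: mixker_ge0].
apply: (@le_trans _ _ (I (fun v => B * (hcauchy t v * mixker v y) +
   4 * (hcauchy t v * (y ^+ 2 / (1 + v ^+ 2) ^+ 2 * mixker v y))))).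
  apply: le_integralR => //.
  - by rewrite /mixker; measR.
  - by rewrite /mixker; measR.
  - move=> v _; have m0 := mixker_ge0 v y; have := kappa01 v.
    have s0 : 0 < 1 + v ^+ 2 by rewrite ltr_wpDr ?sqr_ge0.
    have kE : kap v = 1 - (1 + v ^+ 2)^-1 by field; rewrite lt0r_neq0.
    have -> : y ^+ 2 / (1 + v ^+ 2) ^+ 2 = (kap v * y - y) ^+ 2.
      by rewrite kE; field; rewrite lt0r_neq0.
    move: {kE} (kap v) (mixker v y) (hcauchy t v) m0 (h0 v) => k m h m0 hh0 /andP[k0 k1].
    apply/andP; split.
      apply: mulr_ge0 => //; apply: mulr_ge0 => //; apply: addr_ge0; apply: mulr_ge0 => //.
      exact: sqr_ge0.
    have -> : B * (h * m) + 4 * (h * ((k * y - y) ^+ 2 * m)) =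
      h * (m * (B + 4 * (k * y - y) ^+ 2)) by ring.
    rewrite ler_wpM2l// ler_wpM2l// /B.
    have := sqr_ge0 ((k * y - y) - (y - c)); nra.
rewrite integralRD//; last 4 first.
- by rewrite /mixker; measR.
- by rewrite /mixker; measR.
- move=> v _; apply: mulr_ge0 => //; apply: mulr_ge0 => //; exact: mixker_ge0.
- by move=> v _; apply: mulr_ge0 => //; apply: mulr_ge0.
rewrite !integralRZl//; last 4 first.
- by rewrite /mixker; measR.
- by move=> v _; apply: mulr_ge0.
- by rewrite /mixker; measR.
- by move=> v _; apply: mulr_ge0 => //; exact: mixker_ge0.
rewrite mixE// [leRHS]EFinD [X in (_ <= X + _)%E]EFinM leeD2l// [leRHS]EFinM; apply: lee_wpmul2l; first by rewrite lee_fin.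
exact: SM.
Qed.

End posterior_moments.

(** * The posterior as a normalised product, and Markov's inequality *)

Section posterior_bounds.
Context {R : realType}.
Implicit Types (n : nat) (t r : R).
Local Notation mu := (@lebesgue_measure R).
Local Notation phi := (normal_pdf (0 : R) 1).
Local Notation c0 := (normal_peak (1 : R)).
Local Open Scope ereal_scope.

Lemma measurable_horseshoe_pdf t : (0 < t)%R ->
  measurable_fun [set: R] (horseshoe_pdf t).
Proof.
move=> t0; apply: (measurable_integral_restrict mu (f := fun z : R * R =>
  phi (z.1 / (z.2 * t)) * (z.2 * t)^-1 * (2 / (pi * (1 + z.2 ^+ 2))))%R) => //.
- measR.
- move=> x l; rewrite /= in_itv/= andbT => l0; apply: mulr_ge0.
    by apply: mulr_ge0; [exact: normal_pdf_ge0|rewrite invr_ge0 mulr_ge0// ltW].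
  by rewrite divr_ge0// mulr_ge0 ?pi_ge0// addr_ge0 ?sqr_ge0.
Qed.

Lemma horseshoe_pdf_ge0 t theta : (0 < t)%R -> 0 <= horseshoe_pdf t theta.
Proof.
move=> t0; apply: integral_ge0 => l; rewrite /= in_itv/= andbT => l0.
rewrite lee_fin; apply: mulr_ge0.
  by apply: mulr_ge0; [exact: normal_pdf_ge0|rewrite invr_ge0 mulr_ge0// ltW].
by rewrite divr_ge0// mulr_ge0 ?pi_ge0// addr_ge0 ?sqr_ge0.
Qed.

Section fixed_data.
Context n (t : R) (t0 : (0 < t)%R) (y : n.-tuple R).

Let f (i : 'I_n) (theta : R) := (phi (tnth y i - theta))%:E * horseshoe_pdf t theta.

Let mf i : measurable_fun [set: R] (f i).
Proof.
apply: emeasurable_funM; last exact: measurable_horseshoe_pdf.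
by apply/measurable_EFinP; measR.
Qed.

Let f0 i x : 0 <= f i x.
Proof. by rewrite mule_ge0 ?horseshoe_pdf_ge0 ?lee_fin ?normal_pdf_ge0. Qed.

Definition evidence : R := \prod_(i < n) (c0 * mix t (tnth y i)).

Lemma evidence_gt0 : (0 < evidence)%R.
Proof. by apply: prodr_gt0 => i _; rewrite mulr_gt0 ?normal_peak1_gt0 ?mix_gt0. Qed.

Lemma marginal_likelihoodE : marginal_likelihood t y = evidence%:E.
Proof.
rewrite /marginal_likelihood /evidence -prodEFin; apply: eq_bigr => i _.
exact: horseshoe_marginal.
Qed.

Lemma posterior_normalizer :
  \int[lebesgue_tuple n]_theta posterior_kernel t y theta = evidence%:E.
Proof.
rewrite -marginal_likelihoodE /marginal_likelihood.
exact: (integral_tuple_prod (fun=> mu) mf f0).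
Qed.

Lemma posterior_kernel_ge0 theta : 0 <= posterior_kernel t y theta.
Proof. by apply: prode_ge0 => i _; exact: f0. Qed.

Lemma measurable_posterior_kernel :
  measurable_fun [set: borel_tuple R n] (posterior_kernel t y).
Proof. exact: (emeasurable_tuple_prod mf). Qed.

Lemma posterior_ge0 A : 0 <= posterior t y A.
Proof.
apply: mule_ge0; first by apply: integral_ge0 => x _; exact: posterior_kernel_ge0.
rewrite posterior_normalizer inve_ge0 lee_fin ltW//; exact: evidence_gt0.
Qed.

Lemma posterior_le1 A : posterior t y A <= 1.
Proof.
rewrite /posterior posterior_normalizer inver gt_eqF ?evidence_gt0// lee_pdivrMr ?evidence_gt0// mul1e.
rewrite -posterior_normalizer integral_mkcond; apply: le_integral_lower => x _.
  by rewrite patchE; case: ifP => // _; exact: posterior_kernel_ge0.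
by rewrite patchE; case: ifP => // _; exact: posterior_kernel_ge0.
Qed.

(** Markov's inequality for the squared distance, a sum over coordinates. By the product form of the
    kernel, all coordinates but one contribute only their normalisers. *)
Lemma posterior_markov (theta0 : n.-tuple R) r (b : 'I_n -> R) : (0 < r)%R ->
  (forall i, 0 <= b i)%R ->
  (forall i, second_moment t (tnth y i) (tnth theta0 i) <=
    (b i * (c0 * mix t (tnth y i)))%:E) ->
  posterior t y [set theta | (r <= l2dist theta0 theta)%R] <=
  (r ^- 2 * \sum_(i < n) b i)%:E.
Proof.
move=> r0 b0 hb; rewrite /posterior posterior_normalizer inver gt_eqF ?evidence_gt0// lee_pdivrMr ?evidence_gt0//.
(* The family [g i] inserts the squared deviation of coordinate [i] into the kernel, so its integral
   still factorises. *)
pose g (i j : 'I_n) (theta : R) := if i == j then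
  ((theta - tnth theta0 j) ^+ 2 * phi (tnth y j - theta))%:E * horseshoe_pdf t theta
  else f j theta.
have mg i j : measurable_fun [set: R] (g i j).
  rewrite /g; case: eqP => // _; apply: emeasurable_funM; last exact: measurable_horseshoe_pdf.
  by apply/measurable_EFinP; measR.
have g0 i j x : 0 <= g i j x.
  rewrite /g; case: eqP => // _; rewrite mule_ge0 ?horseshoe_pdf_ge0// lee_fin.
  exact: mulr_ge0 (sqr_ge0 _) (normal_pdf_ge0 _ _ _).
have gE i (x : n.-tuple R) : \prod_(j < n) g i j (tnth x j) =
    ((tnth x i - tnth theta0 i) ^+ 2)%:E * posterior_kernel t y x.
  rewrite /posterior_kernel (bigD1 i)//= [in RHS](bigD1 i)//= /g eqxx muleA.
  congr (_ * _); first by rewrite EFinM muleA.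
  by apply: eq_bigr => j ji; rewrite eq_sym (negbTE ji).
apply: (@le_trans _ _ (\int[lebesgue_tuple n]_x
    ((r ^- 2)%:E * \sum_(i < n) \prod_(j < n) g i j (tnth x j)))).
  rewrite integral_mkcond; apply: le_integral_lower => x _.
    by rewrite patchE; case: ifP => // _; exact: posterior_kernel_ge0.
  have K0 := posterior_kernel_ge0 x.
  rewrite patchE; case: ifPn => [/set_mem/= rx|_]; last first.
    rewrite mule_ge0 ?lee_fin ?invr_ge0 ?sqr_ge0// sume_ge0// => i _.
    by apply: prode_ge0 => j _.
  under eq_bigr do rewrite gE.
  rewrite -ge0_sume_distrl; last by move=> i _; rewrite lee_fin sqr_ge0.
  rewrite muleA -[leLHS]mul1e lee_wpmul2r// sumEFin -EFinM lee_fin.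
  rewrite mulrC ler_pdivlMr ?exprn_gt0// mul1r.
  have S0 : (0 <= \sum_(i < n) (tnth x i - tnth theta0 i) ^+ 2)%R.
    by apply: sumr_ge0 => i _; exact: sqr_ge0.
  rewrite -[leRHS]sqr_sqrtr// ler_sqr ?nnegrE ?(ltW r0) ?sqrtr_ge0//.
  apply: (le_trans rx); rewrite /l2dist le_eqVlt; apply/orP; left; apply/eqP.
  congr Num.sqrt; apply: eq_bigr => i _; ring.
have mG i : measurable_fun [set: borel_tuple R n]
    (fun x => \prod_(j < n) g i j (tnth x j)).
  exact: (emeasurable_tuple_prod (mg i)).
have G0 i (x : borel_tuple R n) : 0 <= \prod_(j < n) g i j (tnth x j).
  by apply: prode_ge0 => j _.
rewrite ge0_integralZl//; last 3 first.
- by apply: emeasurable_sum => i.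
- by move=> x _; apply: sume_ge0 => i _.
- by rewrite lee_fin invr_ge0 sqr_ge0.
rewrite EFinM -muleA; apply: lee_wpmul2l; first by rewrite lee_fin invr_ge0 sqr_ge0.
rewrite ge0_integral_sum// -sumEFin ge0_sume_distrl; last by move=> i _; rewrite lee_fin.
apply: lee_sum => i _.
rewrite (integral_tuple_prod (fun=> mu) (mg i) (g0 i)) (bigD1 i)//= /evidence.
have -> : ((b i)%:E * (\prod_(j < n) (c0 * mix t (tnth y j)))%:E =
    (b i * (c0 * mix t (tnth y i)))%:E *
    \prod_(j < n | j != i) (c0 * mix t (tnth y j))%:E).
  by rewrite (bigD1 i)//= prodEFin -!EFinM mulrA.
apply: lee_pmul.
- by apply: integral_ge0 => x _.
- by apply: prode_ge0 => j _; apply: integral_ge0.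
- by rewrite /g eqxx; exact: hb.
rewrite le_eqVlt; apply/orP; left; apply/eqP; apply: eq_bigr => j ji.
rewrite /g eq_sym (negbTE ji); exact: horseshoe_marginal.
Qed.

End fixed_data.
End posterior_bounds.

(** * Expected posterior mass outside a ball, for given n and p *)

Section contraction_bound.
Context {R : realType}.
Implicit Types (n p : nat) (t r K a : R).
Local Notation mu := (@lebesgue_measure R).
Local Notation phi := (normal_pdf (0 : R) 1).
Local Notation c0 := (normal_peak (1 : R)).

Lemma measurable_preimage_cc d (T : measurableType d) (f : T -> R) (a b : R) :
  measurable_fun setT f -> measurable [set x | a <= f x <= b].
Proof.
move=> mf; rewrite (_ : mkset _ = f @^-1` `[a, b]%classic).
  by rewrite -[X in measurable X]setTI; exact: mf.
by apply/seteqP; split => x; rewrite /= in_itv.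
Qed.

Lemma ge0_integral_data_coord n (theta0 : n.-tuple R) (i : 'I_n) (f : R -> \bar R) :
  measurable_fun [set: R] f -> (forall x, 0 <= f x)%E ->
  (\int[data_law theta0]_y f (tnth y i) =
   \int[normal_prob (tnth theta0 i) 1]_x f x)%E.
Proof.
exact: (ge0_integral_tuple_coord (fun i => normal_prob (tnth theta0 i) 1)).
Qed.

(* Second-moment bounds integrated against the noise: beyond [a] the crude one,
   below [a] the one linear in the scale. *)
Definition noise_bound (K a y : R) : R :=
  K * (expR (y ^+ 2 / 2) * \1_(`[- a, a]%classic) y) +
  (12 + 2 * y ^+ 2) * \1_(~` `[- a, a]%classic) y.

Lemma measurable_noise_bound K a : measurable_fun setT (noise_bound K a).
Proof.
have m1 : measurable_fun setT (\1_(`[- a, a]%classic) : R -> R) by [].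
have m2 : measurable_fun setT (\1_(~` `[- a, a]%classic) : R -> R).
  by apply: measurable_indic; exact: measurableC.
by rewrite /noise_bound; measR.
Qed.

Lemma noise_bound_ge0 K a y : 0 <= K -> 0 <= noise_bound K a y.
Proof.
move=> K0; have i0 (A : set R) : 0 <= \1_A y :> R by rewrite indicE.
apply: addr_ge0; first exact: mulr_ge0 K0 (mulr_ge0 (expR_ge0 _) (i0 _)).
by apply: mulr_ge0 (i0 _); rewrite addr_ge0// mulr_ge0 ?sqr_ge0.
Qed.

(** On [-a, a] the factor exp(y^2/2) cancels the normal density, leaving [K] times the length 2 a
    times [c0 <= 1 / 2]. Outside, 12 + 2 y^2 <= 16 exp(y^2/8), and the product with the density is
    at most exp(-a^2/8) times a multiple of the N(0, 2) density. *)
Lemma integral_noise_bound K a : 0 <= K -> 0 <= a ->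
  (\int[normal_prob (0 : R) 1]_y (noise_bound K a y)%:E <=
   (K * a + 32 * expR (- (a ^+ 2 / 8)))%:E)%E.
Proof.
move=> K0 a0; rewrite ge0_integral_normal_prob; first last.
- by move=> y; rewrite lee_fin noise_bound_ge0.
- by apply/measurable_EFinP; exact: measurable_noise_bound.
have c00 : 0 <= c0 := normal_peak_ge0 1; have c1 := @normal_peak1_le R.
have m1 : measurable_fun setT (\1_(`[- a, a]%classic) : R -> R) by [].
set e := expR (- (a ^+ 2 / 8)); have e0 : 0 <= e by exact: expR_ge0.
have s0 : 0 < Num.sqrt 2 :> R by rewrite sqrtr_gt0.
have mn := measurable_normal_pdf (0 : R) (Num.sqrt 2).
apply: (@le_trans _ _ (\int[mu]_y (K * c0 * \1_(`[- a, a]%classic) y +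
    32 * e * normal_pdf 0 (Num.sqrt 2) y)%:E)%E).
  under eq_integral do rewrite -EFinM.
  apply: le_integralR => //.
  - apply: measurable_funM; first exact: measurable_noise_bound.
    exact: measurable_normal_pdf.
  - by measR.
  move=> y _; apply/andP; split.
    exact: mulr_ge0 (noise_bound_ge0 a y K0) (normal_pdf_ge0 _ _ _).
  rewrite /noise_bound mulrDl; apply: lerD.
    rewrite std_normal_pdfE !indicE; case: (y \in _); last by rewrite !mulr0 mul0r.
    rewrite !mulr1.
    have -> : K * expR (y ^+ 2 / 2) * (c0 * expR (- (y ^+ 2 / 2))) =
      K * c0 * (expR (y ^+ 2 / 2) * expR (- (y ^+ 2 / 2))).
      by move: (c0) => c; ring.
    by rewrite expRxMexpNx_1 mulr1.
  rewrite indicE; have [yA|_] := boolP (y \in _); last first.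
    rewrite mulr0 mul0r; apply: mulr_ge0; last exact: normal_pdf_ge0.
    by rewrite mulr_ge0.
  rewrite mulr1 std_normal_pdfE normal_pdf_posE// sqr_sqrtr// subr0.
  have ya : a ^+ 2 <= y ^+ 2.
    move: yA; rewrite inE /= in_itv/= => /negP; rewrite -ler_norml -ltNge => ay.
    by rewrite -[leRHS]real_normK ?num_real// ler_sqr ?nnegrE// ltW.
  have E8 := expR_ge1Dx (y ^+ 2 / 8).
  have -> : 32 * e * (c0 / Num.sqrt 2 * expR (- (y ^+ 2 / (2 * 2)))) =
     c0 * (32 / Num.sqrt 2 * (e * expR (- (y ^+ 2 / (2 * 2))))).
    by move: (c0) => c; ring.
  rewrite mulrCA ler_wpM2l//.
  have q2 : 16 <= 32 / Num.sqrt 2 :> R.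
    rewrite ler_pdivlMr//.
    have : Num.sqrt 2 <= 2 :> R.
      rewrite -(@ler_pXn2r _ 2) ?nnegrE ?sqrtr_ge0// sqr_sqrtr//.
      by rewrite (_ : 2 ^+ 2 = 4 :> R); [lra|ring].
    by lra.
  apply: (@le_trans _ _ (16 * (e * expR (- (y ^+ 2 / (2 * 2)))))); last first.
    by rewrite ler_wpM2r// mulr_ge0// expR_ge0.
  apply: (@le_trans _ _ (16 * expR (y ^+ 2 / 8) * expR (- (y ^+ 2 / 2)))).
    by rewrite ler_wpM2r ?expR_ge0//; lra.
  rewrite -mulrA ler_wpM2l// -!expRD ler_expR; lra.
rewrite integralRD//; last 4 first.
- by measR.
- by measR.
- by move=> y _; rewrite mulr_ge0 ?mulr_ge0.
- by move=> y _; apply: mulr_ge0; [rewrite mulr_ge0|exact: normal_pdf_ge0].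
rewrite !integralRZl//; last 3 first.
- by rewrite mulr_ge0.
- by move=> y _; exact: normal_pdf_ge0.
- exact: mulr_ge0.
rewrite integral_normal_pdf mule1 EFinD leeD2r// integral_indic// setIT.
rewrite /= lebesgue_measure_itv/= lte_fin.
have -> : (if (- a < a)%R then a%:E - (- a)%:E else 0)%E = (2 * a)%:E.
  case: ltP => [_|aa]; first by rewrite -EFinB; congr EFin; ring.
  have -> : a = 0 by lra.
  by rewrite mulr0.
rewrite -EFinM lee_fin; have -> : K * c0 * (2 * a) = K * a * (2 * c0) by ring.
by rewrite ler_piMr ?mulr_ge0//; lra.
Qed.

(** Off the event the posterior mass is bounded by 1. On it, the second moments are bounded by
    functions of single observations in which the random [tau y] is replaced by [T] (noise) or by
    [n%:R^-1] (signals), so linearity of expectation suffices. *)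
Lemma eb_mass_outside_le n p (theta0 : n.-tuple R) (tau : n.-tuple R -> R)
    T r a : (1 < n)%N -> nearly_black n p theta0 ->
  measurable_fun [set: borel_tuple R n] tau -> (forall y, 0 < tau y) ->
  0 < r -> T <= 1 -> 0 < T -> 0 <= a ->
  (eb_mass_outside tau theta0 r <=
   (1 - data_law theta0 [set y | (n%:R^-1 <= tau y <= T)%R]) +
   (r ^- 2 * (n%:R * (576 * 8 * T * a + 32 * expR (- (a ^+ 2 / 8))) +
      p%:R * (60 + 4 * (8 * ln n%:R + 60 * 340))))%:E)%E.
Proof.
move=> n1 th mtau tau0 r0 T1 T0 a0.
have K0 : 0 <= 576 * 8 * T.
  by apply: mulr_ge0; [apply: mulr_ge0; exact: ler0n|exact: ltW].
set K := 576 * 8 * T in K0 *.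
set L := 8 * ln n%:R + 60 * 340.
set E := [set y | _]; have mE : measurable (E : set (borel_tuple R n)).
  exact: measurable_preimage_cc.
(* Bound on the posterior second moment of coordinate [i], uniform over scales in [1/n, T]. *)
pose H (i : 'I_n) (x : R) : R := if tnth theta0 i == 0 then noise_bound K a x
  else 12 + 4 * (x - tnth theta0 i) ^+ 2 + 4 * L.
have L0 : 0 <= L.
  apply: addr_ge0; first by rewrite mulr_ge0// ln_ge0// ler1n ltnW.
  by apply: mulr_ge0; exact: ler0n.
have H0 i x : 0 <= H i x.
  rewrite /H; case: ifP => _; first exact: noise_bound_ge0.
  by apply: addr_ge0; [apply: addr_ge0 => //|]; apply: mulr_ge0 => //; exact: sqr_ge0.
have mH i : measurable_fun [set: R] (H i).
  by rewrite /H; case: (tnth theta0 i == 0); [exact: measurable_noise_bound|measR].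
have mHi i : measurable_fun [set: borel_tuple R n] (fun y => H i (tnth y i)).
  by apply: (measurableT_comp (mH i)); exact: measurable_tnth.
have r20 : 0 <= r ^- 2 by rewrite invr_ge0 sqr_ge0.
have pw y : (posterior (tau y) y [set theta | (r <= l2dist theta0 theta)%R] <=
    (\1_(~` E) y)%:E + (r ^- 2)%:E * \sum_(i < n) (H i (tnth y i))%:E)%E.
  have S0 : (0 <= (r ^- 2)%:E * \sum_(i < n) (H i (tnth y i))%:E)%E.
    by rewrite mule_ge0 ?lee_fin// sume_ge0// => i _; rewrite lee_fin.
  rewrite indicE; have [yE|yE] := boolP (y \in ~` E).
    by apply: (le_trans (posterior_le1 (tau0 y) y _)); rewrite leeDl.
  rewrite add0e sumEFin -EFinM.
  have /andP[ty1 ty2] : n%:R^-1 <= tau y <= T.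
    by move: yE; rewrite notin_setE /setC/= => /contrapT.
  have tt : 0 < tau y <= 1 by rewrite tau0 (le_trans ty2).
  apply: posterior_markov => // i; rewrite /H; case: eqP => [->|_].
    rewrite /noise_bound indicE; have [yA|yA] := boolP (tnth y i \in `[- a, a]%classic).
      rewrite mulr1 indicE in_setC yA mulr0 addr0.
      apply: (le_trans (second_moment_zero_small _ tt)); rewrite lee_fin.
      apply: ler_wpM2r; first exact: mulr_ge0 (normal_peak_ge0 _) (mix_ge0 _ (tau0 y)).
      apply: ler_wpM2r; first exact: expR_ge0.
      by apply: ler_wpM2l => //; apply: mulr_ge0; exact: ler0n.
    rewrite indicE in_setC yA !mulr0 add0r mulr1.
    exact: second_moment_zero_le.
  apply: (le_trans (second_moment_signal_le _ _ tt)); rewrite lee_fin.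
  apply: ler_wpM2r; first exact: mulr_ge0 (normal_peak_ge0 _) (mix_ge0 _ (tau0 y)).
  rewrite lerD2l ler_pM2l// lerD2r ler_pM2l//.
  rewrite ler_ln ?posrE ?invr_gt0 ?ltr0n ?(ltnW n1)//.
  by rewrite invf_ple ?posrE ?ltr0n ?(ltnW n1).
rewrite /eb_mass_outside.
apply: (@le_trans _ _ (\int[data_law theta0]_y ((\1_(~` E) y)%:E +
   (r ^- 2)%:E * \sum_(i < n) (H i (tnth y i))%:E))%E).
  (* The posterior mass enters only through its sign and the pointwise bound [pw]. *)
  by apply: le_integral_lower => y _; [exact: posterior_ge0|exact: pw].
rewrite ge0_integralD//; last 3 first.
- by apply/measurable_EFinP; apply: measurable_indic; exact: measurableC.
- by move=> y _; rewrite mule_ge0 ?lee_fin// sume_ge0// => i _; rewrite lee_fin.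
- apply: emeasurable_funM => //; apply: emeasurable_sum => i.
  exact/measurable_EFinP.
rewrite integral_indic//; last exact: measurableC.
rewrite setIT; apply: leeD; first by rewrite -probability_setC.
rewrite ge0_integralZl//; last 2 first.
- by apply: emeasurable_sum => i; exact/measurable_EFinP.
- by move=> y _; rewrite sume_ge0// => i _; rewrite lee_fin.
rewrite [leRHS]EFinM; apply: lee_wpmul2l; first by rewrite lee_fin.
rewrite ge0_integral_sum//; last 2 first.
- by move=> i; exact/measurable_EFinP.
- by move=> i y _; rewrite lee_fin.
set Z := K * a + 32 * expR _; set S := 60 + 4 * L.
have Z0 : 0 <= Z.
  by apply: addr_ge0; [exact: mulr_ge0|apply: mulr_ge0 => //; exact: expR_ge0].
have S0 : 0 <= S by rewrite addr_ge0// mulr_ge0.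
apply: (@le_trans _ _ (\sum_(i < n) (Z + S * (tnth theta0 i != 0)%:R)%:E)%E).
  apply: lee_sum => i _.
  rewrite (ge0_integral_data_coord theta0 i (f := fun x => (H i x)%:E)); last 2 first.
  - exact/measurable_EFinP.
  - by move=> x; rewrite lee_fin.
  rewrite /H; case: eqVneq => [->|_]; rewrite ?mulr0 ?addr0 ?mulr1.
    exact: integral_noise_bound.
  apply: (@le_trans _ _ S%:E); last by rewrite lee_fin lerDr.
  set c := tnth theta0 i.
  have mc : measurable_fun [set: R] (fun x : R => (x - c) ^+ 2) by measR.
  have L40 : 0 <= 12 + 4 * L by rewrite addr_ge0// mulr_ge0.
  under eq_integral do rewrite addrAC.
  rewrite integralRD//; last 2 first.
  - by measR.
  - by move=> x _; rewrite mulr_ge0 ?sqr_ge0.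
  rewrite integral_cst// integralRZl//; last by move=> x _; exact: sqr_ge0.
  rewrite ge0_integral_normal_prob//; last 2 first.
  - exact/measurable_EFinP.
  - by move=> x; rewrite lee_fin sqr_ge0.
  (* This bounds the variance of the observation by 12; the 60 in [S] is 12 + 4 * 12. *)
  have := @normal_second_moment_le R c 1 c ltr01.
  rewrite subrr expr0n/= mulr0 addr0 expr1n mulr1 => B12.
  have -> : S%:E = ((12 + 4 * L)%:E * 1 + (4 * 12)%:E)%E.
    by rewrite mule1 -EFinD; congr EFin; rewrite /S; ring.
  apply: leeD.
    by apply: lee_wpmul2l; [rewrite lee_fin|exact: probability_le1].
  rewrite EFinM; apply: lee_wpmul2l; first by rewrite lee_fin.
  by under eq_integral do rewrite -EFinM.
rewrite sumEFin lee_fin big_split/= sumr_const card_ord -[Z *+ n]mulr_natl lerD2l.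
rewrite -mulr_sumr mulrC; apply: ler_wpM2r => //.
rewrite -natr_sum ler_nat; apply: leq_trans th.
by rewrite -sum1_card [leqRHS]big_mkcond /=; apply: leq_sum => i _; rewrite inE; case: ifP.
Qed.

End contraction_bound.

(** * Moments of the likelihood-ratio envelope under pure noise *)

Section noise_moments.
Context {R : realType}.
Implicit Types (t y z B : R).
Local Notation mu := (@lebesgue_measure R).
Local Notation phi := (normal_pdf (0 : R) 1).
Local Notation c0 := (normal_peak (1 : R)).
Local Notation E f := (\int[normal_prob (0 : R) 1]_y (f y)%:E)%E.

(** Size of observation at which t exp(y^2/2) reaches order one ([expR_zeta]). The added 1 keeps it
    at least 1 and thus safe in denominators. *)
Definition zeta t : R := Num.sqrt (1 + 2 * ln t^-1).

Lemma zeta_sqr t : 0 < t <= 1 -> zeta t ^+ 2 = 1 + 2 * ln t^-1.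
Proof.
move=> /andP[t0 t1]; rewrite sqr_sqrtr// addr_ge0// mulr_ge0// ln_ge0//.
by rewrite invf_ge1.
Qed.

Lemma zeta_ge1 t : 0 < t <= 1 -> 1 <= zeta t.
Proof.
move=> /andP[t0 t1]; rewrite -[leLHS]sqrtr1 ler_sqrt.
  by rewrite lerDl mulr_ge0// ln_ge0// invf_ge1.
by rewrite addr_ge0// mulr_ge0// ln_ge0// invf_ge1.
Qed.

Lemma zeta_le s t : 0 < s -> s <= t -> t <= 1 -> zeta t <= zeta s.
Proof.
move=> s0 st t1; have t0 : 0 < t by apply: lt_le_trans st.
have ln0 : 0 <= ln s^-1 by rewrite ln_ge0// invf_ge1// (le_trans st).
rewrite ler_wsqrtr// lerD2l ler_pM2l// ler_ln ?posrE ?invr_gt0//.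
by rewrite lef_pV2.
Qed.

Lemma expR_zeta t : 0 < t <= 1 -> t^-1 <= expR (zeta t ^+ 2 / 2) <= 2 / t.
Proof.
move=> /[dup] tt /andP[t0 t1]; rewrite zeta_sqr//.
have -> : (1 + 2 * ln t^-1) / 2 = 1 / 2 + ln t^-1 by field.
rewrite expRD lnK ?posrE ?invr_gt0//.
have h : expR (1 / 2) <= 2 :> R.
  have hh := expR_ge1Dx (- (1 / 2) : R); have ee := expRxMexpNx_1 (1 / 2 : R).
  by have := expR_gt0 (1 / 2 : R); nra.
have h1 : 1 <= expR (1 / 2) :> R by have := expR_ge1Dx (1 / 2 : R); lra.
have ti : 0 < t^-1 by rewrite invr_gt0.
by apply/andP; split; [rewrite ler_peMl// ltW|rewrite ler_pM2r].
Qed.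

(** For [B = 384] this bounds |lr - 1|, by [mix_dist] multiplied by exp(y^2/2). Times the normal
    density it is a Cauchy profile, so its first moment is finite but the second is not. *)
Definition noise_env B t y : R := B * t * expR (y ^+ 2 / 2) / (1 + y ^+ 2).

Let y1 y : 0 < 1 + y ^+ 2. Proof. by rewrite ltr_wpDr ?sqr_ge0. Qed.

Lemma noise_env_ge0 B t y : 0 <= B -> 0 <= t -> 0 <= noise_env B t y.
Proof. by move=> B0 t0; rewrite divr_ge0 ?mulr_ge0 ?expR_ge0// ltW. Qed.

Lemma measurable_noise_env B t : measurable_fun setT (noise_env B t).
Proof. by rewrite /noise_env; measR. Qed.

Let phi_env B t y : phi y * noise_env B t y = c0 * (B * t / (1 + y ^+ 2)).
Proof.
rewrite std_normal_pdfE /noise_env.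
have e1 := expRxMexpNx_1 (y ^+ 2 / 2).
set a := expR (y ^+ 2 / 2) in e1 *; set b := expR (- _) in e1 *.
transitivity (c0 * (B * t / (1 + y ^+ 2)) * (a * b)); first by move: (c0) => c; ring.
by rewrite e1 mulr1.
Qed.

Let integral_cauchy_sq s m : 0 < s ->
  (\int[mu]_y ((s ^+ 2 + (y - m) ^+ 2)^-1)%:E = (pi / s)%:E)%E.
Proof.
move=> s0; transitivity (\int[mu]_y (s^-1 * (s / (s ^+ 2 + (y - m) ^+ 2)))%:E)%E.
  by apply: eq_integral => y _; rewrite mulrA mulVf ?mul1r// lt0r_neq0.
rewrite integralRZl//; last 3 first.
- by measR.
- by rewrite invr_ge0 ltW.
- by move=> y _; rewrite divr_ge0 ?addr_ge0 ?sqr_ge0 ?(ltW s0).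
by rewrite integralT_cauchy// -EFinM mulrC.
Qed.

Let pi4 : pi <= 4 :> R. Proof. by have := pihalf_lt2 R; lra. Qed.

Let E_le (f g : R -> R) (C : \bar R) : measurable_fun setT f -> measurable_fun setT g ->
  (forall y, 0 <= f y) -> (forall y, phi y * f y <= g y) ->
  (\int[mu]_y (g y)%:E <= C)%E -> (E f <= C)%E.
Proof.
move=> mf mg f0 fg; apply: le_trans.
rewrite ge0_integral_normal_prob; last 2 first.
- exact/measurable_EFinP.
- by move=> y; rewrite lee_fin.
apply: le_integralR => //.
- by apply: measurable_funM => //; exact: measurable_normal_pdf.
- move=> y _; rewrite mulrC fg andbT.
  exact: mulr_ge0 (normal_pdf_ge0 _ _ _) (f0 y).
Qed.

Lemma integral_noise_env B t : 0 <= B -> 0 <= t ->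
  (E (noise_env B t) <= (2 * B * t)%:E)%E.
Proof.
move=> B0 t0; have c00 := normal_peak_ge0 (1 : R); have c1 := @normal_peak1_le R.
have Bt : 0 <= B * t by exact: mulr_ge0.
apply: (E_le (g := fun y => c0 * (B * t) * (1 ^+ 2 + (y - 0) ^+ 2)^-1)).
- exact: measurable_noise_env.
- by measR.
- by move=> y; exact: noise_env_ge0.
- by move=> y; rewrite phi_env expr1n subr0 !mulrA.
rewrite integralRZl//; last 3 first.
- by measR.
- exact: mulr_ge0.
- by move=> y _; rewrite invr_ge0 addr_ge0 ?sqr_ge0.
rewrite integral_cauchy_sq// -EFinM lee_fin divr1.
have := @pi_ge0 R; move: (pi : R) pi4 => P P4 P0.
have -> : 2 * B * t = (1 / 2) * (B * t) * 4 by field.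
apply: ler_pM => //; first exact: mulr_ge0.
by rewrite ler_wpM2r.
Qed.

Definition tail z : set R := ~` `[- z, z]%classic.

Let tailP z y : 0 <= z -> \1_(tail z) y = ((z < `|y|)%R)%:R :> R.
Proof.
move=> z0; rewrite indicE; congr ((nat_of_bool _)%:R).
apply/idP/idP; rewrite in_setE /tail /setC /= in_itv/= -ler_norml.
  by move=> /negP; rewrite -ltNge.
by rewrite ltNge => /negP.
Qed.

Let measurable_tail z : measurable_fun setT (\1_(tail z) : R -> R).
Proof. by apply: measurable_indic; exact: measurableC. Qed.

(** Beyond [z] the factor 1 / (1 + y^2) is at most 2 / (z^2 + y^2), a Cauchy profile of total mass 2
    pi / z. *)
Lemma integral_noise_env_tail B t z : 0 <= B -> 0 <= t -> 1 <= z ->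
  (E (fun y => noise_env B t y * \1_(tail z) y)%R <= (4 * B * t / z)%:E)%E.
Proof.
move=> B0 t0 z1; have c00 := normal_peak_ge0 (1 : R); have c1 := @normal_peak1_le R.
have z0 : 0 < z by apply: lt_le_trans z1.
have Bt : 0 <= B * t by exact: mulr_ge0.
have mt := measurable_tail z; have me := measurable_noise_env B t.
apply: (E_le (g := fun y => c0 * (B * t) * 2 * (z ^+ 2 + (y - 0) ^+ 2)^-1)).
- by measR.
- by measR.
- by move=> y; apply: mulr_ge0; [exact: noise_env_ge0|rewrite indicE].
- move=> y; rewrite subr0 mulrA phi_env tailP ?(ltW z0)//.
  have zy0 : 0 < z ^+ 2 + y ^+ 2 by rewrite ltr_wpDr ?sqr_ge0 ?exprn_gt0.
  have [zy|_] := ltP z `|y|; last first.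
    rewrite mulr0; apply: mulr_ge0; last by rewrite invr_ge0 ltW.
    by rewrite !mulr_ge0.
  rewrite mulr1 -!mulrA ler_wpM2l// ler_wpM2l// ler_wpM2l//.
  rewrite -[leRHS]invf_div lef_pV2 ?posrE ?divr_gt0//.
  have : z ^+ 2 <= y ^+ 2.
    by rewrite -[leRHS]real_normK ?num_real// ler_sqr ?nnegrE// ltW.
  by lra.
rewrite integralRZl//; last 3 first.
- by measR.
- by rewrite !mulr_ge0.
- by move=> y _; rewrite invr_ge0 addr_ge0 ?sqr_ge0.
rewrite integral_cauchy_sq// -EFinM lee_fin.
have := @pi_ge0 R; move: (pi : R) pi4 => P P4 P0.
have -> : 4 * B * t / z = (1 / 2) * (B * t) * 2 * (4 / z) by field; rewrite lt0r_neq0.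
apply: ler_pM => //.
- by rewrite !mulr_ge0.
- by rewrite divr_ge0// ltW.
- by rewrite ler_wpM2r// ler_wpM2r.
- by rewrite ler_wpM2r// invr_ge0 ltW.
Qed.

Let bulkE z y : 0 <= z -> \1_(`[- z, z]%classic) y = ((`|y| <= z)%R)%:R :> R.
Proof.
move=> z0; rewrite indicE; congr ((nat_of_bool _)%:R).
by apply/idP/idP; rewrite in_setE /= in_itv/= -ler_norml.
Qed.

(** The function exp(x/2) / (1 + x)^2 is increasing only up to a constant factor; 16 suffices by
    exp(w) >= (1 + w/2)^2. *)
Let exp_ratio (x x0 : R) : 0 <= x <= x0 ->
  expR (x / 2) / (1 + x) ^+ 2 <= 16 * (expR (x0 / 2) / (1 + x0) ^+ 2).
Proof.
move=> /andP[x_ge0 xx0]; have d0 : 0 <= x0 - x by rewrite subr_ge0.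
have p1 : 0 < (1 + x) ^+ 2 by rewrite exprn_gt0//; lra.
have p2 : 0 < (1 + x0) ^+ 2 by rewrite exprn_gt0//; lra.
have E := expR_ge_pow 1 (divr_ge0 d0 (ler0n R 2)).
have -> : x0 / 2 = x / 2 + (x0 - x) / 2 by field.
rewrite expRD; have e0 := expR_gt0 (x / 2).
move: (expR (x / 2)) (expR ((x0 - x) / 2)) E e0 => a b E a0.
rewrite ler_pdivrMr// mulrA mulrAC ler_pdivlMr//.
have key : (1 + x0) ^+ 2 <= 16 * b * (1 + x) ^+ 2.
  apply: (@le_trans _ _ (16 * (1 + (x0 - x) / 2 / 2) ^+ 2 * (1 + x) ^+ 2)); last first.
    by rewrite ler_pM2r// ler_pM2l.
  have -> : 16 * (1 + (x0 - x) / 2 / 2) ^+ 2 * (1 + x) ^+ 2 =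
     ((4 + (x0 - x)) * (1 + x)) ^+ 2 by field.
  by rewrite ler_sqr ?nnegrE ?mulr_ge0//; nra.
have -> : 16 * (a * b) * (1 + x) ^+ 2 = a * (16 * b * (1 + x) ^+ 2) by ring.
by rewrite ler_pM2l.
Qed.

(** By [exp_ratio] the squared envelope times the density is, up to a constant, largest at the edge
    [zeta t], where it is O(t / zeta^4). It is multiplied by the length of the interval. *)
Lemma integral_noise_env_bulk B t : 0 <= B -> 0 < t <= 1 ->
  (E (fun y => noise_env B t y ^+ 2 * \1_(`[- zeta t, zeta t]%classic) y)%R <=
   (32 * B ^+ 2 * t / zeta t ^+ 2)%:E)%E.
Proof.
move=> B0 /[dup] tt /andP[t0 t1].
have c00 := normal_peak_ge0 (1 : R); have c1 := @normal_peak1_le R.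
have z1 := zeta_ge1 tt; set z := zeta t in z1 *.
have z0 : 0 < z by apply: lt_le_trans z1.
have me := measurable_noise_env B t.
have m1 : measurable_fun setT (\1_(`[- z, z]%classic) : R -> R) by [].
have Bt : 0 <= B * t by rewrite mulr_ge0// ltW.
have K0 : 0 <= c0 * (32 * B ^+ 2 * t / z ^+ 4).
  apply: mulr_ge0 => //; apply: divr_ge0; last by rewrite exprn_ge0// ltW.
  by rewrite mulr_ge0 ?mulr_ge0 ?sqr_ge0// ltW.
apply: (E_le (g := fun y => c0 * (32 * B ^+ 2 * t / z ^+ 4) * \1_(`[- z, z]%classic) y)).
- by measR.
- by measR.
- by move=> y; apply: mulr_ge0; [exact: sqr_ge0|rewrite indicE].
- move=> y; rewrite bulkE ?(ltW z0)//; have [yz|_] := leP `|y| z; last by rewrite !mulr0.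
  have y2z : y ^+ 2 <= z ^+ 2 by rewrite -real_normK ?num_real// ler_sqr ?nnegrE// ltW.
  rewrite !mulr1 expr2 mulrA phi_env -[leLHS]mulrA ler_wpM2l//.
  have Er := @exp_ratio (y ^+ 2) (z ^+ 2).
  rewrite sqr_ge0 y2z in Er; have := Er isT.
  have /andP[_] := expR_zeta tt; rewrite -/z => ez Er2.
  have -> : B * t / (1 + y ^+ 2) * noise_env B t y =
     (B * t) ^+ 2 * (expR (y ^+ 2 / 2) / (1 + y ^+ 2) ^+ 2).
    by rewrite /noise_env; field; rewrite lt0r_neq0.
  apply: (@le_trans _ _ ((B * t) ^+ 2 * (16 * (2 / t / z ^+ 4)))).
    rewrite ler_wpM2l ?sqr_ge0//; apply: (le_trans Er2); rewrite ler_wpM2l//.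
    apply: ler_pM => //.
      by rewrite invr_ge0 sqr_ge0.
    rewrite lef_pV2 ?posrE ?exprn_gt0//.
    have -> : z ^+ 4 = (z ^+ 2) ^+ 2 by rewrite -exprM.
    by rewrite ler_sqr ?nnegrE ?sqr_ge0// ?lerDr// ltW.
  rewrite le_eqVlt; apply/orP; left; apply/eqP; field.
  by rewrite !lt0r_neq0.
rewrite integralRZl// integral_indic// setIT /= lebesgue_measure_itv/= lte_fin.
have -> : - z < z by lra.
rewrite -EFinB -EFinM lee_fin.
have -> : 32 * B ^+ 2 * t / z ^+ 2 = (32 * B ^+ 2 * t / z ^+ 4) * z ^+ 2.
  by field; rewrite lt0r_neq0.
have K1 : 0 <= 32 * B ^+ 2 * t / z ^+ 4.
  apply: divr_ge0; last by rewrite exprn_ge0// ltW.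
  by rewrite mulr_ge0 ?mulr_ge0 ?sqr_ge0// ltW.
move: K1; set K := 32 * B ^+ 2 * t / z ^+ 4 => K1.
have -> : c0 * K * (z - - z) = K * (c0 * (2 * z)) by move: (c0) => c; ring.
by apply: ler_wpM2l => //; nra.
Qed.

(** Against the normal density the square root behaves like sqrt(t) exp(-y^2/4) / |y|. At |y| = zeta
    + u this is O((t / zeta) exp(-zeta u / 2)). A Cauchy profile of width 4 / zeta in [u] dominates
    the exponential and supplies the second factor 1 / zeta. *)
Lemma integral_sqrt_noise_env_tail B t : 0 <= B -> 0 < t <= 1 ->
  (E (fun y => Num.sqrt (noise_env B t y) * \1_(tail (zeta t)) y)%R <=
   (16 * Num.sqrt B * t / zeta t ^+ 2)%:E)%E.
Proof.
move=> B0 /[dup] tt /andP[t0 t1].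
have c00 := normal_peak_ge0 (1 : R); have c1 := @normal_peak1_le R.
have z1 := zeta_ge1 tt; have /andP[ez _] := expR_zeta tt.
set z := zeta t in z1 ez *; clearbody z.
have z0 : 0 < z by apply: lt_le_trans z1.
have me := measurable_noise_env B t; have mt := measurable_tail z.
have zq0 : 0 < 4 / z by rewrite divr_gt0.
have b0 : 0 <= Num.sqrt B by exact: sqrtr_ge0.
pose h (u : R) := (4 / z) ^+ 2 * ((4 / z) ^+ 2 + u ^+ 2)^-1.
have d0 u : 0 < (4 / z) ^+ 2 + u ^+ 2 by rewrite ltr_wpDr ?sqr_ge0 ?exprn_gt0.
have h0 u : 0 <= h u by rewrite mulr_ge0 ?sqr_ge0// invr_ge0 ltW.
have K0 : 0 <= c0 * (Num.sqrt B * t / z).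
  by rewrite mulr_ge0// divr_ge0 ?mulr_ge0// ltW.
apply: (E_le (g := fun y => c0 * (Num.sqrt B * t / z) * (h (y - z) + h (y - (- z))))).
- by measR.
- by rewrite /h; measR.
- by move=> y; rewrite mulr_ge0 ?sqrtr_ge0 ?indicE.
- move=> y; rewrite tailP ?(ltW z0)//; have [zy|_] := ltP z `|y|; last first.
    by rewrite !mulr0 mulr_ge0// addr_ge0.
  rewrite mulr1; set u := `|y| - z; have u0 : 0 <= u by rewrite subr_ge0 ltW.
  have hu : h u <= h (y - z) + h (y - - z).
    rewrite opprK /u; have [yp|yn] := leP 0 y; first by rewrite ger0_norm// lerDl.
    rewrite ltr0_norm// ler_wpDl// /h; have -> : - y - z = - (y + z) by ring.
    by rewrite sqrrN.
  have y2 : z ^+ 2 + 2 * z * u <= y ^+ 2.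
    rewrite -[in leRHS]real_normK ?num_real//.
    have -> : `|y| = z + u by rewrite /u; ring.
    by have := sqr_ge0 u; lra.
  have yz : z ^+ 2 <= y ^+ 2 by apply: le_trans y2; rewrite lerDl !mulr_ge0// ltW.
  apply: (@le_trans _ _ (c0 * (Num.sqrt B * t / z) * h u)); last first.
    by rewrite ler_wpM2l.
  have s0 : 0 < Num.sqrt (1 + y ^+ 2) by rewrite sqrtr_gt0.
  have sz : z <= Num.sqrt (1 + y ^+ 2).
    rewrite -(@ler_pXn2r _ 2) ?nnegrE ?(ltW z0) ?(ltW s0)// [leRHS]sqr_sqrtr ?(ltW (y1 y))//.
    by lra.
  have e4 : expR (- (y ^+ 2 / 2)) * Num.sqrt (noise_env B t y) =
      Num.sqrt B * (Num.sqrt t * expR (- (y ^+ 2 / 4)) / Num.sqrt (1 + y ^+ 2)).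
    rewrite /noise_env sqrtrM; last by rewrite !mulr_ge0 ?expR_ge0// ltW.
    rewrite sqrtrM; last by rewrite mulr_ge0// ltW.
    rewrite sqrtrM// sqrtrV ?(ltW (y1 y))//.
    have -> : expR (y ^+ 2 / 2) = expR (y ^+ 2 / 4) ^+ 2.
      by rewrite [RHS]expr2 -expRD; congr expR; field.
    rewrite sqrtr_sqr ger0_norm ?expR_ge0//.
    have -> : - (y ^+ 2 / 2) = - (y ^+ 2 / 4) + - (y ^+ 2 / 4) by field.
    rewrite expRD; have := expRxMexpNx_1 (y ^+ 2 / 4).
    move: (expR (y ^+ 2 / 4)) (expR (- (y ^+ 2 / 4))) => p q pq.
    transitivity (Num.sqrt B * (Num.sqrt t * q / Num.sqrt (1 + y ^+ 2)) * (p * q)).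
      by ring.
    by rewrite pq mulr1.
  rewrite std_normal_pdfE -[leLHS]mulrA e4 -[leRHS]mulrA ler_wpM2l//.
  have -> : Num.sqrt B * t / z * h u = Num.sqrt B * (t * (z^-1 * h u)) by ring.
  rewrite ler_wpM2l// -[leLHS]mulrA.
  have split_e : expR (- (y ^+ 2 / 4)) <= Num.sqrt t * h u.
    have -> : - (y ^+ 2 / 4) = - (z ^+ 2 / 4) + - ((y ^+ 2 - z ^+ 2) / 4) by field.
    rewrite expRD; apply: ler_pM => //.
    + rewrite -(@ler_pXn2r _ 2) ?nnegrE ?expR_ge0 ?sqrtr_ge0// sqr_sqrtr ?(ltW t0)//.
      rewrite [leLHS]expr2 -expRD -[leRHS]invrK.
      have -> : - (z ^+ 2 / 4) + - (z ^+ 2 / 4) = - (z ^+ 2 / 2) by field.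
      by rewrite expRN lef_pV2 ?posrE ?expR_gt0 ?invr_gt0.
    + have zu0 : 0 <= z * u / 2 by rewrite divr_ge0 ?mulr_ge0// ltW.
      apply: (@le_trans _ _ (expR (- (z * u / 2)))).
        by rewrite ler_expR lerN2; lra.
      apply: (le_trans (expRN_le_pow 1 zu0)); rewrite /h.
      have -> : (4 / z) ^+ 2 * ((4 / z) ^+ 2 + u ^+ 2)^-1 = (1 + (z * u / 4) ^+ 2)^-1.
        have q0 : 0 < 1 + (z * u / 4) ^+ 2 by rewrite ltr_wpDr ?sqr_ge0.
        have -> : (4 / z) ^+ 2 + u ^+ 2 = (4 / z) ^+ 2 * (1 + (z * u / 4) ^+ 2).
          by field; rewrite lt0r_neq0.
        by rewrite invfM mulrA divff ?mul1r// lt0r_neq0// exprn_gt0.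
      rewrite lef_pV2 ?posrE ?ltr_wpDr ?sqr_ge0 ?exprn_gt0 ?ltr_wpDr ?divr_ge0//.
        have -> : z * u / 2 / 2 = z * u / 4 by field.
        by move: zu0; move: (z * u) => w w0; nra.
      by rewrite mulr_ge0// ltW.
  have st2 : Num.sqrt t * Num.sqrt t = t by rewrite -expr2 sqr_sqrtr// ltW.
  have -> : t * (z^-1 * h u) = Num.sqrt t * ((Num.sqrt t * h u) * z^-1).
    by rewrite -{1}st2; ring.
  rewrite ler_wpM2l ?sqrtr_ge0//; apply: ler_pM => //.
  by rewrite lef_pV2.
rewrite integralRZl//; last 2 first.
- by rewrite /h; measR.
- by move=> y _; rewrite addr_ge0.
rewrite integralRD//; last 2 first.
- by rewrite /h; measR.
- by rewrite /h; measR.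
have Ih m : (\int[mu]_y (h (y - m))%:E = (4 * pi / z)%:E)%E.
  rewrite /h integralRZl//; last 3 first.
  - by measR.
  - exact: sqr_ge0.
  - by move=> y _; rewrite invr_ge0 ltW.
  rewrite integral_cauchy_sq// -EFinM; congr EFin.
  by move: (pi : R) => P; field; rewrite lt0r_neq0.
rewrite !Ih -EFinD -EFinM lee_fin.
have := @pi_ge0 R; move: (pi : R) pi4 => P P4 P0.
have -> : 16 * Num.sqrt B * t / z ^+ 2 = (1 / 2) * (Num.sqrt B * t / z) * (32 / z).
  by field; rewrite lt0r_neq0.
apply: ler_pM => //.
- by rewrite addr_ge0 ?divr_ge0 ?mulr_ge0 ?(ltW z0).
- by rewrite ler_wpM2r// divr_ge0 ?mulr_ge0 ?(ltW t0) ?(ltW z0).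
- by rewrite -mulrDl ler_wpM2r ?invr_ge0 ?(ltW z0)//; lra.
Qed.

End noise_moments.

(** * Centring a random variable bounded below *)

Section centring.
Context d (T : measurableType d) {R : realType} (P : probability T R).
Local Open Scope ereal_scope.

(** The shift by 3 lets the mean be bounded through integrals of nonnegative functions; it suits ln
    lr, as lr >= 1/8 >= exp(-3). The witness is the mean, and centring there can only lower the
    second moment. *)
Lemma centred_second_moment (U : T -> R) (b V : R) : measurable_fun setT U ->
  (forall x, 0 <= U x + 3)%R -> \int[P]_x (U x + 3)%:E <= (b + 3)%:E ->
  \int[P]_x (U x ^+ 2)%:E <= V%:E ->
  exists m : R, [/\ (m <= b)%R, \int[P]_x (U x - m)%:E = 0 &
    \int[P]_x ((U x - m) ^+ 2)%:E <= V%:E].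
Proof.
move=> mU U3 Ub UV.
have icst (c : R) : \int[P]_x c%:E = c%:E.
  by rewrite integral_cst// -[RHS]mule1; congr (_ * _); exact: probability_setT.
have iU2 : P.-integrable setT (fun x => (U x ^+ 2)%:E).
  apply/integrableP; split; first by apply/measurable_EFinP; measR.
  under eq_integral do rewrite gee0_abs ?lee_fin ?sqr_ge0//.
  exact: (le_lt_trans UV (ltry _)).
have i1 (c : R) : P.-integrable setT (fun=> c%:E).
  apply/integrableP; split; first exact: measurable_cst.
  apply: (@le_lt_trans _ _ (\int[P]_x `|c|%:E)) => //.
  by rewrite icst ltry.
have iU : P.-integrable setT (EFin \o U).
  apply: (@le_integrable _ _ _ P _ measurableT _ (fun x => 1%:E + (U x ^+ 2)%:E)).
  - exact/measurable_EFinP.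
  - move=> x _; rewrite -EFinD /= lee_fin [leRHS]ger0_norm ?addr_ge0 ?sqr_ge0//.
    by rewrite -[X in (_ <= 1 + X)%R]real_normK ?num_real//; nra.
  - exact: integrableD.
have Ufin : \int[P]_x (U x)%:E \is a fin_num by exact: integrable_fin_num.
set m := fine (\int[P]_x (U x)%:E); have mE : \int[P]_x (U x)%:E = m%:E by rewrite fineK.
exists m; split.
- move: Ub; rewrite (_ : \int[P]_x _ = (m + 3)%:E) ?lee_fin ?lerD2r//.
  under eq_integral do rewrite EFinD.
  by rewrite integralD// mE icst EFinD.
- under eq_integral do rewrite EFinD.
  by rewrite integralD// mE icst -EFinD subrr.
- have -> : \int[P]_x ((U x - m) ^+ 2)%:E =
      \int[P]_x ((U x ^+ 2)%:E + ((- (2 * m))%:E * (U x)%:E + (m ^+ 2)%:E)).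
    by apply: eq_integral => x _; rewrite -EFinM -!EFinD; congr EFin; ring.
  rewrite integralD//; last by apply: integrableD => //; exact: integrableZl.
  rewrite integralD//; last exact: integrableZl.
  rewrite integralZl// mE icst -EFinM -EFinD.
  apply: le_trans UV; rewrite -[leRHS]adde0 leeD2l// lee_fin.
  by have := sqr_ge0 m; nra.
Qed.

End centring.

(** * Elementary inequalities for a ratio bounded below by 1/8 *)

Section log_bounds.
Context {R : realType}.
Implicit Types (x Z : R).

Let ln_le x : 0 < x -> ln x <= x - 1.
Proof. by move=> x0; have := @le_ln1Dx R (x - 1); rewrite subrKC; apply; lra. Qed.

Let abs_ln x : 8^-1 <= x -> `|ln x| <= 8 * `|x - 1|.
Proof.
move=> x8; have x0 : 0 < x by apply: lt_le_trans x8.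
have up := ln_le x0.
have lo : - ln x <= x^-1 - 1 by rewrite -lnV ?posrE//; apply: ln_le; rewrite invr_gt0.
have ix : x^-1 <= 8 by rewrite -[leRHS]invrK lef_pV2 ?posrE ?invr_gt0.
have xx : x * x^-1 = 1 by rewrite divff// lt0r_neq0.
have i0 : 0 < x^-1 by rewrite invr_gt0.
rewrite ler_norml; have [x1|x1] := leP 1 x.
  have l0 := ln_ge0 x1.
  by rewrite ger0_norm ?subr_ge0//; apply/andP; split; lra.
rewrite ltr0_norm ?subr_lt0//; apply/andP; split; last by lra.
by nra.
Qed.

Lemma ln_sqr_le x Z : 8^-1 <= x -> `|x - 1| <= Z -> ln x ^+ 2 <= 64 * Z ^+ 2.
Proof.
move=> x8 xZ; have := abs_ln x8; rewrite -real_normK ?num_real//.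
move: (normr_ge0 (ln x)) (normr_ge0 (x - 1)) xZ.
by move: `|ln x| `|x - 1| => a b a0 b0 bZ ab; nra.
Qed.

(** Alternative to [ln_sqr_le] for the tail, where Z^2 is not integrable: a logarithm grows more
    slowly than any power of |x - 1|. *)
Lemma ln_sqr_le_sqrt x Z : 8^-1 <= x -> `|x - 1| <= Z ->
  ln x ^+ 2 <= 64 * Num.sqrt Z.
Proof.
move=> x8 xZ; have x0 : 0 < x by apply: lt_le_trans x8.
have Z0 : 0 <= Z by apply: le_trans xZ.
have sq : Num.sqrt `|x - 1| <= Num.sqrt Z by rewrite ler_wsqrtr.
apply: (@le_trans _ _ (64 * Num.sqrt `|x - 1|)); last by rewrite ler_wpM2l.
have s0 := sqrtr_ge0 `|x - 1|.
have s2 : Num.sqrt `|x - 1| ^+ 2 = `|x - 1| by rewrite sqr_sqrtr.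
have [x1|x1] := leP 1 x.
  (* With the fourth root [w] of x - 1, x = 1 + w^4 <= (1 + w)^4, so ln x <= 4 w. *)
  set w := Num.sqrt (Num.sqrt `|x - 1|); have w0 : 0 <= w := sqrtr_ge0 _.
  have w2 : w ^+ 2 = Num.sqrt `|x - 1| by rewrite sqr_sqrtr.
  have w4 : x <= (1 + w) ^+ 4.
    have -> : x = 1 + (w ^+ 2) ^+ 2 by rewrite w2 s2 ger0_norm ?subr_ge0//; ring.
    have := exprn_ge0 2 w0; have := exprn_ge0 3 w0; nra.
  have : ln x <= 4 * w.
    apply: (@le_trans _ _ (ln ((1 + w) ^+ 4))).
      by rewrite ler_ln ?posrE ?exprn_gt0//; lra.
    by rewrite lnXn ?ltr_wpDr// -[leLHS]mulr_natl ler_pM2l// le_ln1Dx//; lra.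
  by have := ln_ge0 x1; rewrite -w2; nra.
have := abs_ln x8; have : `|x - 1| <= 1 by rewrite ltr0_norm ?subr_lt0//; lra.
rewrite -[ln x ^+ 2]real_normK ?num_real//.
move: (Num.sqrt `|x - 1|) s0 s2 (normr_ge0 (ln x)) => s s0 <-.
move: `|ln x| => l l0 s1 ls.
have s1' : s <= 1 by rewrite -(@ler_pXn2r _ 2) ?nnegrE// expr1n.
have s12 : s ^+ 2 <= s by rewrite expr2 ler_piMr.
have ls8 : l <= 8 * s by lra.
have l2 : l ^+ 2 <= (8 * s) ^+ 2 by rewrite ler_sqr ?nnegrE ?mulr_ge0.
by lra.
Qed.

(** The excess over 2 is exactly (x - 1)^2 / x, where 1 / x <= 8; for x >= 1 it is also at most x -
    1. *)
Lemma inv_add_le x Z : 8^-1 <= x -> `|x - 1| <= Z ->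
  x^-1 + x <= 2 + 8 * Z ^+ 2 /\ x^-1 + x <= 2 + 8 * Z.
Proof.
move=> x8 xZ; have x0 : 0 < x by apply: lt_le_trans x8.
have i0 : 0 < x^-1 by rewrite invr_gt0.
have ix : x^-1 <= 8 by rewrite -[leRHS]invrK lef_pV2 ?posrE ?invr_gt0.
have xx : x * x^-1 = 1 by rewrite divff// lt0r_neq0.
have E : x^-1 + x = 2 + x^-1 * (x - 1) ^+ 2.
  by field; rewrite lt0r_neq0.
rewrite E -real_normK ?num_real//.
have [x1|x1] := leP 1 x.
  move: xZ; rewrite ger0_norm ?subr_ge0// => xZ; split.
    by rewrite lerD2l; apply: ler_pM; rewrite ?sqr_ge0 ?(ltW i0)//; nra.
  have -> : x^-1 * (x - 1) ^+ 2 = (1 - x^-1) * (x - 1).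
    by field; rewrite lt0r_neq0.
  by nra.
move: xZ; rewrite ltr0_norm ?subr_lt0// => xZ.
have d0 : 0 <= - (x - 1) by lra.
have d1 : - (x - 1) <= 1 by lra.
move: (- (x - 1)) xZ d0 d1 => w wZ w0 w1.
have ww : x^-1 * w ^+ 2 <= 8 * w ^+ 2 by rewrite ler_wpM2r ?sqr_ge0.
by split; nra.
Qed.

Lemma min_sqr_le Z : 0 <= Z ->
  Num.min 1 (8 * Z) ^+ 2 <= 64 * Z ^+ 2 /\ Num.min 1 (8 * Z) ^+ 2 <= 64 * Num.sqrt Z.
Proof.
move=> Z0; have s0 := sqrtr_ge0 Z; have s2 : Num.sqrt Z ^+ 2 = Z by rewrite sqr_sqrtr.
move: (Num.sqrt Z) s0 s2 => s s0 s2.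
rewrite minEle; case: ifPn => [h|]; last rewrite -ltNge => h.
  have s8 : 8^-1 <= s.
    rewrite leNgt; apply/negP => sl; have : s ^+ 2 <= s * 8^-1.
      by rewrite expr2 ler_wpM2l// ltW.
    by lra.
  have Z8 : 8^-1 <= Z by lra.
  by split; nra.
have s1 : s <= 1 by rewrite -(@ler_pXn2r _ 2) ?nnegrE// expr1n; lra.
have s3 : s ^+ 2 <= s by rewrite expr2 ler_piMr.
by split; nra.
Qed.

End log_bounds.

(** * The likelihood ratio of one noise observation *)

Section likelihood_ratio.
Context {R : realType}.
Implicit Types (t y B : R).
Local Notation mu := (@lebesgue_measure R).
Local Notation phi := (normal_pdf (0 : R) 1).
Local Notation c0 := (normal_peak (1 : R)).
Local Notation E f := (\int[normal_prob (0 : R) 1]_y (f y)%:E)%E.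

(* Ratio of the marginal density of one observation to the noise density. *)
Definition lr t y : R := expR (y ^+ 2 / 2) * mix t y.

Definition env_const : R := 384.

Local Notation env := (noise_env env_const).

Lemma env_const_ge0 : 0 <= env_const. Proof. exact: ler0n. Qed.

Lemma measurable_lr t : 0 < t -> measurable_fun setT (lr t).
Proof. by move=> t0; have mm := measurable_mix t0; rewrite /lr; measR. Qed.

Lemma lr_gt0 t y : 0 < t -> 0 < lr t y.
Proof. by move=> t0; rewrite mulr_gt0 ?expR_gt0 ?mix_gt0. Qed.

Lemma lr_ge t y : 0 < t <= 1 -> 8^-1 <= lr t y.
Proof.
move=> tt; have := mix_ge_exp y tt; have e0 := expR_gt0 (y ^+ 2 / 2).
rewrite /lr expRN; move: (expR _) (mix t y) e0 => e m e0 em.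
have -> : 8^-1 = e * (e^-1 / 8) by field; rewrite lt0r_neq0.
by rewrite ler_wpM2l// ltW.
Qed.

Lemma lr_dist t y : 0 < t -> `|lr t y - 1| <= env t y.
Proof.
move=> t0; have := mix_dist y t0; have e0 := expR_gt0 (y ^+ 2 / 2).
rewrite /lr /noise_env expRN -/env_const.
move: (expR _) (mix t y) e0 => e m e0 em.
have -> : e * m - 1 = e * (m - e^-1) by field; rewrite lt0r_neq0.
rewrite normrM gtr0_norm//.
have -> : env_const * t * e / (1 + y ^+ 2) = e * (t * env_const / (1 + y ^+ 2)) by ring.
by rewrite ler_wpM2l// ltW.
Qed.

Lemma lr_scale s t y : 0 < s -> s <= t -> lr t y <= t / s * lr s y.
Proof.
move=> s0 st; rewrite /lr mulrCA ler_wpM2l ?expR_ge0//; exact: mix_scale.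
Qed.

Lemma lr_increment s t y : 0 < s -> s <= t ->
  lr t y <= lr s y + (t / s - 1) * env s y.
Proof.
move=> s0 st; rewrite /lr /noise_env.
have -> : expR (y ^+ 2 / 2) * mix s y +
    (t / s - 1) * (env_const * s * expR (y ^+ 2 / 2) / (1 + y ^+ 2)) =
  expR (y ^+ 2 / 2) * (mix s y + (t / s - 1) * (s * env_const / (1 + y ^+ 2))).
  by ring.
rewrite ler_wpM2l ?expR_ge0//; exact: mix_increment.
Qed.

Lemma lr_ge_tail t y : 0 < t <= 1 ->
  t * expR (y ^+ 2 / 2) / (60 * (1 + y ^+ 2)) <= lr t y.
Proof.
move=> tt; rewrite /lr mulrAC mulrC ler_wpM2l ?expR_ge0//; exact: mix_ge.
Qed.

Let phi_lr t y : lr t y * phi y = c0 * mix t y.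
Proof.
rewrite std_normal_pdfE /lr; have := expRxMexpNx_1 (y ^+ 2 / 2).
move: (expR _) (expR _) (c0) (mix t y) => a b c m ab.
by transitivity (c * m * (b * a)); [ring|rewrite ab mulr1].
Qed.

(** Its product with the noise density is the marginal density, a mixture over [v] of the normal
    densities with variance 1 + v^2. *)
Lemma integral_lr t : 0 < t -> E (lr t) = 1%E.
Proof.
move=> t0; rewrite ge0_integral_normal_prob; last 2 first.
- by apply/measurable_EFinP; exact: measurable_lr.
- by move=> y; rewrite lee_fin ltW// lr_gt0.
have h0 v : 0 <= hcauchy t v by rewrite hcauchy_ge0// ltW.
have mh := measurable_hcauchy t.
transitivity (\int[mu]_y \int[mu]_(v in `[0%R, +oo[)
    (c0 * (hcauchy t v * mixker v y))%:E)%E.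
  apply: eq_integral => y _; rewrite -EFinM phi_lr EFinM -mixE// -integralRZl//.
  - by rewrite /mixker; measR.
  - exact: normal_peak_ge0.
  - by move=> v _; apply: mulr_ge0 => //; exact: mixker_ge0.
rewrite (tonelli_restrict mu mu (f := fun z => c0 * (hcauchy t z.2 * mixker z.2 z.1)))//; last 2 first.
- by rewrite /hcauchy /mixker; measR.
- move=> y v _; apply: mulr_ge0; first exact: normal_peak_ge0.
  by apply: mulr_ge0 => //; exact: mixker_ge0.
rewrite -(integral_hcauchy t0); apply: eq_integral => v _.
have s0 : 0 < Num.sqrt (1 + v ^+ 2) by rewrite sqrtr_gt0 ltr_wpDr ?sqr_ge0.
transitivity (\int[mu]_y (hcauchy t v * normal_pdf 0 (Num.sqrt (1 + v ^+ 2)) y)%:E)%E.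
  apply: eq_integral => y _; congr EFin; rewrite normal_pdf_posE// /mixker subr0.
  rewrite sqr_sqrtr; last by rewrite addr_ge0 ?sqr_ge0.
  by move: (c0) => c; ring.
rewrite integralRZl//; last 2 first.
- exact: measurable_normal_pdf.
- by move=> y _; exact: normal_pdf_ge0.
by rewrite integral_normal_pdf mule1.
Qed.

Let tt0 t : 0 < t <= 1 -> 0 < t. Proof. by case/andP. Qed.

(** Integrable substitute for the square of the envelope: the square up to [zeta t], the square root
    beyond. Its expectation is O(t / zeta^2). *)
Definition env_mixed t y : R :=
  env t y ^+ 2 * \1_(`[- zeta t, zeta t]%classic) y +
  Num.sqrt (env t y) * \1_(tail (zeta t)) y.

Let ind_split t y :
  ((\1_(`[- zeta t, zeta t]%classic) y = 1 :> R) /\ (\1_(tail (zeta t)) y = 0 :> R)) \/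
  ((\1_(`[- zeta t, zeta t]%classic) y = 0 :> R) /\ (\1_(tail (zeta t)) y = 1 :> R)).
Proof.
rewrite !indicE /tail in_setC; case: (y \in _) => /=; by [left|right].
Qed.

Let m_bulk t : measurable_fun setT (\1_(`[- zeta t, zeta t]%classic) : R -> R).
Proof. by []. Qed.

Let m_tail t : measurable_fun setT (\1_(tail (zeta t)) : R -> R).
Proof. by apply: measurable_indic; exact: measurableC. Qed.

Lemma measurable_env_mixed t : measurable_fun setT (env_mixed t).
Proof.
have me := measurable_noise_env env_const t; have m1 := @m_bulk t; have m2 := @m_tail t.
by rewrite /env_mixed; measR.
Qed.

Lemma env_mixed_ge0 t y : 0 <= env_mixed t y.
Proof.
by apply: addr_ge0; apply: mulr_ge0; rewrite ?indicE// ?sqr_ge0 ?sqrtr_ge0.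
Qed.

Let ez t y : 0 < t -> 0 <= env t y.
Proof. by move=> t0; apply: noise_env_ge0; [exact: env_const_ge0|exact: ltW]. Qed.

Lemma ln_lr_sqr_le t y : 0 < t <= 1 -> ln (lr t y) ^+ 2 <= 64 * env_mixed t y.
Proof.
move=> tt; have l8 := lr_ge y tt; have ld := lr_dist y (tt0 tt).
rewrite /env_mixed; case: (ind_split t y) => [[-> ->]|[-> ->]].
  by rewrite mulr1 mulr0 addr0; exact: ln_sqr_le.
by rewrite mulr0 mulr1 add0r; exact: ln_sqr_le_sqrt.
Qed.

Lemma min_env_sqr_le t y : 0 < t <= 1 ->
  Num.min 1 (8 * env t y) ^+ 2 <= 64 * env_mixed t y.
Proof.
move=> tt; have [e1 e2] := min_sqr_le (ez y (tt0 tt)).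
rewrite /env_mixed; case: (ind_split t y) => [[-> ->]|[-> ->]].
  by rewrite mulr1 mulr0 addr0.
by rewrite mulr0 mulr1 add0r.
Qed.


Let ind_ge0 (A : set R) y : 0 <= \1_A y :> R. Proof. by rewrite indicE. Qed.

Lemma integral_env_mixed : exists2 C : R, 0 <= C &
  forall t, 0 < t <= 1 -> (E (env_mixed t) <= (C * t / zeta t ^+ 2)%:E)%E.
Proof.
have B0 := env_const_ge0; move: (@ez) (@m_bulk) (@m_tail) => ez1 mb mt.
rewrite /env_mixed; move: (env_const) B0 ez1 => B B0 ez0.
exists (32 * B ^+ 2 + 16 * Num.sqrt B).
  by rewrite addr_ge0 ?mulr_ge0 ?sqr_ge0 ?sqrtr_ge0.
move=> t tt; have t0 := tt0 tt; have me := measurable_noise_env B t.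
rewrite integralRD//; last 3 first.
- by measR; exact: mb.
- by measR; exact: mt.
- by move=> y _; apply: mulr_ge0 => //; exact: sqr_ge0.
apply: (le_trans (leeD (integral_noise_env_bulk B0 tt)
  (integral_sqrt_noise_env_tail B0 tt))).
by rewrite -EFinD lee_fin -!mulrDl.
Qed.

(** Since lr has mean one, it is enough to bound the mean of 1/lr + lr by 2 plus an error. By
    [inv_add_le] the error is O(env^2) in the bulk and O(env) in the tail. *)
Lemma integral_inv_lr : exists2 C : R, 0 <= C &
  forall t, 0 < t <= 1 -> (E (fun y => (lr t y)^-1)%R <= (1 + C * t / zeta t)%:E)%E.
Proof.
have B0 := env_const_ge0; move: (@ez) (@m_bulk) (@m_tail) (@lr_dist) => ez1 mb mt ld.
move: (env_const) B0 ez1 ld => B B0 ez0 ld.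
exists (8 * (32 * B ^+ 2) + 8 * (4 * B)).
  by rewrite addr_ge0 ?mulr_ge0 ?sqr_ge0.
move=> t tt; have t0 := tt0 tt; have me := measurable_noise_env B t.
have z1 := zeta_ge1 tt; have ml := measurable_lr t0.
have := integral_noise_env_bulk B0 tt.
have := integral_noise_env_tail B0 (ltW t0) z1.
have mb' := @mb t; have mt' := @mt t; have et y := @ez0 t y t0.
have sp := @ind_split t.
move: (\1_(tail _)) (\1_(`[_, _]%classic)) sp mt' mb' => T G sp mT mG Tle Gle.
have T0 y : 0 <= T y by case: (sp y) => -[_ ->].
have G0 y : 0 <= G y by case: (sp y) => -[-> _].
have z0 : 0 < zeta t by apply: lt_le_trans z1.
have mi : measurable_fun setT (fun y => (lr t y)^-1) by measR.
have i0 y : 0 <= (lr t y)^-1 by rewrite invr_ge0 ltW// lr_gt0.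
have eG y : 0 <= noise_env B t y ^+ 2 * G y by exact: mulr_ge0 (sqr_ge0 _) (G0 y).
have eT y : 0 <= noise_env B t y * T y by exact: mulr_ge0 (et y) (T0 y).
have l0 y : 0 <= lr t y by rewrite ltW// lr_gt0.
have main : (E (fun y => (lr t y)^-1 + lr t y)%R <=
    E (fun y => 2 + (8 * (noise_env B t y ^+ 2 * G y) + 8 * (noise_env B t y * T y)))%R)%E.
  apply: le_integralR => //; first by measR.
    by measR.
  move=> y _; rewrite addr_ge0//=.
  have [h1 h2] := inv_add_le (lr_ge y tt) (ld t y t0).
  by case: (sp y) => -[-> ->]; rewrite !(mulr1, mulr0, addr0, add0r).
have icst (c : R) : (\int[normal_prob (0 : R) 1]_x c%:E = c%:E)%E.
  by rewrite integral_cst// -[RHS]mule1; congr (_ * _)%E; exact: probability_setT.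
move: main; rewrite integralRD// integral_lr// -leeBrDr// => /le_trans; apply.
rewrite leeBlDr// integralRD//; last 2 first.
- by measR.
- by move=> y _; rewrite addr_ge0// mulr_ge0.
rewrite icst integralRD//; last 4 first.
- by measR.
- by measR.
- by move=> y _; rewrite mulr_ge0.
- by move=> y _; rewrite mulr_ge0.
rewrite !integralRZl//; last 2 first.
- by measR.
- by measR.
have e8 : (0 <= (8 : R)%:E)%E by rewrite lee_fin.
apply: (le_trans (leeD2l _ (leeD (lee_wpmul2l e8 Gle) (lee_wpmul2l e8 Tle)))).
rewrite -!EFinM -!EFinD lee_fin; move: (zeta t) z1 z0 => z z1 z0.
have zz : t / z ^+ 2 <= t / z.
  by rewrite ler_pM2l// lef_pV2 ?posrE ?exprn_gt0// expr2 ler_peMl// ltW.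
have B2 := sqr_ge0 B.
rewrite -(mulrA (32 * _) t) -(mulrA (4 * B) t) -(mulrA _ t z^-1); move: (t / z ^+ 2) (t / z) (B ^+ 2) zz B2 => a b c ab c0.
have : c * a <= c * b by rewrite ler_wpM2l.
nra.
Qed.

(** Large enough for exp(y^2/4) to exceed 240 (1 + y^2) on the spike, from which [4 <= lr t y]
    follows. *)
Let K : R := 128.

(** Observations rare under noise but fairly likely under the marginal law; they produce the strict
    loss in the mean of ln lr. *)
Let spike t := `[K * zeta t, 2 * K * zeta t]%classic.

Let spike_le t y : 0 < t <= 1 -> y \in spike t ->
  1 + y ^+ 2 <= (1 + 4 * K ^+ 2) * zeta t ^+ 2 /\ 4 <= lr t y.
Proof.
move=> tt; rewrite inE /spike /= in_itv /= => /andP[y1 y2].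
have z1 := zeta_ge1 tt; have /andP[ez0 _] := expR_zeta tt.
have t0 := tt0 tt; have lt := lr_ge_tail y tt.
have K0 : 0 < K by [].
have yz : 16 * (8 * zeta t) <= y by apply: le_trans y1; rewrite mulrA ler_wpM2r// ?/K; lra.
have y0 : 0 <= y by lra.
split.
  have : y ^+ 2 <= (2 * K * zeta t) ^+ 2.
    by rewrite ler_sqr ?nnegrE// (le_trans y0).
  have : 1 <= zeta t ^+ 2 by rewrite exprn_ege1.
  have -> : (2 * K * zeta t) ^+ 2 = 4 * K ^+ 2 * zeta t ^+ 2 by ring.
  by move=> z2 yz2; rewrite mulrDl mul1r lerD.
apply: le_trans lt; rewrite ler_pdivlMr; last first.
  by rewrite mulr_gt0// ltr_pwDl// sqr_ge0.
have -> : y ^+ 2 / 2 = y ^+ 2 / 4 + y ^+ 2 / 4 by field.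
rewrite expRD mulrA.
have h1 : 1 <= t * expR (y ^+ 2 / 4).
  rewrite -[leLHS](divff (lt0r_neq0 t0)) ler_pM2l//; apply: (le_trans ez0).
  rewrite ler_expR; have : (2 * zeta t) ^+ 2 <= y ^+ 2.
    by rewrite ler_sqr ?nnegrE//; lra.
  have -> : (2 * zeta t) ^+ 2 = 4 * zeta t ^+ 2 by ring.
  by have := sqr_ge0 (zeta t); move: (zeta t ^+ 2) (y ^+ 2) => a b; lra.
have h2 : (1 + y ^+ 2 / 8) ^+ 2 <= expR (y ^+ 2 / 4).
  have -> : y ^+ 2 / 4 = 2%:R * (y ^+ 2 / 8) by field.
  rewrite expRM_natl ler_sqr ?nnegrE ?expR_ge0 ?addr_ge0 ?divr_ge0 ?sqr_ge0//.
  exact: expR_ge1Dx.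
have h3 : 4 * (60 * (1 + y ^+ 2)) <= (1 + y ^+ 2 / 8) ^+ 2.
  have w : 16 * 16 <= (y / 8) ^+ 2.
    have y16 : 16 <= y / 8 by lra.
    by rewrite expr2 ler_pM.
  have -> : y ^+ 2 / 8 = 8 * (y / 8) ^+ 2 by field.
  have -> : y ^+ 2 = 64 * (y / 8) ^+ 2 by field.
  by move: ((y / 8) ^+ 2) w => w w0; nra.
have := expR_gt0 (y ^+ 2 / 4); nra.
Qed.

(** With w = sqrt(u) >= 2 and ln w <= w - 1 there remains a quadratic inequality in w, an equality
    at w = 2. *)
Let ln_le_spike (u : R) : 4 <= u -> ln u + 3 + u / 4 <= u + 2.
Proof.
move=> u4; have u0 : 0 < u by lra.
have w0 : 0 < Num.sqrt u by rewrite sqrtr_gt0.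
have w2 : 2 <= Num.sqrt u.
  by rewrite -(@ler_pXn2r _ 2) ?nnegrE ?sqrtr_ge0// sqr_sqrtr ?(ltW u0)//; lra.
have uE : u = Num.sqrt u ^+ 2 by rewrite sqr_sqrtr// ltW.
rewrite uE lnXn//; move: (Num.sqrt u) w0 w2 => w w0 w2.
have := @le_ln1Dx R (w - 1); rewrite subrKC => /(_ _)/wrap[]; first by lra.
by rewrite mulr2n => h; nra.
Qed.

Lemma ln_lr_ge t y : 0 < t <= 1 -> 0 <= ln (lr t y) + 3.
Proof.
move=> tt; have l8 := lr_ge y tt; have l0 := lr_gt0 y (tt0 tt).
rewrite -lerBlDr sub0r -ler_expR lnK ?posrE//; apply: le_trans l8.
rewrite expRN lef_pV2 ?posrE ?expR_gt0//.
have -> : 3 = 3%:R * 1 :> R by rewrite mulr1.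
have e2 : 2 <= expR 1 :> R by have := @expR_ge1Dx R 1; lra.
have -> : 8 = 2 ^+ 3 :> R by ring.
by rewrite expRM_natl lerXn2r ?nnegrE// expR_ge0.
Qed.

(** By [mix_ge] the marginal density is at least of order t / zeta^2 on the spike, whose length is
    of order zeta. *)
Let integral_spike : exists2 c : R, 0 < c & forall t, 0 < t <= 1 ->
  ((c * t / zeta t)%:E <= E (fun y => 4^-1 * (lr t y * \1_(spike t) y))%R)%E.
Proof.
have K0 : 0 < K by []. have Ksp := spike_le; rewrite /spike in Ksp *.
move: (K) K0 Ksp => L K0 Ksp.
have c00 : 0 < c0 by exact: normal_peak1_gt0.
pose k : R := c0 / (240 * (1 + 4 * L ^+ 2)).
have K2 : 0 < 1 + 4 * L ^+ 2 by apply: ltr_pwDl => //; apply: mulr_ge0 => //; exact: sqr_ge0.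
have k0 : 0 < k by rewrite divr_gt0// mulr_gt0.
exists (k * L); first by rewrite mulr_gt0.
move=> t tt; have t0 := tt0 tt; have z1 := zeta_ge1 tt; have ml := measurable_lr t0.
have z0 : 0 < zeta t by apply: lt_le_trans z1.
set S := `[_, _]%classic; have mS : measurable S by exact: measurable_itv.
have mI : measurable_fun setT (\1_S : R -> R) by exact: measurable_indic.
have z2 : 0 < zeta t ^+ 2 by rewrite exprn_gt0.
have kt : 0 <= k * t / zeta t ^+ 2 by rewrite ltW// divr_gt0// mulr_gt0.
have -> : (k * L * t / zeta t)%:E =
    (\int[mu]_y (k * t / zeta t ^+ 2 * \1_S y)%:E)%E.
  rewrite integralRZl// integral_indic// setIT /= lebesgue_measure_itv /= lte_fin.
  rewrite ltr_pM2r// ltr_pMl// ltr1n -EFinB -EFinM; congr EFin.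
  by move: (k) => l; field; rewrite lt0r_neq0.
rewrite ge0_integral_normal_prob; last 2 first.
- by apply/measurable_EFinP; measR.
- move=> y; rewrite lee_fin; apply: mulr_ge0 => //; apply: mulr_ge0 => //.
  by rewrite ltW// lr_gt0.
under [X in (_ <= X)%E]eq_integral do rewrite -EFinM.
apply: le_integralR => //; [by measR|by measR; exact: measurable_normal_pdf|].
move=> y _; rewrite mulr_ge0//=.
have -> : 4^-1 * (lr t y * \1_S y) * phi y = 4^-1 * (c0 * mix t y) * \1_S y.
  by rewrite -phi_lr; move: (phi y) (\1_S y) => a b; ring.
rewrite indicE; case: (boolP (y \in S)) => yS; last by rewrite !mulr0.
rewrite !mulr1; have [yz _] := Ksp t y tt yS.
have y2 : 0 < 1 + y ^+ 2 by rewrite ltr_pwDl ?sqr_ge0.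
have -> : k * t / zeta t ^+ 2 =
    4^-1 * (c0 * (t / (60 * ((1 + 4 * L ^+ 2) * zeta t ^+ 2)))).
  rewrite /k; move: (c0) (1 + 4 * L ^+ 2) K2 => c D D0.
  by field; rewrite !lt0r_neq0.
rewrite ler_wpM2l// ler_wpM2l ?(ltW c00)//; apply: le_trans (mix_ge y tt).
by rewrite ler_wpM2l ?(ltW t0)// lef_pV2 ?posrE ?mulr_gt0// ler_wpM2l.
Qed.

(** Quantitative Jensen inequality: ln u <= u - 1 everywhere, with an extra gain u / 4 on the spike,
    and lr - 1 has mean zero. *)
Lemma integral_ln_lr : exists2 c : R, 0 < c & forall t, 0 < t <= 1 ->
  (E (fun y => ln (lr t y) + 3)%R <= (3 - c * t / zeta t)%:E)%E.
Proof.
have [c c_gt0 cS] := integral_spike; exists c => // t tt.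
have t0 := tt0 tt; have ml := measurable_lr t0.
have mS : measurable (spike t) by exact: measurable_itv.
have mI : measurable_fun setT (\1_(spike t) : R -> R) by exact: measurable_indic.
have lp y : 0 <= lr t y by rewrite ltW// lr_gt0.
have sp0 y : 0 <= 4^-1 * (lr t y * \1_(spike t) y).
  by apply: mulr_ge0 => //; apply: mulr_ge0 => //.
have : (E (fun y => (ln (lr t y) + 3) + 4^-1 * (lr t y * \1_(spike t) y))%R <=
    E (fun y => lr t y + 2)%R)%E.
  apply: le_integralR => //; [by measR|by measR|].
  move=> y _; rewrite addr_ge0//= ?ln_lr_ge//.
  rewrite indicE; case: (boolP (y \in spike t)) => ys.
    by rewrite mulr1 [_^-1 * _]mulrC ln_le_spike//; case: (spike_le tt ys).
  rewrite !mulr0 addr0; have := @le_ln1Dx R (lr t y - 1); rewrite subrKC.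
  by move=> /(_ _)/wrap[]; [have := lr_gt0 y t0; lra|lra].
rewrite integralRD//; last 3 first.
- by measR.
- by measR.
- by move=> y _; exact: ln_lr_ge.
rewrite [X in (_ <= X)%E -> _]integralRD// integral_lr//.
have icst (a : R) : (\int[normal_prob (0 : R) 1]_x a%:E = a%:E)%E.
  by rewrite integral_cst// -[RHS]mule1; congr (_ * _)%E; exact: probability_setT.
rewrite icst => h; rewrite EFinB leeBrDr//.
apply: le_trans (leeD2l _ (cS t tt)) _; apply: le_trans h _.
by rewrite -EFinD lee_fin; lra.
Qed.

(* Dominates [ln (lr t' y)] for all [t <= t' <= (1 + d) * t]. *)
Definition log_lr_env d t y : R := ln (lr t y) + d * Num.min 1 (8 * env t y).

Lemma measurable_log_lr_env d t : 0 < t -> measurable_fun setT (log_lr_env d t).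
Proof.
move=> t0; have ml := measurable_lr t0; have me := measurable_noise_env env_const t.
rewrite /log_lr_env; apply: measurable_funD; first by measR.
apply: measurable_funM => //; apply: measurable_minr => //; by measR.
Qed.

Lemma ln_lr_le_env d s t y : 0 < s <= 1 -> s <= t -> t <= (1 + d) * s ->
  ln (lr t y) <= log_lr_env d s y.
Proof.
move=> ss st td; have s0 := tt0 ss; have t0 : 0 < t by apply: lt_le_trans st.
have ls0 := lr_gt0 y s0; have lt0 := lr_gt0 y t0.
have tsd : t / s - 1 <= d by rewrite lerBlDr ler_pdivrMr// [d + 1]addrC.
have ts1 : 0 <= t / s - 1 by rewrite subr_ge0 ler_pdivlMr// mul1r.
have e0 := ez y s0.
have l8 : (lr s y)^-1 <= 8.
  by rewrite -[leRHS]invrK lef_pV2 ?posrE ?invr_gt0// lr_ge.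
have h : ln (lr t y) - ln (lr s y) <= lr t y / lr s y - 1.
  rewrite -ln_div ?posrE//; have := @le_ln1Dx R (lr t y / lr s y - 1).
  by rewrite subrKC; apply; rewrite ltrBrDr addrC subrr divr_gt0.
rewrite /log_lr_env -lerBlDl; apply: (le_trans h).
(* Two bounds on the relative increment: [lr_scale] gives [d], and [lr_increment] gives [d] times
   the envelope over [lr s y >= 1 / 8]. The first keeps second moments finite, the second makes the
   mean O(d s). *)
have h1 : lr t y / lr s y - 1 <= d * 1.
  rewrite mulr1; apply: le_trans tsd; rewrite lerD2r ler_pdivrMr//.
  exact: lr_scale.
have h2 : lr t y / lr s y - 1 <= d * (8 * env s y).
  apply: (@le_trans _ _ ((t / s - 1) * env s y * (lr s y)^-1)).
    have -> : lr t y / lr s y - 1 = (lr t y - lr s y) / lr s y.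
      by field; rewrite lt0r_neq0.
    by rewrite ler_wpM2r ?invr_ge0 ?(ltW ls0)// lerBlDl lr_increment.
  apply: (@le_trans _ _ ((t / s - 1) * env s y * 8)).
    by rewrite ler_wpM2l// mulr_ge0.
  by rewrite -mulrA [_ * 8]mulrC ler_wpM2r// mulr_ge0.
by rewrite minEle; case: ifP.
Qed.

(** Mean and centred second moment of the log likelihood ratio, uniformly over a cell of relative
    width [d]. The cell costs only [K1 * d * t] in the mean, so a small [d] preserves the negative
    drift. *)
Lemma log_lr_env_moments : exists c V K1 : R, [/\ 0 < c, 0 <= V, 0 <= K1 &
  forall d t, 0 <= d <= 1 -> 0 < t <= 1 ->
  exists m, [/\ m <= - (c * t / zeta t) + K1 * d * t,
    E (fun y => log_lr_env d t y - m)%R = 0%E &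
    (E (fun y => (log_lr_env d t y - m) ^+ 2)%R <= (V * t / zeta t ^+ 2)%:E)%E]].
Proof.
have [c c_gt0 cE] := integral_ln_lr; have [C C0 CE] := integral_env_mixed.
have B0 := env_const_ge0.
exists c, (256 * C), (8 * (2 * env_const)); split=> //; first exact: mulr_ge0.
  by apply: mulr_ge0 => //; exact: mulr_ge0.
move=> d t /andP[d0 d1] tt; have t0 := tt0 tt; have ml := measurable_lr t0.
have me := measurable_noise_env env_const t.
have mmin : measurable_fun setT (fun y => Num.min 1 (8 * env t y)).
  apply: measurable_minr => //; by measR.
have e0 y := ez y t0.
have e80 y : 0 <= 8 * env t y by apply: mulr_ge0.
have min0 y : 0 <= Num.min 1 (8 * env t y) by rewrite le_min ler01/=.
have mmix := measurable_env_mixed t.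
apply: centred_second_moment.
- exact: measurable_log_lr_env.
- move=> y; rewrite /log_lr_env addrAC addr_ge0 ?mulr_ge0//; exact: ln_lr_ge.
- have -> : E (fun y => log_lr_env d t y + 3)%R =
      E (fun y => (ln (lr t y) + 3) + d * Num.min 1 (8 * env t y))%R.
    by apply: eq_integral => y _; congr EFin; rewrite /log_lr_env addrAC.
  rewrite integralRD//; last 4 first.
  + by measR.
  + by measR.
  + by move=> y _; exact: ln_lr_ge.
  + by move=> y _; exact: mulr_ge0.
  have h : (E (fun y => d * Num.min 1 (8 * env t y))%R <=
      (d * (8 * (2 * env_const * t)))%:E)%E.
    rewrite integralRZl// EFinM lee_wpmul2l ?lee_fin//.
    apply: (@le_trans _ _ (E (fun y => 8 * env t y)%R)).
      apply: le_integralR => //; first by measR.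
      by move=> y _; rewrite min0 ge_min lexx orbT.
    by rewrite integralRZl// EFinM lee_wpmul2l ?lee_fin// integral_noise_env// ltW.
  apply: (le_trans (leeD (cE t tt) h)); rewrite -EFinD lee_fin.
  move: (zeta t) (env_const) => z B.
  by rewrite le_eqVlt; apply/orP; left; apply/eqP; ring.
- apply: (@le_trans _ _ (E (fun y => 256 * env_mixed t y)%R)).
    apply: le_integralR => //.
    + by have := measurable_log_lr_env d t0 => mm; measR.
    + by measR.
    move=> y _; rewrite sqr_ge0/= /log_lr_env.
    have h1 := ln_lr_sqr_le y tt; have h2 := min_env_sqr_le y tt.
    move: (ln _) (Num.min _ _) (env_mixed t y) (min0 y) h1 h2 => a b e b0 h1 h2.
    have : (d * b) ^+ 2 <= b ^+ 2 by rewrite ler_sqr ?nnegrE ?mulr_ge0// ler_piMl.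
    by have := sqr_ge0 (a - d * b); nra.
  rewrite integralRZl//; last by move=> y _; exact: env_mixed_ge0.
  rewrite -!(mulrA 256) EFinM lee_wpmul2l// ?mulrA ?CE//.
Qed.


End likelihood_ratio.

(** * Geometric grids *)

Section geometric_grid.
Context {R : realType}.
Implicit Types (a d x : R).

Lemma geometric_grid_unbounded a d : 0 < a -> 0 < d ->
  exists m, 1 < a * (1 + d) ^+ m.
Proof.
move=> a0 d0; have ad0 : 0 < a * d by rewrite mulr_gt0.
(* With m > 1 / (a d), Bernoulli's inequality gives a (1 + d)^m >= a + a d m > 1. *)
set m := (Num.truncn (a * d)^-1).+1; exists m.
have mm : (a * d)^-1 < m%:R by exact: truncnS_gt.
have bernoulli : 1 + m%:R * d <= (1 + d) ^+ m.
  elim: (m) => [|k ih]; first by rewrite expr0 mul0r addr0.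
  rewrite exprS -natr1; have k0 := ler0n R k.
  have : (1 + d) * (1 + k%:R * d) <= (1 + d) * (1 + d) ^+ k.
    by rewrite ler_wpM2l//; lra.
  by move: (k%:R) k0 => r r0; nra.
apply: (@lt_le_trans _ _ (a * (1 + m%:R * d))); last by rewrite ler_wpM2l// ltW.
move: mm; rewrite invf_plt ?posrE ?ltr0n// => mm.
have : m%:R^-1 * m%:R < (a * d) * m%:R by rewrite ltr_pM2r ?ltr0n.
by rewrite mulVf ?pnatr_eq0//; nra.
Qed.

Lemma geometric_grid_cell a d x m : 0 < a -> 0 <= d -> a < x ->
  x < a * (1 + d) ^+ m ->
  exists2 k, (k < m)%N & a * (1 + d) ^+ k <= x <= (1 + d) * (a * (1 + d) ^+ k).
Proof.
move=> a0 d0 ax; elim: m => [|m ih]; first by rewrite expr0 mulr1 => /(lt_trans ax); rewrite ltxx.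
move=> xm; have [/ih[k km kx]|mx] := ltP x (a * (1 + d) ^+ m).
  by exists k => //; exact: ltnW.
by exists m => //; rewrite mx /= mulrCA -exprS ltW.
Qed.

Lemma sum_geometric_le d m : 0 < d <= 1 ->
  \sum_(k < m) ((1 + d) ^+ k)^-1 <= 2 / d.
Proof.
move=> /andP[d0 d1]; have q0 : 0 < 1 + d by lra.
have -> : \sum_(k < m) ((1 + d) ^+ k)^-1 = \sum_(k < m) (1 + d)^-1 ^+ k.
  by apply: eq_bigr => k _; rewrite exprVn.
have := subrX1 (1 + d)^-1 m; set S := \sum_(k < m) _ => SE.
have qm : 0 <= (1 + d)^-1 ^+ m by rewrite exprn_ge0// invr_ge0 ltW.
have SE' : d * S = (1 + d) * (1 - (1 + d)^-1 ^+ m).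
  rewrite -[1 - _]opprB SE; move: S {SE} => S; field.
  by rewrite lt0r_neq0.
by rewrite ler_pdivlMr// mulrC SE'; nra.
Qed.

End geometric_grid.

(** * Sums and products over the noise coordinates *)

Section noise_sums.
Context {R : realType}.
Implicit Types (n p : nat) (t : R).
Local Notation E f := (\int[normal_prob (0 : R) 1]_y (f y)%:E)%E.

Lemma integral_noise_sum_sqr n (theta0 : n.-tuple R) (h : R -> R) (V : R) :
  measurable_fun setT h -> 0 <= V -> E h = 0%E ->
  (E (fun y => h y ^+ 2)%R <= V%:E)%E ->
  (\int[data_law theta0]_y
     ((\sum_(i < n | tnth theta0 i == 0) h (tnth y i)) ^+ 2)%:E <= (n%:R * V)%:E)%E.
Proof.
move=> mh V0 h0 hV.
have := @integral_tuple_sum_sqr _ _ R n (fun i => normal_prob (tnth theta0 i) 1)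
  (fun i x => if tnth theta0 i == 0 then h x else 0) (fun=> V).
rewrite sumr_const card_ord mulr_natl => /(_ _ _ _)/wrap[].
- by move=> i; case: eqP.
- by move=> i; case: eqP => [->//|_]; rewrite integral0.
- move=> i; case: eqP => [->//|_]; under eq_integral do rewrite expr0n/=.
  by rewrite integral0.
apply: le_trans; rewrite le_eqVlt; apply/orP; left; apply/eqP.
by apply: eq_integral => y _; rewrite big_mkcond.
Qed.

(** By independence the expectation factorises into at most [n] factors 1 + b <= exp(b); signal
    coordinates contribute the factor 1. *)
Lemma integral_noise_prod n (theta0 : n.-tuple R) (f : R -> R) (b : R) :
  measurable_fun setT f -> (forall x, 0 <= f x) -> 0 <= b ->
  (E f <= (1 + b)%:E)%E ->
  (\int[data_law theta0]_y
     (\prod_(i < n | tnth theta0 i == 0) f (tnth y i))%:E <= (expR (n%:R * b))%:E)%E.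
Proof.
move=> mf f0 b0 fb.
pose g (i : 'I_n) (x : R) := (if tnth theta0 i == 0 then f x else 1)%:E.
have gE : (\int[data_law theta0]_y (\prod_(i < n | tnth theta0 i == 0) f (tnth y i))%:E =
    \int[data_law theta0]_y (\prod_(i < n) g i (tnth y i)))%E.
  by apply: eq_integral => y _; rewrite big_mkcond -prodEFin.
rewrite gE (integral_tuple_prod (fun i => normal_prob (tnth theta0 i) 1)); last 2 first.
- by move=> i; apply/measurable_EFinP; case: (tnth theta0 i == 0).
- by move=> i x; rewrite /g; case: ifP => _; rewrite lee_fin.
have [_ h] : (0 <= \prod_(i < n) \int[normal_prob (tnth theta0 i) 1]_x g i x)%E /\
    (\prod_(i < n) \int[normal_prob (tnth theta0 i) 1]_x g i x <=
     \prod_(i < n) (expR b)%:E)%E.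
  elim/big_rec2 : _ => [|i x y _ [y0 yx]]; first by rewrite lee_fin.
  have g0 : (0 <= \int[normal_prob (tnth theta0 i) 1]_x g i x)%E.
    by apply: integral_ge0 => z _; rewrite /g; case: ifP => _; rewrite lee_fin.
  split; first exact: mule_ge0.
  apply: lee_pmul => //; rewrite /g; case: eqP => [->|_].
    by apply: (le_trans fb); rewrite lee_fin expR_ge1Dx.
  rewrite integral_cst// [leLHS](_ : _ = 1%E).
    by rewrite lee_fin -expR0 ler_expR.
  by rewrite -[RHS]mule1; congr (_ * _)%E; exact: probability_setT.
by apply: (le_trans h); rewrite prodEFin prodr_const card_ord expRM_natl.
Qed.

End noise_sums.

(** * Comparing the likelihood at two scales *)

Section likelihood_comparison.
Context {R : realType}.
Implicit Types (n p : nat) (s t d m D : R).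

Lemma sum_ln_lr_le n s t (y : n.-tuple R) : 0 < s -> 0 < t ->
  evidence s y <= evidence t y ->
  \sum_(i < n) ln (lr s (tnth y i)) <= \sum_(i < n) ln (lr t (tnth y i)).
Proof.
move=> s0 t0; have c00 := @normal_peak1_gt0 R.
have ev u : 0 < u -> evidence u y =
    (\prod_(i < n) (normal_peak 1 * expR (- (tnth y i ^+ 2 / 2)))) *
    expR (\sum_(i < n) ln (lr u (tnth y i))).
  move=> u0; rewrite expR_sum -big_split; apply: eq_bigr => i _ /=.
  rewrite lnK ?posrE ?lr_gt0// /lr; have := expRxMexpNx_1 (tnth y i ^+ 2 / 2).
  move: (expR _) (expR _) (mix _ _) (normal_peak _) => a b x c ab.
  by transitivity (c * x * (b * a)); [rewrite ab mulr1|ring].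
rewrite !ev// ler_pM2l ?ler_expR//.
by apply: prodr_gt0 => i _; rewrite mulr_gt0// expR_gt0.
Qed.

Lemma card_noise_ge n p (theta0 : n.-tuple R) : nearly_black n p theta0 ->
  n%:R - p%:R <= \sum_(i < n | tnth theta0 i == 0) (1 : R) <= n%:R /\
  \sum_(i < n | tnth theta0 i != 0) (1 : R) <= p%:R.
Proof.
move=> th; have sig : \sum_(i < n | tnth theta0 i != 0) (1 : R) <= p%:R.
  by rewrite sumr_const ler_nat.
have sig0 : 0 <= \sum_(i < n | tnth theta0 i != 0) (1 : R) by rewrite sumr_ge0.
have : \sum_(i < n) (1 : R) = n%:R by rewrite sumr_const card_ord.
rewrite (bigID (fun i => tnth theta0 i == 0))/= => nE; split=> //.
by apply/andP; split; lra.
Qed.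

(** By [mix_scale] each signal raises its log ratio by at most ln(u / s) <= ln(2 t / s), whatever
    its observation. Each noise term at [u] is at most its envelope at [t], with mean [m <= - D],
    and there are at least n - p of them. *)
Lemma noise_ln_lr_le n p (theta0 y : n.-tuple R) s t u d m D :
  nearly_black n p theta0 -> 0 < s -> s <= t -> t <= 1 -> 0 <= d <= 1 ->
  t <= u -> u <= (1 + d) * t -> evidence s y <= evidence u y ->
  m <= - D -> 0 <= D ->
  \sum_(i < n | tnth theta0 i == 0) ln (lr s (tnth y i)) <=
    p%:R * ln (2 * (t / s)) - (n%:R - p%:R) * D +
    \sum_(i < n | tnth theta0 i == 0) (log_lr_env d t (tnth y i) - m).
Proof.
move=> th s0 st t1 /andP[d0 d1] tu ud su mD D0.
have t0 : 0 < t by apply: lt_le_trans st.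
have u0 : 0 < u by apply: lt_le_trans tu.
have := sum_ln_lr_le s0 u0 su.
have [/andP[noise _] sig] := card_noise_ge th.
rewrite (bigID (fun i => tnth theta0 i == 0))/= [leRHS](bigID (fun i => tnth theta0 i == 0))/=.
set Ns := \sum_(i < n | _) _; set Ss := \sum_(i < n | _) _.
set Nu := \sum_(i < n | _) _; set Su := \sum_(i < n | _) _ => h.
have ts1 : 1 <= t / s by rewrite ler_pdivlMr// mul1r.
have ts2 : 0 < 2 * (t / s) by lra.
have l0 : 0 <= ln (2 * (t / s)) by rewrite ln_ge0//; lra.
have SuSs : Su <= (\sum_(i < n | tnth theta0 i != 0) 1) * ln (2 * (t / s)) + Ss.
  rewrite mulr_suml -big_split; apply: ler_sum => i _ /=.
  rewrite mul1r -lnM ?posrE ?lr_gt0//.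
  rewrite ler_ln ?posrE ?lr_gt0//; last by rewrite mulr_gt0 ?lr_gt0.
  apply: (le_trans (lr_scale (tnth y i) s0 (le_trans st tu))).
  rewrite ler_wpM2r ?(ltW (lr_gt0 _ _))// mulrA ler_wpM2r ?invr_ge0 ?(ltW s0)//.
  by nra.
have NuU : Nu <= \sum_(i < n | tnth theta0 i == 0) (log_lr_env d t (tnth y i) - m) +
    (\sum_(i < n | tnth theta0 i == 0) 1) * m.
  rewrite mulr_suml -big_split; apply: ler_sum => i _ /=.
  by rewrite mul1r subrK; apply: ln_lr_le_env; rewrite ?t0.
have : 0 <= \sum_(i < n | tnth theta0 i == 0) (1 : R) by rewrite sumr_ge0.
move: (\sum_(i < n | _) 1) (\sum_(i < n | _) 1) noise sig SuSs NuU => a b.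
move: (\sum_(i < n | _) _) => S noise sig SuSs NuU a0.
have h1 : b * ln (2 * (t / s)) <= p%:R * ln (2 * (t / s)) by rewrite ler_wpM2r.
have h2 : a * m <= a * - D by rewrite ler_wpM2l.
have h3 : (n%:R - p%:R) * D <= a * D by rewrite ler_wpM2r.
by lra.
Qed.

End likelihood_comparison.

(** * The rate tau_n(p) and its threshold *)

Section sparsity_rate.
Context {R : realType}.
Variables (n p : nat).
Hypotheses (p0 : (0 < p)%N) (pn : (2 * p <= n)%N) (L1 : 1 <= ln (n%:R / p%:R : R)).
Local Notation L := (ln (n%:R / p%:R : R)).
Local Notation s := (@tau_rate R n p).

Let pR : 0 < p%:R :> R. Proof. by rewrite ltr0n. Qed.

Let nR : 0 < n%:R :> R.
Proof. by rewrite ltr0n (leq_trans _ pn)// muln_gt0. Qed.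

Let q1 : 1 <= Num.sqrt L. Proof. by rewrite -[leLHS]sqrtr1 ler_sqrt// (le_trans _ L1). Qed.

Let q2 : Num.sqrt L ^+ 2 = L. Proof. by rewrite sqr_sqrtr// (le_trans _ L1). Qed.

Lemma natr_tau_rate : n%:R * s = p%:R * Num.sqrt L.
Proof. by rewrite /tau_rate; field; rewrite lt0r_neq0. Qed.

Lemma tau_rate_ge : n%:R^-1 <= s.
Proof.
rewrite -(ler_pM2l nR) natr_tau_rate divff ?lt0r_neq0//.
have : 1 <= p%:R :> R by rewrite ler1n.
by move=> p1; rewrite -[leLHS]mulr1 ler_pM.
Qed.

Lemma tau_rate_gt0 : 0 < s.
Proof. by apply: lt_le_trans tau_rate_ge; rewrite invr_gt0. Qed.

(** Here ln(1/s) = L - ln(sqrt L), and the correction is at most sqrt(L) - 1. *)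
Lemma zeta_tau_rate : s <= 1 -> Num.sqrt L <= zeta s <= 2 * Num.sqrt L.
Proof.
move=> s1; have s0 := tau_rate_gt0; have ss : 0 < s <= 1 by rewrite s0.
have q0 : 0 < Num.sqrt L by apply: lt_le_trans q1.
have z2 : zeta s ^+ 2 = 1 + 2 * (L - ln (Num.sqrt L)).
  rewrite zeta_sqr// /tau_rate invfM invfM invrK [p%:R^-1 * _]mulrC -ln_div ?posrE//.
  by rewrite divr_gt0.
have lq0 : 0 <= ln (Num.sqrt L) by rewrite ln_ge0.
have lq : ln (Num.sqrt L) <= Num.sqrt L - 1.
  have := @le_ln1Dx R (Num.sqrt L - 1); rewrite subrKC; apply.
  by rewrite ltrBrDr addrC subrr.
have z0 : 0 <= zeta s by apply: le_trans (zeta_ge1 ss).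
move: (zeta s) (Num.sqrt L) z2 z0 q1 q2 q0 lq lq0 => z q z2 z0 q1' q2' q0 lq lq0.
apply/andP; split; rewrite -(@ler_pXn2r _ 2) ?nnegrE ?mulr_ge0 ?(ltW q0)//.
  by rewrite z2 -q2'; nra.
by rewrite z2 exprMn -q2'; nra.
Qed.

End sparsity_rate.

(** * The maximum marginal likelihood estimator *)

Section mmle.
Context {R : realType}.
Implicit Types (n p : nat) (s t : R).

Lemma ln_le_linear (e : R) : 0 < e ->
  exists2 A, 1 <= A & forall x, A <= x -> ln (2 * x) <= e * x.
Proof.
move=> e0; have e4 : 0 < 4 / e by rewrite divr_gt0.
exists (1 + 2 * `|ln (4 / e)| / e).
  by rewrite lerDl divr_ge0 ?mulr_ge0// ltW.
move=> x Ax; have x0 : 0 < x.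
  by apply: lt_le_trans Ax; rewrite ltr_pwDl// divr_ge0 ?mulr_ge0// ltW.
have -> : 2 * x = e * x / 2 * (4 / e) by field; rewrite lt0r_neq0.
have ex0 : 0 < e * x / 2 by rewrite divr_gt0 ?mulr_gt0.
rewrite lnM ?posrE//.
have h1 : ln (e * x / 2) <= e * x / 2 - 1.
  by have := @le_ln1Dx R (e * x / 2 - 1); rewrite subrKC; apply; lra.
have h2 : ln (4 / e) <= `|ln (4 / e)| by exact: ler_norm.
have h3 : 2 * `|ln (4 / e)| <= e * x.
  by rewrite [leRHS]mulrC -ler_pdivrMr//; lra.
lra.
Qed.

(** An estimate above [A * tau_rate n p] is at least as likely as [s = tau_rate n p] itself. That
    forces a large centred noise sum in some grid cell, or an unusually small noise likelihood at
    [s]. *)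
Lemma mmle_le_rate : exists A K : R, [/\ 0 < A, 0 <= K &
  forall n p (theta0 : n.-tuple R) (tau : n.-tuple R -> R),
  (0 < p)%N -> (2 * p <= n)%N -> 1 <= ln (n%:R / p%:R : R) ->
  tau_rate n p <= 1 :> R -> nearly_black n p theta0 ->
  measurable_fun [set: borel_tuple R n] tau -> is_mmle tau ->
  ((1 - K / p%:R)%:E <=
   data_law theta0 [set y | (n%:R^-1 <= tau y <= A * tau_rate n p)%R])%E].
Proof.
have [c [V [K1 [c0 V0 K10 moments]]]] := @log_lr_env_moments R.
have [C C0 invlr] := @integral_inv_lr R.
(* In [Wge] a quarter of the drift is at least e p (g/s). [A] is chosen so that for x >= A both ln(2
   x) and C + 1 are at most e x. *)
pose e := c / 32; have e0 : 0 < e by rewrite divr_gt0.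
have [A1 A11 lnA] := ln_le_linear e0.
pose A := A1 + (C + 1) / e; pose kap := c + 4 * K1.
have C1 : 0 < C + 1 by rewrite ltr_wpDl.
have A1A : A1 <= A by rewrite lerDl divr_ge0// ltW.
have A0 : 0 < A by apply: lt_le_trans A1A; apply: lt_le_trans A11.
have AC : C + 1 <= e * A.
  rewrite mulrDr mulrCA divff ?lt0r_neq0// mulr1 lerDr mulr_ge0 ?(ltW e0)//.
  exact: le_trans A11.
have kap0 : 0 < kap by rewrite ltr_pwDl// mulr_ge0.
exists A, (128 * (V * kap / c ^+ 3) + 1); split=> //.
  by rewrite addr_ge0// mulr_ge0// divr_ge0 ?mulr_ge0 ?exprn_ge0// ltW.
move=> n p theta0 tau p0 pn L1 s1 th mtau mmle.
have [pR n0] : 0 < p%:R :> R /\ 0 < n%:R :> R.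
  by rewrite !ltr0n p0 (leq_trans _ pn)// muln_gt0.
have s0 := tau_rate_gt0 p0 pn L1; have sn := tau_rate_ge p0 pn L1.
have ns := @natr_tau_rate R n p p0 pn.
have /andP[qz zq] := zeta_tau_rate p0 pn L1 s1.
set q := Num.sqrt _ in ns qz zq; set s := tau_rate n p in s1 s0 sn ns qz zq *.
have q1 : 1 <= q by rewrite -[leLHS]sqrtr1 ler_sqrt// (le_trans _ L1).
have q0 : 0 < q by apply: lt_le_trans q1.
(* A mesh of order 1 / q is fine enough for the cell cost [K1 * d] to use at most half the drift, as
   zeta <= 2 q. It is also coarse enough: the Chebyshev bounds sum to order 1 / (n s d), which is
   O(1/p) because n s = p q. *)
pose d := c / (kap * q).
have d0 : 0 < d by rewrite divr_gt0 ?mulr_gt0.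
have d1 : d <= 1.
  rewrite ler_pdivrMr ?mulr_gt0// mul1r; apply: (@le_trans _ _ kap).
    by rewrite lerDl mulr_ge0.
  by rewrite ler_peMr// ltW.
have As0 : 0 < A * s by rewrite mulr_gt0.
have [m mP] := geometric_grid_unbounded As0 d0.
pose g k := A * s * (1 + d) ^+ k.
have g0 k : 0 < g k by rewrite mulr_gt0// exprn_gt0//; lra.
have sg k : s <= g k /\ A <= g k / s.
  have h1 : A <= g k / s.
    rewrite ler_pdivlMr// /g -[leLHS]mulr1 ler_wpM2l ?(ltW As0)//.
    by rewrite exprn_ege1//; lra.
  split=> //; rewrite -[leLHS]mul1r -ler_pdivlMr//; apply: le_trans h1.
  exact: le_trans A11 A1A.
(* The centring at each grid point; above 1 the value 0 is arbitrary. *)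
have ctr k : exists mk, g k <= 1 -> [/\ mk <= - (c / 2 * g k / zeta (g k)),
    (\int[normal_prob (0 : R) 1]_y (log_lr_env d (g k) y - mk)%:E = 0)%E &
    (\int[normal_prob (0 : R) 1]_y ((log_lr_env d (g k) y - mk) ^+ 2)%:E <=
     (V * g k / zeta (g k) ^+ 2)%:E)%E].
  have [gk1|] := leP (g k) 1; last by move=> _; exists 0.
  have gg : 0 < g k <= 1 by rewrite g0.
  have dd : 0 <= d <= 1 by rewrite (ltW d0).
  have [mk [mkb mk0 mk2]] := moments d (g k) dd gg.
  exists mk => _; split=> //; apply: (le_trans mkb).
  have zk1 := zeta_ge1 gg; have zk := zeta_le s0 (proj1 (sg k)) gk1.
  have zk0 : 0 < zeta (g k) by apply: lt_le_trans zk1.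
  have K1d : K1 * d <= c / 2 / zeta (g k).
    apply: (@le_trans _ _ (c / 2 / (2 * q))); last first.
      by rewrite ler_wpM2l ?divr_ge0 ?(ltW c0)// lef_pV2 ?posrE ?mulr_gt0// (le_trans zk).
    have -> : K1 * d = K1 / kap * (c / q) by rewrite /d; field; rewrite !lt0r_neq0.
    have -> : c / 2 / (2 * q) = 4^-1 * (c / q) by field; rewrite lt0r_neq0.
    rewrite ler_wpM2r ?divr_ge0 ?(ltW c0) ?(ltW q0)// ler_pdivrMr// /kap.
    by rewrite -ler_pdivrMl ?invr_gt0// invrK lerDr ltW.
  have -> : - (c * g k / zeta (g k)) = - (c / 2 * g k / zeta (g k)) - c / 2 / zeta (g k) * g k.
    by field; rewrite lt0r_neq0.
  by rewrite -addrA gerDl addrC subr_le0 ler_wpM2r ?(ltW (g0 k)).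
have [mk mkP] := choice ctr => {ctr moments}.
pose S k (y : n.-tuple R) : R :=
  \sum_(i < n | tnth theta0 i == 0) (log_lr_env d (g k) (tnth y i) - mk k).
(* Total drift of the noise at [g k], with n - p replaced by n / 2. [F k] is the Chebyshev majorant
   of the event that the centred sum exceeds [W k / 2]; it is set to 0 above 1, where no cell can
   contain an estimate. [G] is the Markov majorant for a small noise likelihood at [s]. *)
pose W k : R := n%:R * (c * g k / (4 * zeta (g k))).
pose F k y : R := if g k <= 1 then 4 / W k ^+ 2 * S k y ^+ 2 else 0.
pose G (y : n.-tuple R) : R := expR (- ((C + 1) * p%:R)) *
  \prod_(i < n | tnth theta0 i == 0) (lr s (tnth y i))^-1.
have Wge k : g k <= 1 -> e * p%:R * (g k / s) <= W k / 4 /\ 0 < W k.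
  move=> gk1; have gg : 0 < g k <= 1 by rewrite g0.
  have zk0 : 0 < zeta (g k) by apply: lt_le_trans (zeta_ge1 gg).
  split; last by apply: (mulr_gt0 n0); apply: divr_gt0; apply: mulr_gt0.
  have zk : zeta (g k) <= 2 * q by apply: le_trans (zeta_le s0 (proj1 (sg k)) gk1) zq.
  have -> : e * p%:R * (g k / s) = c / 16 * (p%:R * (g k / s)) / 2 by rewrite /e; field; rewrite lt0r_neq0.
  have -> : W k / 4 = c / 16 * (n%:R * s * (g k / s)) / zeta (g k).
    by rewrite /W; field; rewrite !lt0r_neq0.
  rewrite ns; have -> : c / 16 * (p%:R * q * (g k / s)) / zeta (g k) =
    c / 16 * (p%:R * (g k / s)) * (q / zeta (g k)) by field; rewrite !lt0r_neq0.
  apply: ler_wpM2l.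
    by apply: mulr_ge0; [rewrite divr_ge0// ltW|apply: mulr_ge0; rewrite ?divr_ge0// ltW].
  by rewrite ler_pdivlMr// mulrC ler_pdivrMr// mulrC.
set B := [set y | _]; have F0 k y : 0 <= F k y.
  rewrite /F; case: ifP => // gk1; have [_ Wk] := Wge _ gk1.
  by rewrite mulr_ge0 ?sqr_ge0// divr_ge0// sqr_ge0.
have G0 y : 0 <= G y.
  rewrite /G mulr_ge0 ?expR_ge0// prodr_ge0// => i _.
  by rewrite invr_ge0 ltW// lr_gt0.
have pw y : ((\1_(~` B) y)%:E <= \sum_(k < m) (F k y)%:E + (G y)%:E)%E.
  have sF0 : 0 <= \sum_(k < m) F k y by rewrite sumr_ge0.
  rewrite sumEFin -EFinD lee_fin indicE; have [yB|yB] := boolP (y \in ~` B); last first.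
    by rewrite addr_ge0.
  have [/andP[tn t1] tmax] := mmle y.
  have At : A * s < tau y.
    rewrite ltNge; apply/negP => tA.
    by move: yB; rewrite inE /B/= tn tA.
  have [k km /andP[gt tg]] := geometric_grid_cell As0 (ltW d0) At (le_lt_trans t1 mP).
  have gk1 : g k <= 1 by apply: le_trans t1.
  have gg : 0 < g k <= 1 by rewrite g0.
  have zk0 : 0 < zeta (g k) by apply: lt_le_trans (zeta_ge1 gg).
  have t0 : 0 < tau y by apply: lt_trans At.
  have ev : evidence s y <= evidence (tau y) y.
    by rewrite -lee_fin -!marginal_likelihoodE// tmax// sn.
  have [mkb _ _] := mkP k gk1; have [sgk Agk] := sg k.
  have D0 : 0 <= c / 2 * g k / zeta (g k).
    apply: divr_ge0; last exact: ltW.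
    by apply: mulr_ge0; [rewrite divr_ge0// ltW|rewrite ltW].
  have dd : 0 <= d <= 1 by rewrite (ltW d0).
  have := noise_ln_lr_le th s0 sgk gk1 dd gt tg ev mkb D0.
  rewrite -/(S k y); set Z := \sum_(i < n | _) _ => Zle.
  have [We Wk0] := Wge k gk1.
  have ND : W k <= (n%:R - p%:R) * (c / 2 * g k / zeta (g k)).
    have -> : W k = n%:R / 2 * (c / 2 * g k / zeta (g k)).
      by rewrite /W; field; rewrite lt0r_neq0.
    rewrite ler_wpM2r//.
    have : (2 * p)%:R <= n%:R :> R by rewrite ler_nat.
    by rewrite natrM; lra.
  have lnW : p%:R * ln (2 * (g k / s)) <= W k / 4.
    apply: le_trans We; rewrite (mulrC e) -(mulrA _ e) ler_wpM2l ?(ltW pR)// lnA//.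
    exact: le_trans A1A Agk.
  have CW : (C + 1) * p%:R <= W k / 4.
    apply: le_trans We; rewrite mulrAC ler_wpM2r ?(ltW pR)//; apply: (le_trans AC).
    by rewrite ler_wpM2l// ltW.
  (* If the centred sum is below W / 2, the log likelihood [Z] at [s] is at most W/4 - W + W/2 = -
     W/4, hence at most -(C+1) p, and [G y >= 1]. Otherwise [F k y >= 1]. *)
  have [SW|SW] := leP (W k / 2) (S k y).
    rewrite -[leLHS]addr0 lerD//.
    rewrite (bigD1 (Ordinal km))//= -[leLHS]addr0 lerD ?sumr_ge0//.
    rewrite /F gk1 mulrC mulrA ler_pdivlMr ?exprn_gt0// mul1r.
    have : (W k / 2) ^+ 2 <= S k y ^+ 2.
      by rewrite ler_sqr ?nnegrE ?(le_trans _ SW)// divr_ge0// ltW.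
    move: (W k) (S k y) => w u; have -> : (w / 2) ^+ 2 = w ^+ 2 / 4 by field.
    by lra.
  rewrite -[leLHS]add0r lerD// /G.
  have -> : \prod_(i < n | tnth theta0 i == 0) (lr s (tnth y i))^-1 = expR (- Z).
    rewrite /Z -sumrN expR_sum; apply: eq_bigr => i _.
    by rewrite expRN lnK ?posrE ?lr_gt0.
  by rewrite -expRD -[leLHS]expR0 ler_expR; lra.
have mB : measurable (B : set (borel_tuple R n)) by exact: measurable_preimage_cc.
have mlog k : measurable_fun setT (fun y => log_lr_env d (g k) y - mk k).
  have mU := measurable_log_lr_env d (g0 k); by measR.
have mF k : measurable_fun [set: borel_tuple R n] (F k).
  rewrite /F; case: (g k <= 1); last exact: measurable_cst.
  apply: measurable_funM; first exact: measurable_cst.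
  apply: measurable_funX; rewrite /S; under eq_fun do rewrite big_mkcond.
  apply: measurable_sum => i; case: (tnth theta0 i == 0) => //.
  by apply: (measurableT_comp (mlog k)); exact: measurable_tnth.
have mi : measurable_fun setT (fun x : R => (lr s x)^-1).
  by have ml := measurable_lr s0; measR.
have mprod : measurable_fun [set: borel_tuple R n]
    (fun y => (\prod_(i < n | tnth theta0 i == 0) (lr s (tnth y i))^-1)%:E).
  under eq_fun do rewrite big_mkcond -prodEFin.
  apply: (emeasurable_tuple_prod
    (f := fun i x => (if tnth theta0 i == 0 then (lr s x)^-1 else 1)%:E)) => i.
  by apply/measurable_EFinP => /=; case: (tnth theta0 i == 0).
(* Variance over squared drift: [zeta] cancels, leaving order 1 / (n g_k), which is geometric in
   [k]. *)
have IF k : (\int[data_law theta0]_y (F k y)%:E <=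
    (64 * V / (c ^+ 2 * (n%:R * (A * s))) * ((1 + d) ^+ k)^-1)%:E)%E.
  rewrite /F; case: (boolP (g k <= 1)) => [gk1|_]; last first.
    rewrite integral0 lee_fin mulr_ge0 ?invr_ge0 ?exprn_ge0//; last by lra.
    by rewrite divr_ge0 ?mulr_ge0 ?sqr_ge0// ltW.
  have [_ Wk0] := Wge k gk1; have [_ mk0 mk2] := mkP k gk1.
  have gg : 0 < g k <= 1 by rewrite g0.
  have zk0 : 0 < zeta (g k) by apply: lt_le_trans (zeta_ge1 gg).
  have Vz : 0 <= V * g k / zeta (g k) ^+ 2.
    by rewrite divr_ge0 ?sqr_ge0// mulr_ge0// ltW.
  have w0 : 0 <= 4 / W k ^+ 2 by rewrite divr_ge0 ?sqr_ge0.
  under eq_integral do rewrite EFinM.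
  rewrite ge0_integralZl//; last 2 first.
  - apply/measurable_EFinP; apply: measurable_funX.
    rewrite /S; under eq_fun do rewrite big_mkcond.
    apply: measurable_sum => i; case: (tnth theta0 i == 0) => //.
    by apply: (measurableT_comp (mlog k)); exact: measurable_tnth.
  - by move=> y _; rewrite lee_fin sqr_ge0.
  apply: (le_trans (lee_wpmul2l _ (integral_noise_sum_sqr theta0 (mlog k) Vz mk0 mk2))).
    by rewrite lee_fin.
  rewrite -EFinM lee_fin le_eqVlt; apply/orP; left; apply/eqP.
  rewrite /W /g; set u := (1 + d) ^+ k; have u0 : 0 < u by rewrite exprn_gt0//; lra.
  move: (zeta _) zk0 => z z0; clearbody u s A.
  by field; rewrite !lt0r_neq0.
have IG : (\int[data_law theta0]_y (G y)%:E <= (p%:R^-1)%:E)%E.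
  have b0 : 0 <= C * s / zeta s.
    by rewrite divr_ge0 ?mulr_ge0 ?(ltW s0)// (le_trans (ltW q0)).
  have ss : 0 < s <= 1 by rewrite s0.
  under eq_integral do rewrite EFinM.
  rewrite ge0_integralZl//; last first.
    move=> y _; rewrite lee_fin prodr_ge0// => i _.
    by rewrite invr_ge0 ltW// lr_gt0.
  have l0 x : 0 <= (lr s x)^-1 by rewrite invr_ge0 ltW// lr_gt0.
  apply: (le_trans (lee_wpmul2l _ (integral_noise_prod theta0 mi l0 b0 (invlr s ss)))).
    by rewrite lee_fin expR_ge0.
  rewrite -EFinM -expRD lee_fin.
  (* From n s = p q and q <= zeta s. With the factor exp(-(C+1) p) this leaves exp(-p) <= 1/p. *)
  have h : n%:R * (C * s / zeta s) <= C * p%:R.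
    have z0 : 0 < zeta s by apply: lt_le_trans qz.
    have -> : n%:R * (C * s / zeta s) = C * (n%:R * s / zeta s) by ring.
    rewrite ler_wpM2l// ler_pdivrMr// ns ler_wpM2l// ltW//.
  apply: (@le_trans _ _ (expR (- p%:R))); first by rewrite ler_expR; lra.
  rewrite expRN lef_pV2 ?posrE ?expR_gt0//.
  by apply: le_trans (expR_ge1Dx _); rewrite lerDr.
have IB : (data_law theta0 (~` B) <=
    ((128 * (V * kap / c ^+ 3) + 1) / p%:R)%:E)%E.
  have -> : data_law theta0 (~` B) = (\int[data_law theta0]_y (\1_(~` B) y)%:E)%E.
    by rewrite integral_indic ?setIT//; exact: measurableC.
  apply: (@le_trans _ _ (\int[data_law theta0]_y
      (\sum_(k < m) (F k y)%:E + (G y)%:E))%E).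
    by apply: le_integral_lower => // y _; rewrite lee_fin indicE.
  rewrite ge0_integralD//; last 4 first.
  - by move=> y _; rewrite sume_ge0// => k _; rewrite lee_fin.
  - by apply: emeasurable_sum => k; exact/measurable_EFinP.
  - by move=> y _; rewrite lee_fin.
  - by rewrite /G; under eq_fun do rewrite EFinM; apply: emeasurable_funM.
  rewrite ge0_integral_sum//; last 2 first.
  - by move=> k; exact/measurable_EFinP.
  - by move=> k y _; rewrite lee_fin.
  apply: le_trans; first by apply: leeD IG; apply: lee_sum => k _; exact: IF.
  rewrite sumEFin -EFinD lee_fin -mulr_sumr [leRHS]mulrDl div1r lerD2r.
  have dd : 0 < d <= 1 by rewrite d0.
  have nA : 0 < n%:R * (A * s) by rewrite mulr_gt0.
  apply: (@le_trans _ _ (64 * V / (c ^+ 2 * (n%:R * (A * s))) * (2 / d))).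
    rewrite ler_wpM2l ?sum_geometric_le//.
    by rewrite divr_ge0 ?mulr_ge0 ?sqr_ge0// ltW.
  have -> : n%:R * (A * s) = A * (p%:R * q) by rewrite mulrCA ns.
  have -> : 64 * V / (c ^+ 2 * (A * (p%:R * q))) * (2 / d) =
      128 * (V * kap / c ^+ 3) / p%:R * A^-1.
    rewrite /d; move: (A) A0 (kap) kap0 => a a0 k k0.
    by field; rewrite !lt0r_neq0.
  apply: ler_piMr; last by rewrite invf_le1// (le_trans A11).
  by rewrite divr_ge0 ?(ltW pR)// mulr_ge0// divr_ge0 ?mulr_ge0 ?exprn_ge0// ltW.
move: IB; rewrite probability_setC// leeBlDr; last exact: fin_num_measure.
move=> IB; rewrite EFinB leeBlDl// addeC.
Qed.

End mmle.

(** * Passage to the limit *)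

Section asymptotics.
Context {R : realType}.
Implicit Types (n p : nat).

Lemma tau_rate_le_sqrt n p : (0 < p)%N -> (0 < n)%N ->
  tau_rate n p <= Num.sqrt (p%:R / n%:R) :> R.
Proof.
move=> p0 n0; have [pR nR] : 0 < p%:R :> R /\ 0 < n%:R :> R by rewrite !ltr0n.
rewrite /tau_rate -[n%:R / p%:R]invf_div; set x := p%:R / n%:R.
have x0 : 0 < x by rewrite divr_gt0.
have xi0 : 0 < x^-1 by rewrite invr_gt0.
have h : ln x^-1 <= x^-1.
  have := @le_ln1Dx R (x^-1 - 1); rewrite subrKC => /(_ _)/wrap[]; first by lra.
  by move/le_trans; apply; lra.
apply: (@le_trans _ _ (x * Num.sqrt x^-1)).
  by rewrite ler_wpM2l ?(ltW x0)// ler_wsqrtr.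
by rewrite sqrtrV ?(ltW x0)// -[X in X * _]sqr_sqrtr ?(ltW x0)// expr2 mulfK// lt0r_neq0// sqrtr_gt0.
Qed.

(** Shows the index set of the suprema and infima to be nonempty, so that they lie on the right side
    of 0 and 1. *)
Lemma nearly_black_nseq0 n p : @nearly_black R n p [tuple of nseq n 0].
Proof.
by rewrite /nearly_black/= eq_card0// => i; rewrite inE tnth_nseq eqxx.
Qed.

(* [c1 .. c5] are the numerical constants of [eb_mass_outside_le]. *)
Let risk_le (n p T a x l C c1 c2 c3 c4 c5 : R) :
  0 <= c1 -> 0 <= c2 -> 0 <= c3 -> 0 <= c4 -> 1 <= p -> 1 <= l -> 0 <= C ->
  n * T * a <= 3 * C * p * l -> n * x = 1 ->
  n * (c1 * T * a + c2 * x) + p * (c3 + (c5 * l + c4)) <=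
  p * l * (3 * C * c1 + c2 + c3 + c4 + c5).
Proof.
move=> c10 c20 c30 c40 p1 l1 C0 nTa nx.
have -> : n * (c1 * T * a + c2 * x) = c1 * (n * T * a) + c2 * (n * x) by ring.
rewrite nx; have pl1 : 1 <= p * l by rewrite -[leLHS]mulr1 ler_pM.
have ppl : p <= p * l by rewrite ler_peMr//; lra.
have h1 : c1 * (n * T * a) <= c1 * (3 * C * p * l) by rewrite ler_wpM2l.
have h2 : c2 * 1 <= c2 * (p * l) by rewrite ler_wpM2l.
have h3 : c3 * p <= c3 * (p * l) by rewrite ler_wpM2l.
have h4 : c4 * p <= c4 * (p * l) by rewrite ler_wpM2l.
have -> : p * (c3 + (c5 * l + c4)) = c3 * p + c5 * (p * l) + c4 * p by ring.
apply: le_trans (lerD (lerD h1 h2) (lerD (lerD h3 (lexx (c5 * (p * l)))) h4)) _.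
by rewrite le_eqVlt; apply/orP; left; apply/eqP; ring.
Qed.

(** The combination of constants in the conclusion of [risk_le]. *)
Let mass_const (C : R) : R := 3 * C * (576 * 8) + 32 + 60 + 4 * (60 * 340) + 4 * 8.

Lemma eb_mass_outside_rate_le n p (theta0 : n.-tuple R) (tau : n.-tuple R -> R)
    (C M : R) : (0 < p)%N -> (p < n)%N -> 1 <= ln n%:R :> R ->
  nearly_black n p theta0 -> measurable_fun [set: borel_tuple R n] tau ->
  (forall y, 0 < tau y) -> 0 < C -> C * tau_rate n p <= 1 -> 0 < M ->
  (eb_mass_outside tau theta0 (M * Num.sqrt (p%:R * ln n%:R)) <=
   (1 - data_law theta0 [set y | (n%:R^-1 <= tau y <= C * tau_rate n p)%R]) +
   (mass_const C / M ^+ 2)%:E)%E.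
Proof.
move=> p0 pn l1 th mtau tau0 C0 T1 M0.
have n1 : (1 < n)%N by exact: leq_ltn_trans p0 pn.
have [pR nR] : 0 < p%:R :> R /\ 0 < n%:R :> R by rewrite !ltr0n p0 ltnW.
have l0 : 0 < ln n%:R :> R by apply: lt_le_trans l1.
have L0 : 0 < ln (n%:R / p%:R) :> R by rewrite ln_gt0// ltr_pdivlMr// mul1r ltr_nat.
have T0 : 0 < C * tau_rate n p.
  by apply: mulr_gt0 => //; rewrite /tau_rate mulr_gt0 ?sqrtr_gt0// divr_gt0.
have pl0 : 0 < p%:R * ln n%:R :> R by rewrite mulr_gt0.
have r0 : 0 < M * Num.sqrt (p%:R * ln n%:R) by rewrite mulr_gt0// sqrtr_gt0.
(* This cut-off makes exp(-a^2/8) equal to 1/n, so the large noise observations cost O(1) in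
   total. *)
have a0 : 0 <= Num.sqrt (8 * ln n%:R) :> R by rewrite sqrtr_ge0.
apply: (le_trans (eb_mass_outside_le n1 th mtau tau0 r0 T1 T0 a0)).
apply: leeD2l; rewrite lee_fin exprMn sqr_sqrtr ?(ltW pl0)//.
rewrite sqr_sqrtr ?mulr_ge0 ?(ltW l0)//.
have -> : 8 * ln n%:R / 8 = ln n%:R :> R by rewrite mulrAC mulfV ?mul1r// pnatr_eq0.
rewrite expRN lnK ?posrE// [4 * _]mulrDr [4 * (8 * _)]mulrA.
have nTa : n%:R * (C * tau_rate n p) * Num.sqrt (8 * ln n%:R) <= 3 * C * p%:R * ln n%:R.
  have -> : n%:R * (C * tau_rate n p) = C * p%:R * Num.sqrt (ln (n%:R / p%:R)).
    by rewrite /tau_rate; field; rewrite lt0r_neq0.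
  have s8 : Num.sqrt (8 * ln n%:R) <= 3 * Num.sqrt (ln n%:R) :> R.
    rewrite sqrtrM// ler_wpM2r ?sqrtr_ge0//.
    rewrite -(@ler_pXn2r _ 2) ?nnegrE ?sqrtr_ge0// sqr_sqrtr//.
    by have -> : 3 ^+ 2 = 9 :> R by [ring]; lra.
  have sL : Num.sqrt (ln (n%:R / p%:R)) <= Num.sqrt (ln n%:R) :> R.
    rewrite ler_wsqrtr// ler_ln ?posrE ?divr_gt0// ler_pdivrMr// ler_peMr ?(ltW nR)//.
    by rewrite ler1n.
  have h : Num.sqrt (ln (n%:R / p%:R)) * Num.sqrt (8 * ln n%:R) <= 3 * ln n%:R :> R.
    have -> : 3 * ln n%:R = Num.sqrt (ln n%:R) * (3 * Num.sqrt (ln n%:R)) :> R.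
      by rewrite mulrCA -expr2 sqr_sqrtr// ltW.
    by rewrite ler_pM ?sqrtr_ge0.
  rewrite -mulrA; have -> : 3 * C * p%:R * ln n%:R = C * p%:R * (3 * ln n%:R) by ring.
  by rewrite ler_wpM2l// mulr_ge0 ?(ltW C0) ?(ltW pR).
rewrite ler_pdivrMl ?mulr_gt0 ?exprn_gt0//.
have -> : M ^+ 2 * (p%:R * ln n%:R) * (mass_const C / M ^+ 2) =
    p%:R * ln n%:R * mass_const C.
  by move: (mass_const C) => K; field; rewrite lt0r_neq0.
apply: risk_le nTa _.
- exact: mulr_ge0 (ler0n _ _) (ler0n _ _).
- exact: ler0n.
- exact: ler0n.
- by apply: mulr_ge0 (ler0n _ _) (mulr_ge0 (ler0n _ _) (ler0n _ _)).
- by rewrite ler1n.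
- exact: l1.
- exact: ltW.
- by rewrite divff// lt0r_neq0.
Qed.

(** The bound of [eb_mass_outside_rate_le] depends on theta0 only through the probability of the
    event. The supremum is thus squeezed between 0 and one minus the infimum of these probabilities
    plus a term of order 1 / M_n^2. *)
Lemma contraction_of_rate (p : nat -> nat) (tau : forall n, n.-tuple R -> R) (C : R)
    (M : nat -> R) : (forall n, (0 < p n)%N) ->
  (fun n => (p n)%:R / n%:R : R) @ \oo --> (0 : R) ->
  (forall n, measurable_fun [set: borel_tuple R n] (tau n)) ->
  (forall n y, (0 < n)%N -> 0 < tau n y) -> 0 < C ->
  (fun n => ereal_inf
    [set data_law theta0
       [set y | n%:R^-1 <= tau n y <= C * tau_rate n (p n)]
     | theta0 in nearly_black n (p n)]) @ \oo --> (1 : \bar R)%E ->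
  M @ \oo --> +oo ->
  (fun n => ereal_sup
    [set eb_mass_outside (tau n) theta0
           (M n * Num.sqrt ((p n)%:R * ln n%:R))
     | theta0 in nearly_black n (p n)]) @ \oo --> (0 : \bar R)%E.
Proof.
move=> p0 sparse mtau tau0 C0 rate Moo.
set Q := fun n => ereal_inf _ in rate.
apply: (@squeeze_cvge _ _ _ R (cst 0%E)
  _ (fun n => 1 - Q n + (mass_const C / M n ^+ 2)%:E)%E); last 2 first.
- exact: cvg_cst.
- rewrite -[X in _ --> X]adde0 -[X in (X + 0)%E](_ : 1 - 1 = _)%E; last by rewrite subee.
  apply: cvgeD => //; first by apply: cvgeB => //; exact: cvg_cst.
  apply: cvg_EFin; first exact: nearW.
  have iM : (fun n => (M n)^-1) @ \oo --> 0.
    by apply/gtr0_cvgV0 => //; move/cvgryPgt: Moo; exact.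
  rewrite [X in X @ _](_ : _ = fun n => mass_const C * ((M n)^-1 * (M n)^-1)); last first.
    by apply/funext => n /=; rewrite expr2 invfM.
  have -> : 0 = mass_const C * (0 * 0) :> R by rewrite !mulr0.
  by apply: cvgM; [exact: cvg_cst|exact: cvgM].
have lnoo : \forall n \near \oo, expR 1 <= n%:R :> R by exact: nbhs_infty_ger.
have M0 : \forall n \near \oo, 0 < M n by move/cvgryPgt: Moo; exact.
have x1 : \forall n \near \oo, (p n)%:R / n%:R < 1 :> R by exact: cvgr_lt sparse _ ltr01.
(* With [tau_rate_le_sqrt] this gives [C * tau_rate n (p n) <= 1], the range where the moment bounds
   hold. *)
have xC : \forall n \near \oo, (p n)%:R / n%:R <= C^-1 ^+ 2 :> R.
  by apply: cvgr_le sparse _ _; rewrite exprn_gt0// invr_gt0.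
near=> n.
have e1 : expR 1 <= n%:R :> R by near: n.
have nR : 0 < n%:R :> R by apply: lt_le_trans e1; exact: expR_gt0.
have n0 : (0 < n)%N by rewrite -(ltr0n R).
have l1 : 1 <= ln n%:R :> R by rewrite -ler_expR lnK.
have pn : (p n < n)%N.
  by rewrite -(ltr_nat R) -[ltRHS]mul1r -ltr_pdivrMr//; near: n.
have T1 : C * tau_rate n (p n) <= 1.
  rewrite mulrC -ler_pdivlMr// mul1r; apply: (le_trans (tau_rate_le_sqrt (p0 n) n0)).
  have Ci : 0 <= C^-1 by rewrite invr_ge0 ltW.
  rewrite -[leRHS]ger0_norm// -sqrtr_sqr ler_wsqrtr//.
  by near: n.
apply/andP; split.
  apply: le_ereal_sup_tmp; exists (eb_mass_outside (tau n) [tuple of nseq n 0]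
      (M n * Num.sqrt ((p n)%:R * ln n%:R))).
    exists [tuple of nseq n 0] => //; exact: nearly_black_nseq0.
  by apply: integral_ge0 => y _; apply: posterior_ge0; exact: tau0.
apply: ge_ereal_sup => _ [theta0 th <-].
apply: le_trans (eb_mass_outside_rate_le (p0 n) pn l1 th (mtau n) (fun y => tau0 n y n0) C0 T1 _) _.
  by near: n.
rewrite leeD2r// leeB//; apply: ge_ereal_inf.
by exists (data_law theta0 [set y | n%:R^-1 <= tau n y <= C * tau_rate n (p n)]) => //; exists theta0.
Unshelve. all: by end_near. Qed.

End asymptotics.

(** The probability bound 1 - K / p of [mmle_le_rate] is uniform over theta0 and tends to 1 with p;
    sparsity eventually gives 2 p <= n and ln(n/p) >= 1. *)
Lemma mmle_rate (R : realType) (p : nat -> nat) (tau : forall n, n.-tuple R -> R) :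
  (forall n, (0 < p n)%N) ->
  (fun n => (p n)%:R : R) @ \oo --> +oo ->
  (fun n => (p n)%:R / n%:R : R) @ \oo --> (0 : R) ->
  (forall n, measurable_fun [set: borel_tuple R n] (tau n)) ->
  (forall n, is_mmle (tau n)) ->
  exists2 A : R, 0 < A &
    (fun n => ereal_inf
      [set data_law theta0
         [set y | n%:R^-1 <= tau n y <= A * tau_rate n (p n)]
       | theta0 in nearly_black n (p n)]) @ \oo --> (1 : \bar R)%E.
Proof.
move=> p0 poo sparse mtau mmle; have [A [K [A0 K0 AK]]] := @mmle_le_rate R.
exists A => //.
apply: (@squeeze_cvge _ _ _ R (fun n => (1 - K / (p n)%:R)%:E) _ (cst 1%E)); last 2 first.
- apply: cvg_EFin; first exact: nearW.
  rewrite [X in X @ _](_ : _ = fun n => 1 - K * ((p n)%:R)^-1); last by apply/funext.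
  have h : (fun n => 1 - K * ((p n)%:R)^-1) @ \oo --> 1 - K * 0.
    apply: cvgB; first exact: cvg_cst.
    apply: cvgM; first exact: cvg_cst.
    by apply/gtr0_cvgV0 => //; apply: nearW => n; rewrite ltr0n.
  by rewrite mulr0 subr0 in h.
- exact: cvg_cst.
have e0 : 0 < expR (-1) :> R by exact: expR_gt0.
have x2 : \forall n \near \oo, (p n)%:R / n%:R <= 2^-1 :> R.
  by apply: cvgr_le sparse _ _.
have xe : \forall n \near \oo, (p n)%:R / n%:R <= expR (-1) :> R.
  by apply: cvgr_le sparse _ _.
near=> n.
have n0 : (0 < n)%N by near: n; exact: nbhs_infty_gt.
have [pR nR] : 0 < (p n)%:R :> R /\ 0 < n%:R :> R by rewrite !ltr0n p0.
have pn : (2 * p n <= n)%N.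
  rewrite -(ler_nat R) natrM mulrC -ler_pdivlMr// mulrC -ler_pdivrMr//.
  by near: n.
have L1 : 1 <= ln (n%:R / (p n)%:R) :> R.
  rewrite -ler_expR lnK ?posrE ?divr_gt0// -[leRHS]invf_div -[leLHS]invrK -expRN.
  by rewrite lef_pV2 ?posrE ?divr_gt0//; near: n.
have s1 : tau_rate n (p n) <= 1 :> R.
  apply: (le_trans (tau_rate_le_sqrt (p0 n) n0)); rewrite -[leRHS]sqrtr1 ler_wsqrtr//.
  rewrite ler_pdivrMr// mul1r ler_nat; apply: leq_trans pn.
  by rewrite leq_pmull.
apply/andP; split.
  by apply: le_ereal_inf_tmp => _ [theta0 th <-]; apply: AK.
apply: ge_ereal_inf; exists (data_law [tuple of nseq n 0]
    [set y | n%:R^-1 <= tau n y <= A * tau_rate n (p n)]).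
  exists [tuple of nseq n 0] => //; exact: nearly_black_nseq0.
by apply: probability_le1; exact: (measurable_preimage_cc _ _ (mtau n)).
Unshelve. all: by end_near. Qed.


Theorem theorem3p2 (R : realType) (p : nat -> nat)
    (p_gt0 : forall n, (0 < p n)%N)
    (p_oo : (fun n => (p n)%:R : R) @ \oo --> +oo)
    (p_sparse : (fun n => (p n)%:R / n%:R : R) @ \oo --> (0 : R)) :
  (forall tauhat : forall n, n.-tuple R -> R,
    (forall n, measurable_fun [set: borel_tuple R n] (tauhat n)) ->
    (forall n y, 0 < tauhat n y) ->
    (exists2 C : R, 0 < C &
      (fun n => ereal_inf
        [set data_law theta0
           [set y | n%:R^-1 <= tauhat n y <= C * tau_rate n (p n)]
         | theta0 in nearly_black n (p n)]) @ \oo --> (1 : \bar R)%E) ->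
    forall M : nat -> R, M @ \oo --> +oo ->
      (fun n => ereal_sup
        [set eb_mass_outside (tauhat n) theta0
               (M n * Num.sqrt ((p n)%:R * ln n%:R))
         | theta0 in nearly_black n (p n)]) @ \oo --> (0 : \bar R)%E) /\
  (forall tauM : forall n, n.-tuple R -> R,
    (forall n, measurable_fun [set: borel_tuple R n] (tauM n)) ->
    (forall n, is_mmle (tauM n)) ->
    forall M : nat -> R, M @ \oo --> +oo ->
      (fun n => ereal_sup
        [set eb_mass_outside (tauM n) theta0
               (M n * Num.sqrt ((p n)%:R * ln n%:R))
         | theta0 in nearly_black n (p n)]) @ \oo --> (0 : \bar R)%E).
Proof.
split=> [tauhat mtau tau0 [C C0 rate]|tauM mtau mmle] M Moo.
  by apply: contraction_of_rate C0 rate Moo.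
have [A A0 rate] := mmle_rate p_gt0 p_oo p_sparse mtau mmle.
apply: contraction_of_rate A0 rate Moo => // n y n0.
(* Positivity comes from the lower end 1/n of the search interval. At [n = 0] that end is 0, which
   is why [contraction_of_rate] asks for positivity only when [0 < n]. *)
have [/andP[+ _] _] := mmle n y; apply: lt_le_trans.
by rewrite invr_gt0 ltr0n.
Qed.
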